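(* Let $\alpha<\beta$, $\Omega:=(\alpha,\beta)$, $b\in C(\overline\Omega)$, $0\le c\in L^\infty(\Omega)$, and $Lu:=-u''+b(x)u'+c(x)u$. Let $m\in L^2(\Omega)$ be a function that changes sign in $\Omega$, let $M^+:=\{x\in\Omega: m(x)\ge0\}$, and suppose that $m\in C(M^+)$ and $m^+\not\equiv0$. Let $\mathcal P$ be the set of $p\in(0,1)$ such that the problem $$Lu=m u^p\text{ in }\Omega,\qquad u>0\text{ in }\Omega,\qquad u=0\text{ on }\partial\Omega$$ admits some solution $u\in W^{2,2}(\Omega)$. Then either $\mathcal P=(0,1)$, or there exists $p_*\in(0,1)$ such that $\mathcal P=(p_*,1)$ or $\mathcal P=[p_*,1)$.
   Context: $m^+=\max(m,0)$ and $m^-=\max(-m,0)$; ''$m$ changes sign in $\Omega$'' means that neither $m^+$ nor $m^-$ vanishes a.e. in $\Omega$. $m\in C(M^+)$ means that the restriction of $m$ to $M^+$ is continuous. A solution of the problem is a function $u\in W^{2,2}(\Omega)\cap W^{1,2}_0(\Omega)$ with $u(x)>0$ for all $x\in\Omega$ satisfying the equation for a.e. $x\in\Omega$. *)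

(* Defs.v *)
From HB Require Import structures.
From mathcomp Require Import all_boot all_order all_algebra.
From mathcomp Require Import all_classical all_reals all_analysis.
Set Implicit Arguments.
Unset Strict Implicit.
Unset Printing Implicit Defensive.
Import Order.TTheory GRing.Theory Num.Theory.
Import numFieldNormedType.Exports.
Local Open Scope classical_set_scope.
Local Open Scope ring_scope.

Section Sobolev.
Context {R : realType}.
Implicit Types (D : set R) (f u v phi : R -> R).
Local Notation mu := (@lebesgue_measure R).

(* Lebesgue (not only Borel) measurable functions are covered: [f] has to agree
   a.e. on [D] with a Borel function of finite norm. The values of [f] outside
   [D] are irrelevant. *)
Definition Lp D (p : \bar R) f : Prop :=
  exists2 g : R -> R, g \in Lfun mu p & {ae mu, forall x, D x -> f x = g x}.

(* C_c^oo(D), as functions on the whole line vanishing off a compact of [D]. *)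
Definition test_function D phi : Prop :=
  (forall n x, derivable (phi^`(n))%classic x 1) /\
  exists K : set R, [/\ compact K, K `<=` D & forall x, ~ K x -> phi x = 0].

(* Only meaningful for [u] and [v] locally integrable on [D]. *)
Definition weak_derivative D (k : nat) u v : Prop :=
  forall phi, test_function D phi ->
    \int[mu]_(x in D) (u x * (phi^`(k))%classic x) =
    (- 1) ^+ k * \int[mu]_(x in D) (v x * phi x).

(* W^{k,2}(D) *)
Definition sobolev D (k : nat) u : Prop :=
  Lp D 2%:E u /\
  forall j, (j <= k)%N -> exists2 v, Lp D 2%:E v & weak_derivative D j u v.

(* W^{1,2}_0(D), the closure of C_c^oo(D) in W^{1,2}(D); [u'] is the weak
   derivative of [u]. *)
Definition sobolev0 D u : Prop :=
  Lp D 2%:E u /\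
  exists u', [/\ Lp D 2%:E u', weak_derivative D 1 u u' &
    forall e : R, 0 < e -> exists2 phi, test_function D phi &
      (\int[mu]_(x in D)
         ((u x - phi x) ^+ 2 + (u' x - (phi^`())%classic x) ^+ 2)%:E < (e ^+ 2)%:E)%E].

Definition ae_zero D f : Prop := {ae mu, forall x, D x -> f x = 0}.

Definition changes_sign D (m : R -> R) : Prop :=
  ~ ae_zero D (m^\+) /\ ~ ae_zero D (m^\-).

(* Positive solutions of - u'' + b u' + c u = m u^p in D, u = 0 on the boundary.
   An element of W^{2,2} of an interval is identified with its continuous
   representative, so that positivity at every point of [D] makes sense. *)
Definition solution D (b c m : R -> R) (p : R) u : Prop :=
  [/\ {within D, continuous u},
      sobolev D 2 u,
      sobolev0 D u,
      forall x, D x -> 0 < u x &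
      exists u1 u2 : R -> R,
        [/\ Lp D 2%:E u1, weak_derivative D 1 u u1,
            Lp D 2%:E u2, weak_derivative D 2 u u2 &
            {ae mu, forall x, D x ->
               - u2 x + b x * u1 x + c x * u x = m x * u x `^ p}]].

Definition solvable_exponents D (b c m : R -> R) : set R :=
  [set p | 0 < p < 1 /\ exists u, solution D b c m p u].

End Sobolev.

(* Main.v *)
Require Import Defs.
From HB Require Import structures.
From mathcomp Require Import all_boot all_order all_algebra.
From mathcomp Require Import all_classical all_reals all_analysis.
From mathcomp Require Import measurable_realfun ess_sup_inf.
From mathcomp Require Import ring lra.
Set Implicit Arguments.
Unset Strict Implicit.
Unset Printing Implicit Defensive.
Import Order.TTheory GRing.Theory Num.Theory.
Import numFieldNormedType.Exports.
Local Open Scope classical_set_scope.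
Local Open Scope ring_scope.

(** Put [k = exp(int b)] and [W = u' / k]. By du Bois-Reymond's lemma a solution
    is a pair of absolutely continuous functions with [u' = k W] and
    [W' = (c u - m u^p) / k], and [u = 0] at both end points; conversely such a
    pair is a solution, the closure of the test functions being reached by
    approximating [u'] by smooth bumps.

    For [0 < q < 1] a positive subsolution yields a solution: truncate [s^q] in
    the term with [m^-] to a Lipschitz function and iterate down from a large
    supersolution to the maximal solution; it stays above the subsolution, and
    these maximal solutions decrease to a solution as the truncation is removed.

    If [u] solves the problem with exponent [p < q], then [t u^((1-p)/(1-q))] is
    a subsolution for [q] for a suitable [t > 0], so the set of exponents is
    upward closed in ]0, 1[. It is nonempty: at a Lebesgue point of [m] where
    [m > 0], a linear problem concentrated near that point provides a
    subsolution for exponents close to [1]. *)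

(** Dividing by [k] puts [- u'' + b u'] in the divergence form [- k (u'/k)'] without differentiating
    [b], and comparison then only needs monotonicity of [W]. The truncation is forced by [s^q] not
    being Lipschitz at 0: no multiple [l s] makes [l s - s^q] nondecreasing there, whereas
    [l s - min (s^q) (l s)] is nondecreasing, so the iteration is monotone. The subsolution keeps
    the limits positive, and this removes the truncation at every interior point. The delicate point
    is nonemptiness: the term with [m^-] acts up to the boundary and could destroy positivity there.
    For [p = 1 - e] one has [w^p <= e + w], so this term is a linear potential plus a perturbation
    of size [e]. The latter is absorbed because solutions of one linear operator with nonnegative,
    nontrivial sources are all comparable, up to the boundary, to a single function [d]. The
    potential has strength of order [r^-2] on an interval of radius [r], hence is not small by
    itself; the small mean oscillation of [m] at the Lebesgue point makes its effect negligible. *)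

(* Sealed: conversion on two different integrals would not terminate in practice. *)
HB.lock Definition I {R : realType} (a b : R) (f : R -> R) : R :=
  \int[@lebesgue_measure R]_(t in `[a, b]) f t.

Lemma IE {R : realType} (a b : R) f :
  I a b f = \int[@lebesgue_measure R]_(t in `[a, b]) f t.
Proof. by rewrite unlock. Qed.

(** * Lebesgue integrals over compact intervals *)

Section Integration.
Context {R : realType}.
Local Notation mu := (@lebesgue_measure R).
Implicit Types (a b c x y t : R) (f g h u v F G : R -> R).

Definition itg a b f := mu.-integrable `[a, b] (EFin \o f).
Lemma itg_sub a b x y f : a <= x -> y <= b -> itg a b f -> itg x y f.
Proof.
move=> ax yb; apply: integrableS => //.
by apply: subset_itv; rewrite bnd_simp.
Qed.

Lemma itg_measurable a b f : itg a b f -> measurable_fun `[a, b] f.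
Proof. by move=> /integrableP[/measurable_EFinP]. Qed.

Lemma itg_le a b f g : measurable_fun `[a, b] f -> itg a b g ->
  (forall x, a <= x <= b -> `|f x| <= `|g x|) -> itg a b f.
Proof.
move=> mf ig fg; by apply: (le_integrable _ _ _ ig) => //; exact/measurable_EFinP.
Qed.

Lemma itg_cst a b (k : R) : itg a b (fun=> k).
Proof.
apply: measurable_bounded_integrable => //=.
  by rewrite lebesgue_measure_itv/=; case: ifP => //= _; rewrite -EFinB ltry.
by exists `|k|; split; rewrite ?num_real// => M kM x _ /=; exact: ltW.
Qed.

Lemma itgD a b f g : itg a b f -> itg a b g -> itg a b (fun x => f x + g x).
Proof. by move=> fi gi; apply: (integrableD _ fi gi). Qed.

Lemma itgN a b f : itg a b f -> itg a b (fun x => - f x).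
Proof. by move=> fi; rewrite /itg (_ : _ \o _ = -%E \o (EFin \o f))//; exact: integrableN. Qed.

Lemma itgB a b f g : itg a b f -> itg a b g -> itg a b (fun x => f x - g x).
Proof. by move=> fi gi; apply: itgD => //; exact: itgN. Qed.

Lemma itgZ a b (k : R) f : itg a b f -> itg a b (fun x => k * f x).
Proof. by move=> fi; apply: (integrableZl _ k fi). Qed.

Lemma itg_norm a b f : itg a b f -> itg a b (fun x => `|f x|).
Proof. by move=> fi; exact: integrable_norm. Qed.

Lemma itg_bounded a b (M : R) f : measurable_fun `[a, b] f ->
  (forall x, a <= x <= b -> `|f x| <= M) -> itg a b f.
Proof.
move=> mf fM; apply: itg_le (itg_cst a b M) _ => // x xab.
by rewrite (le_trans (fM _ xab))// ler_norm.
Qed.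

Lemma itgM_bounded a b (M : R) f g : measurable_fun `[a, b] g ->
  (forall x, a <= x <= b -> `|g x| <= M) ->
  itg a b f -> itg a b (fun x => f x * g x).
Proof.
move=> mg gM fi; apply: (@itg_le _ _ _ (fun x => M * f x)).
- by apply: measurable_funM => //; exact: itg_measurable.
- exact: itgZ.
- move=> x xab; rewrite normrM [leRHS]normrM mulrC ler_wpM2r//.
  by rewrite (le_trans (gM _ xab))// ler_norm.
Qed.

Lemma I_ext a b f g : (forall x, a <= x <= b -> f x = g x) -> I a b f = I a b g.
Proof. by move=> fg; rewrite !IE; apply: eq_Rintegral => x; rewrite inE/= in_itv/=; exact: fg. Qed.

Lemma itg_ext a b f g : (forall x, a <= x <= b -> f x = g x) ->
  itg a b f -> itg a b g.
Proof.
move=> fg; apply: eq_integrable => // x; rewrite inE/= in_itv/= => /fg.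
by move=> ->.
Qed.

Lemma I_D a b f g : itg a b f -> itg a b g ->
  I a b (fun x => f x + g x) = I a b f + I a b g.
Proof. by rewrite !IE; exact: RintegralD. Qed.

Lemma I_B a b f g : itg a b f -> itg a b g ->
  I a b (fun x => f x - g x) = I a b f - I a b g.
Proof. by rewrite !IE; exact: RintegralB. Qed.

Lemma I_Z a b (k : R) f : itg a b f -> I a b (fun x => k * f x) = k * I a b f.
Proof. by rewrite !IE; exact: RintegralZl. Qed.

Lemma I_N a b f : itg a b f -> I a b (fun x => - f x) = - I a b f.
Proof.
by move=> fi; rewrite -mulN1r -I_Z//; apply: I_ext => x _; rewrite mulN1r.
Qed.

Lemma I_ge0 a b f : (forall x, a <= x <= b -> 0 <= f x) -> 0 <= I a b f.
Proof. by move=> f0; rewrite IE; apply: Rintegral_ge0 => x; rewrite /= in_itv/=; exact: f0. Qed.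

Lemma I_le a b f g : itg a b f -> itg a b g ->
  (forall x, a <= x <= b -> f x <= g x) -> I a b f <= I a b g.
Proof.
by move=> fi gi fg; rewrite !IE; apply: le_Rintegral => // x; rewrite /= in_itv/=; exact: fg.
Qed.

Lemma I_norm a b f : itg a b f -> `|I a b f| <= I a b (fun x => `|f x|).
Proof. by rewrite !IE; exact: le_normr_Rintegral. Qed.

Lemma I_cst a b (k : R) : a <= b -> I a b (fun=> k) = k * (b - a).
Proof.
move=> ab; rewrite !IE Rintegral_cst//= lebesgue_measure_itv/= lte_fin.
by move: ab; rewrite le_eqVlt => /predU1P[->|->//]; rewrite ltxx subrr/= mulr0.
Qed.

Lemma I_cst0 a b : I a b (fun=> 0) = 0.
Proof.
have [ab|ba] := leP a b; first by rewrite I_cst// mul0r.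
by rewrite IE set_itv_ge ?Rintegral_set0// bnd_simp -ltNge.
Qed.

Lemma I_xx a f : I a a f = 0.
Proof. by rewrite !IE set_itv1 Rintegral_set1. Qed.

Lemma I_empty a b f : b < a -> I a b f = 0.
Proof.
move=> ba; rewrite !IE set_itv_ge ?Rintegral_set0//.
by rewrite bnd_simp -ltNge.
Qed.

Lemma I_split a b c f : a <= b -> b <= c -> itg a c f ->
  I a c f = I a b f + I b c f.
Proof.
move=> ab bc fi; apply/eqP; rewrite addrC -subr_eq; apply/eqP.
rewrite !IE Rintegral_itvB// ?bnd_simp//.
apply: Rintegral_itv_obnd_cbnd; apply: integrableS fi => //.
by apply: subset_itv; rewrite bnd_simp.
Qed.

Lemma I_ge0_mono a b x y f : a <= x -> y <= b -> itg a b f ->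
  (forall x, a <= x <= b -> 0 <= f x) -> I x y f <= I a b f.
Proof.
move=> ax yb fi f0.
have [xy|yx] := leP x y; last by rewrite I_empty// I_ge0.
have xb := le_trans xy yb.
rewrite (@I_split a x b)// (@I_split x y b)//; last exact: itg_sub fi.
rewrite addrCA lerDl addr_ge0// I_ge0// => t /andP[t1 t2]; apply: f0.
  by rewrite t1/= (le_trans t2).
by rewrite t2 andbT (le_trans ax)// (le_trans xy).
Qed.

Lemma I_small a b (e : R) f : itg a b f -> 0 < e ->
  exists2 d : R, 0 < d & forall x y, a <= x -> x <= y -> y <= b -> y - x < d ->
    I x y (fun t => `|f t|) < e.
Proof.
move=> fi e0.
have : mu.-integrable setT (EFin \o f \_ `[a, b]).
  by rewrite -restrict_EFin; apply/integrable_restrict => //=; rewrite setTI.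
move=> /integral_normr_continuous /(_ _ e0)[d [d0 /= H]].
exists d => // x y ax xy yb yxd.
have := H [set` `[x, y]] (measurable_itv _).
rewrite lebesgue_measure_itv/= lte_fin.
have -> : ((if (x < y)%R then (y%:E - x%:E)%E else 0%E) < d%:E)%E.
  by case: ifP; rewrite ?lte_fin.
move=> /(_ isT); apply: le_lt_trans; rewrite le_eqVlt; apply/orP; left; apply/eqP.
rewrite IE; apply: eq_Rintegral => t; rewrite inE/= in_itv/= => /andP[t1 t2].
by rewrite patchE mem_set//= in_itv/= (le_trans ax t1) (le_trans t2 yb).
Qed.

Lemma I_dominated a b (f_ : nat -> R -> R) f h :
  (forall n, measurable_fun `[a, b] (f_ n)) ->
  (forall x, a <= x <= b -> f_ ^~ x @ \oo --> f x) ->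
  itg a b h -> (forall n x, a <= x <= b -> `|f_ n x| <= h x) ->
  itg a b f /\ (fun n => I a b (f_ n)) @ \oo --> I a b f.
Proof.
move=> mf cf hi fh.
have cf' x : `[a, b]%classic x -> f_ ^~ x @ \oo --> f x.
  by rewrite /= in_itv/= => xab; exact: cf.
have mf' : measurable_fun `[a, b] f by apply: measurable_fun_cvg cf'.
have mD : measurable [set` `[a, b]] by [].
have mEf n : measurable_fun `[a, b] (EFin \o f_ n).
  exact/measurable_EFinP.
have mEf' : measurable_fun `[a, b] (EFin \o f).
  exact/measurable_EFinP.
have [|||fi _ H] := @dominated_convergence _ _ _ (@lebesgue_measure R)
    `[a, b] mD (fun n => EFin \o f_ n) (EFin \o f) (EFin \o h) mEf mEf'.
- by apply: aeW => x xab; apply/fine_cvgP; split; [exact: nearW|exact: cf'].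
- exact: hi.
- apply: aeW => x n; rewrite /= in_itv/= => xab.
  by rewrite lee_fin; exact: fh.
split=> //; have -> : (fun n => I a b (f_ n)) =
    (fun n => \int[@lebesgue_measure R]_(x in `[a, b]) f_ n x).
  by apply/funext => n; rewrite IE.
rewrite IE; apply: fine_cvg.
by rewrite /Rintegral fineK//; exact: integrable_fin_num.
Qed.

End Integration.
#[global] Opaque itg.

Lemma within_continuousP {R : realType} (A : set R) (F : R -> R) :
  {within A, continuous F} <-> (forall x, A x -> forall e : R, 0 < e ->
    exists2 d : R, 0 < d & forall y, A y -> `|x - y| < d -> `|F x - F y| < e).
Proof.
split=> [/subspace_continuousP cF x Ax e e0|H].
  have /cvgrPdist_lt /(_ _ e0) := cF x Ax.
  move=> -[d /= d0 h].
  by exists d => // y Ay xyd; exact: h.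
apply/subspace_continuousP => x Ax; apply/cvgrPdist_lt => e e0.
have [d d0 h] := H x Ax e e0.
rewrite near_withinE; near=> y => Ay.
by apply: h => //; near: y; apply/nbhs_ballP; exists d.
Unshelve. all: by end_near. Qed.

(** * Absolutely continuous functions *)

Section AbsolutelyContinuous.
Context {R : realType}.
Local Notation mu := (@lebesgue_measure R).
Implicit Types (a b c x y t : R) (f g h u v F G : R -> R).

Definition ucont a b F := forall e : R, 0 < e -> exists2 d : R, 0 < d &
  forall x y, a <= x -> x <= y -> y <= b -> y - x < d -> `|F y - F x| < e.

Lemma ucont_continuous a b F : ucont a b F -> {within `[a, b], continuous F}.
Proof.
move=> Fu; apply/within_continuousP => x/=; rewrite in_itv/= => /andP[ax xb] e.
move=> /Fu[d d0 H]; exists d => // y; rewrite /= in_itv/= => /andP[ay yb].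
have [xy|/ltW yx] := leP x y.
  by rewrite ler0_norm ?subr_le0// opprB distrC; exact: H.
by rewrite ger0_norm ?subr_ge0//; exact: H.
Qed.

Lemma continuous_measurable a b F : {within `[a, b], continuous F} ->
  measurable_fun `[a, b] F.
Proof. by move=> cF; exact: subspace_continuous_measurable_fun. Qed.

Lemma continuous_bounded a b F : {within `[a, b], continuous F} ->
  exists2 M : R, 0 <= M & forall x, a <= x <= b -> `|F x| <= M.
Proof.
have [ab|ba] := leP a b; last first.
  by exists 0 => // x /andP[ax xb]; move: (le_trans ax xb); rewrite leNgt ba.
move=> cF; have cN : {within `[a, b], continuous (fun x => `|F x|)}.
  by move=> x; apply: continuous_comp; [exact: cF|exact: norm_continuous].
have [c _ H] := EVT_max ab cN.
by exists `|F c| => // x xab; apply: H; rewrite in_itv.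
Qed.

Lemma continuous_itg a b F : {within `[a, b], continuous F} -> itg a b F.
Proof.
move=> cF; have [M _ FM] := continuous_bounded cF.
by apply: itg_bounded FM; exact: continuous_measurable.
Qed.

Lemma itgM_continuous a b f F : itg a b f -> {within `[a, b], continuous F} ->
  itg a b (fun x => f x * F x).
Proof.
move=> fi cF; have [M _ FM] := continuous_bounded cF.
by apply: itgM_bounded FM _ => //; exact: continuous_measurable.
Qed.

(** Absolute continuity through the fundamental theorem of calculus, with the density carried along.
    Derivatives almost everywhere are thereby avoided, and an equation is an equality of
    densities. *)
Definition AC a b F f := itg a b f /\
  forall x y, a <= x -> x <= y -> y <= b -> F y - F x = I x y f.

Lemma AC_sub a b x y F f : a <= x -> y <= b -> AC a b F f -> AC x y F f.
Proof.
move=> ax yb [fi H]; split; first exact: itg_sub fi.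
by move=> s t xs st ty; apply: H => //; [exact: le_trans xs|exact: le_trans yb].
Qed.

Lemma AC_ext a b F G f g : (forall x, a <= x <= b -> F x = G x) ->
  (forall x, a <= x <= b -> f x = g x) -> AC a b F f -> AC a b G g.
Proof.
move=> FG fg [fi H]; split; first exact: itg_ext fi.
move=> x y ax xy yb; rewrite -!FG ?(ax, yb, le_trans xy, le_trans ax)//.
rewrite H//; apply: I_ext => t /andP[xt ty]; apply: fg.
by rewrite (le_trans ax xt) (le_trans ty yb).
Qed.

Lemma AC_cst a b (k : R) : AC a b (fun=> k) (fun=> 0).
Proof.
split; first exact: itg_cst.
by move=> x y _ xy _; rewrite subrr I_cst// mul0r.
Qed.

Lemma AC_D a b F G f g : AC a b F f -> AC a b G g ->
  AC a b (fun x => F x + G x) (fun x => f x + g x).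
Proof.
move=> [fi HF] [gi HG]; split; first exact: itgD.
move=> x y ax xy yb; rewrite I_D; [|exact: itg_sub fi|exact: itg_sub gi].
by rewrite -HF// -HG// opprD addrACA.
Qed.

Lemma AC_Z a b (k : R) F f : AC a b F f ->
  AC a b (fun x => k * F x) (fun x => k * f x).
Proof.
move=> [fi HF]; split; first exact: itgZ.
by move=> x y ax xy yb; rewrite I_Z; [rewrite -mulrBr HF|exact: itg_sub fi].
Qed.

Lemma AC_B a b F G f g : AC a b F f -> AC a b G g ->
  AC a b (fun x => F x - G x) (fun x => f x - g x).
Proof.
move=> FA GA; have := AC_D FA (AC_Z (-1) GA); apply: AC_ext => x _;
  by rewrite mulN1r.
Qed.

Lemma AC_int a b f : itg a b f -> AC a b (fun x => I a x f) f.
Proof.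
move=> fi; split=> // x y ax xy yb.
by rewrite (@I_split _ a x y)//; [rewrite addrC addKr|exact: itg_sub fi].
Qed.

Lemma AC_ucont a b F f : AC a b F f -> ucont a b F.
Proof.
move=> [fi HF] e e0; have [d d0 H] := I_small fi e0.
exists d => // x y ax xy yb xyd; rewrite HF//; apply: le_lt_trans (H _ _ ax xy yb xyd).
by apply: I_norm; exact: itg_sub fi.
Qed.

Lemma AC_continuous a b F f : AC a b F f -> {within `[a, b], continuous F}.
Proof. by move=> /AC_ucont/ucont_continuous. Qed.

Lemma AC_itg a b F f : AC a b F f -> itg a b F.
Proof. by move=> /AC_continuous/continuous_itg. Qed.

(* Cutting [x, y] into equal pieces sums the local estimate to [e * I x y h]. *)
Lemma additive_eq0 a b (E : R -> R -> R) h : itg a b h ->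
  (forall x y z, a <= x -> x <= y -> y <= z -> z <= b -> E x z = E x y + E y z) ->
  (forall e : R, 0 < e -> exists2 d : R, 0 < d & forall x y,
     a <= x -> x <= y -> y <= b -> y - x < d -> `|E x y| <= e * I x y h) ->
  forall x y, a <= x -> x <= y -> y <= b -> E x y = 0.
Proof.
move=> hi addE smallE x y ax xy yb.
suff H e : 0 < e -> `|E x y| <= e * I x y h.
  apply/eqP; rewrite -normr_le0; apply/ler_addgt0Pl => e e0; rewrite addr0.
  have K0 : 0 < `|I x y h| + 1 by rewrite ltr_wpDl.
  apply: le_trans (H (e / (`|I x y h| + 1)) (divr_gt0 e0 K0)) _.
  rewrite mulrAC ler_pdivrMr//; apply: ler_wpM2l; first exact: ltW.
  by rewrite (le_trans (ler_norm _))// lerDl.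
move=> e0; have [d d0 Hd] := smallE e e0.
pose N := (Num.truncn ((y - x) / d)).+1.
have N0 : 0 < N%:R :> R by rewrite ltr0n.
pose s := (y - x) / N%:R.
have xy' : 0 <= y - x by rewrite subr_ge0.
have s0 : 0 <= s by rewrite divr_ge0 ?subr_ge0// ltW.
have sd : s < d.
  rewrite /s ltr_pdivrMr// mulrC -ltr_pdivrMr//.
  by have /andP[] := truncn_itv (divr_ge0 (xy' : 0 <= y - x) (ltW d0)).
have sN : N%:R * s = y - x by rewrite /s mulrC divfK ?gt_eqF.
have tN k : (k <= N)%N -> x + k%:R * s <= y.
  move=> kN; rewrite -lerBrDl -sN ler_wpM2r//.
  by rewrite ler_nat.
have tx k : x <= x + k%:R * s by rewrite lerDl mulr_ge0.
have tS k : x + k.+1%:R * s = x + k%:R * s + s by rewrite -natr1 mulrDl mul1r addrA.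
have E0 z : a <= z -> z <= b -> E z z = 0.
  move=> az zb; have := addE z z z az (lexx _) (lexx _) zb.
  by move/eqP; rewrite -subr_eq0 opprD addrA subrr add0r oppr_eq0 => /eqP.
suff H k : (k <= N)%N -> `|E x (x + k%:R * s)| <= e * I x (x + k%:R * s) h.
  by have := H N (leqnn N); rewrite sN addrCA subrr addr0.
elim: k => [_|k IH kN].
  by rewrite mul0r addr0 E0 ?(le_trans xy)// normr0 I_xx mulr0.
have kb := le_trans (tN _ kN) yb.
have tkS : x + k%:R * s <= x + k.+1%:R * s by rewrite tS lerDl.
rewrite (addE x (x + k%:R * s))// (@I_split _ x (x + k%:R * s))//; last first.
  exact: itg_sub hi.
rewrite mulrDr (le_trans (ler_normD _ _))// lerD//; first exact: IH (ltnW kN).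
apply: Hd => //; first exact: le_trans (tx _).
by rewrite tS addrAC subrr add0r.
Qed.

(** The defect of the product formula is additive in the interval. From [F y * G y - F x * G x = F y
    * (G y - G x) + G x * (F y - F x)] it is at most [e] times the integral of [|f| + |g|] on short
    intervals, so [additive_eq0] applies. *)
Lemma AC_mul a b F G f g : AC a b F f -> AC a b G g ->
  AC a b (fun x => F x * G x) (fun x => f x * G x + F x * g x).
Proof.
move=> FA GA; have [fi HF] := FA; have [gi HG] := GA.
have cF := AC_continuous FA; have cG := AC_continuous GA.
have fGi : itg a b (fun x => f x * G x + F x * g x).
  apply: itgD; first exact: itgM_continuous.
  by apply: itg_ext (itgM_continuous gi cF) => x _; rewrite mulrC.
split=> // x y ax xy yb; apply/eqP; rewrite -subr_eq0; apply/eqP.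
apply: (@additive_eq0 a b (fun x y => F y * G y - F x * G x -
  I x y (fun x => f x * G x + F x * g x)) (fun t => `|f t| + `|g t|)) => //.
- by apply: itgD; exact: itg_norm.
- move=> s t z as_ st tz zb.
  rewrite (@I_split _ s t z)//; first by ring.
  exact: itg_sub fGi.
move=> e e0.
have [d1 d10 H1] := I_small fi e0.
have [d2 d20 H2] := I_small gi e0.
exists (Num.min d1 d2); first by rewrite lt_min d10.
move=> {x y ax xy yb} x y ax xy yb; rewrite lt_min => /andP[yx1 yx2].
have fi' : itg x y f by exact: itg_sub fi.
have gi' : itg x y g by exact: itg_sub gi.
have fGi' : itg x y (fun x => f x * G x + F x * g x) by exact: itg_sub fGi.
have -> : F y * G y - F x * G x - I x y (fun x => f x * G x + F x * g x) =
    I x y (fun t => (F y - F t) * g t + (G x - G t) * f t).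
  have -> : F y * G y - F x * G x = I x y (fun t => F y * g t + G x * f t).
    rewrite I_D ?I_Z; [|by []|by []|exact: itgZ|exact: itgZ].
    by rewrite -HF// -HG//; ring.
  rewrite -I_B//; first by apply: I_ext => t _; ring.
  by apply: itgD; exact: itgZ.
have di : itg x y (fun t => (F y - F t) * g t + (G x - G t) * f t).
  apply: itg_ext (itgB (itgD (itgZ (F y) gi') (itgZ (G x) fi')) fGi') => t _.
  ring.
apply: le_trans (I_norm di) _; rewrite -I_Z; last by apply: itgD; exact: itg_norm.
apply: I_le; first exact: itg_norm.
  by apply: itgZ; apply: itgD; exact: itg_norm.
move=> t /andP[xt ty]; apply: le_trans (ler_normD _ _) _.
rewrite mulrDr !normrM addrC; apply: lerD; apply: ler_wpM2r => //.
  rewrite distrC HG// ?(le_trans ty)//; apply: le_trans (I_norm _) _.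
    by apply: itg_sub gi'.
  apply: ltW; apply: H2 => //; first exact: le_trans yb.
  by rewrite (le_lt_trans _ yx2)// lerB.
rewrite HF// ?(le_trans ax)//; apply: le_trans (I_norm _) _.
  by apply: itg_sub fi'.
apply: ltW; apply: H1 => //; first exact: le_trans xt.
by rewrite (le_lt_trans _ yx1)// lerB.
Qed.

Lemma AC_comp a b (lo hi L : R) (Phi dPhi : R -> R) F f : AC a b F f ->
  (forall x, a <= x <= b -> lo <= F x <= hi) ->
  (forall z, lo <= z <= hi -> is_derive z 1 Phi (dPhi z)) ->
  (forall z w, lo <= z <= hi -> lo <= w <= hi ->
    `|dPhi z - dPhi w| <= L * `|z - w|) ->
  AC a b (fun x => Phi (F x)) (fun x => dPhi (F x) * f x).
Proof.
move=> FA Flh dP Lip; have [fi HF] := FA.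
have L1 : 0 < `|L| + 1 by rewrite ltr_wpDl.
have LipL z w : lo <= z <= hi -> lo <= w <= hi ->
    `|dPhi z - dPhi w| <= (`|L| + 1) * `|z - w|.
  move=> zl wl; apply: le_trans (Lip _ _ zl wl) _; apply: ler_wpM2r => //.
  by rewrite (le_trans (ler_norm _))// lerDl.
have cdF : {within `[a, b], continuous (fun x => dPhi (F x))}.
  apply: ucont_continuous => e e0.
  have [d d0 H] := AC_ucont FA (divr_gt0 e0 L1).
  exists d => // x y ax xy yb yxd.
  apply: le_lt_trans (LipL _ _ _ _) _.
  - by apply: Flh; rewrite (le_trans ax xy).
  - by apply: Flh; rewrite ax (le_trans xy).
  - by rewrite mulrC -ltr_pdivlMr//; exact: H.
have gi : itg a b (fun x => dPhi (F x) * f x).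
  by apply: itg_ext (itgM_continuous fi cdF) => x _; rewrite mulrC.
have mvt z w : lo <= z <= hi -> lo <= w <= hi -> exists c, [/\ lo <= c <= hi,
    `|z - c| <= `|w - z|, `|w - c| <= `|w - z| & Phi w - Phi z = dPhi c * (w - z)].
  wlog zw : z w / z <= w => [H|].
    have [zw|/ltW wz] := leP z w; first exact: H.
    move=> zl wl; have [c [cl cz cw cE]] := H _ _ wz wl zl.
    by exists c; split; rewrite // 1?[`|w - z|]distrC// -[LHS]opprB cE -mulrN opprB.
  move=> /andP[lz zh] /andP[lw wh].
  have [c|c|c] := @MVT_segment _ Phi dPhi z w zw.
  - rewrite in_itv/= => /andP[zc cw]; apply: dP.
    by rewrite (le_trans lz (ltW zc)) (le_trans (ltW cw)).
  - apply: continuous_subspace_itv => {}c; rewrite in_itv/= => /andP[zc cw].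
    have [+ _] : is_derive c 1 Phi (dPhi c).
      by apply: dP; rewrite (le_trans lz zc) (le_trans cw).
    by move=> /derivable1_diffP/differentiable_continuous.
  - rewrite in_itv/= => /andP[zc cw] cE; exists c; split=> //.
    + by rewrite (le_trans lz zc) (le_trans cw).
    + by rewrite ler0_norm ?subr_le0// ger0_norm ?subr_ge0// opprB lerB.
    + by rewrite ger0_norm ?subr_ge0// ger0_norm ?subr_ge0// lerB.
split=> // x y ax xy yb; apply/eqP; rewrite -subr_eq0; apply/eqP.
apply: (@additive_eq0 a b (fun x y => Phi (F y) - Phi (F x) -
  I x y (fun x => dPhi (F x) * f x)) (fun t => `|f t|)) => //.
- exact: itg_norm.
- move=> s t z as_ st tz zb.
  rewrite (@I_split _ s t z)//; first by ring.
  exact: itg_sub gi.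
move=> e e0.
(* The 2 pays for [|c - F t| <= |F x - F t| + |F x - c|], the other factor for the Lipschitz
   constant of [dPhi]. *)
have e20 : 0 < e / (2 * (`|L| + 1)) by rewrite divr_gt0// mulr_gt0.
have [d d0 H] := I_small fi e20.
exists d => // {x y ax xy yb} x y ax xy yb yxd.
have fi' : itg x y f by exact: itg_sub fi.
have gi' : itg x y (fun x => dPhi (F x) * f x) by exact: itg_sub gi.
have Fx : lo <= F x <= hi by apply: Flh; rewrite ax (le_trans xy).
have Fy : lo <= F y <= hi by apply: Flh; rewrite yb (le_trans ax).
have [c [clh xc _ cE]] := mvt _ _ Fx Fy.
have small t : x <= t -> t <= y -> `|F t - F x| <= e / (2 * (`|L| + 1)).
  move=> xt ty; rewrite HF ?(le_trans ty)//; apply: le_trans (I_norm _) _.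
    exact: itg_sub fi'.
  by apply/ltW/H => //; [exact: le_trans yb|rewrite (le_lt_trans _ yxd)// lerB].
have -> : Phi (F y) - Phi (F x) - I x y (fun x => dPhi (F x) * f x) =
    I x y (fun t => (dPhi c - dPhi (F t)) * f t).
  rewrite cE HF// -I_Z// -I_B//; first by apply: I_ext => t _; rewrite mulrBl.
  exact: itgZ.
have di : itg x y (fun t => (dPhi c - dPhi (F t)) * f t).
  by apply: itg_ext (itgB (itgZ (dPhi c) fi') gi') => t _; rewrite mulrBl.
apply: le_trans (I_norm di) _; rewrite -I_Z; last exact: itg_norm.
apply: I_le; [exact: itg_norm|by apply: itgZ; exact: itg_norm|].
move=> t /andP[xt ty]; rewrite normrM ler_wpM2r//.
apply: le_trans (LipL _ _ clh _) _.
  by apply: Flh; rewrite (le_trans ax)// (le_trans ty).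
have : `|c - F t| <= 2 * (e / (2 * (`|L| + 1))).
  rewrite (_ : c - F t = (F x - F t) - (F x - c)); last by ring.
  rewrite mulr_natl mulr2n (le_trans (ler_normB _ _))// lerD//.
    by rewrite distrC small.
  by rewrite (le_trans xc)// small.
move=> /(ler_wpM2l (ltW L1)) h; apply: le_trans h _.
by rewrite le_eqVlt; apply/orP; left; apply/eqP; field; rewrite gt_eqF.
Qed.

End AbsolutelyContinuous.

(** * The Dirichlet problem for linear equations *)

Section MaximumPrinciple.
Context {R : realType}.
Implicit Types (a b c x y t : R) (d k W : R -> R).

Lemma last_ge0 a c d : a <= c -> {within `[a, c], continuous d} ->
  0 <= d a -> d c < 0 ->
  exists2 s, a <= s < c & 0 <= d s /\ forall t, s < t <= c -> d t < 0.
Proof.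
move=> ac /within_continuousP cd da dc.
pose S := [set x | a <= x <= c /\ 0 <= d x].
have Sa : S a by split=> //; rewrite lexx.
have Sub : has_sup S.
  by split; [exists a|exists c => x [/andP[]]].
have aS : a <= sup S by apply: ub_le_sup => //; exact: (proj2 Sub).
have Sc : sup S <= c by apply: ge_sup => //; [exists a|move=> x [/andP[]]].
have dS : 0 <= d (sup S).
  rewrite leNgt; apply/negP => dS.
  have SI : `[a, c]%classic (sup S) by rewrite /= in_itv/= aS.
  have dS' : 0 < - d (sup S) by rewrite oppr_gt0.
  have [e e0 H] := cd (sup S) SI _ dS'.
  have [x [/andP[ax xc] dx] xS] := sup_adherent e0 Sub.
  have : `|d (sup S) - d x| < - d (sup S).
    apply: H; first by rewrite /= in_itv/= ax.
    have xS' : x <= sup S by apply: ub_le_sup; [exact: (proj2 Sub)|split=> //; rewrite ax].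
    by rewrite ger0_norm ?subr_ge0// ltrBlDr -ltrBlDl.
  by rewrite ler0_norm ?subr_le0 ?(ltW (lt_le_trans dS dx))//; lra.
exists (sup S).
  rewrite aS lt_neqAle Sc andbT; apply/eqP => E.
  by move: dc; rewrite -E ltNge dS.
split=> // t /andP[St tc]; rewrite ltNge; apply/negP => dt.
have : t <= sup S.
  apply: ub_le_sup; first exact: (proj2 Sub).
  by split=> //; rewrite tc (le_trans aS (ltW St)).
by rewrite leNgt St.
Qed.

Lemma first_ge0 a c d : a <= c -> {within `[a, c], continuous d} ->
  0 <= d c -> d a < 0 ->
  exists2 s, a < s <= c & 0 <= d s /\ forall t, a <= t < s -> d t < 0.
Proof.
move=> ac /within_continuousP cd dc da.
have [||||s /andP[cs sa] [ds H]] := @last_ge0 (- c) (- a) (d \o -%R).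
- by rewrite lerN2.
- apply/within_continuousP => x/=; rewrite in_itv/= => /andP[cx xa] e e0.
  have xI : `[a, c]%classic (- x) by rewrite /= in_itv/= lerNr xa lerNl.
  have [h h0 H] := cd (- x) xI e e0.
  exists h => // y; rewrite /= in_itv/= => /andP[cy ya] xy.
  by apply: H; [rewrite /= in_itv/= lerNr ya lerNl|rewrite -opprD normrN].
- by rewrite /= opprK.
- by rewrite /= opprK.
exists (- s); first by rewrite ltrNr sa lerNl.
split=> // t /andP[a_t ts]; rewrite -[t]opprK; apply: H.
by rewrite ltrNr ts lerN2.
Qed.

(* Left (resp. right) of a point where [d < 0] and [W >= 0] (resp. [W < 0]),
   [d] is monotone as long as it is negative, hence cannot reach [0]. *)
Lemma max_principle a b d k W : {within `[a, b], continuous d} ->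
  0 <= d a -> 0 <= d b -> (forall x, a < x < b -> 0 <= k x) ->
  (forall x y, a < x -> x <= y -> y < b -> AC x y d (fun t => k t * W t)) ->
  (forall x y, a < x -> x <= y -> y < b ->
     (forall t, x <= t <= y -> d t < 0) -> W y <= W x) ->
  forall x, a <= x <= b -> 0 <= d x.
Proof.
move=> cd da db k0 dAC Wmono c /andP[ac cb]; rewrite leNgt; apply/negP => dc.
have cdl : {within `[a, c], continuous d}.
  by apply: continuous_subspaceW cd; apply: subset_itv; rewrite bnd_simp.
have cdr : {within `[c, b], continuous d}.
  by apply: continuous_subspaceW cd; apply: subset_itv; rewrite bnd_simp.
have [s /andP[as_ sc] [ds Hs]] := last_ge0 ac cdl da dc.
have [u /andP[cu ub] [du Hu]] := first_ge0 cb cdr db dc.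
have [Wc|Wc] := leP 0 (W c).
- have H x : s < x -> x <= c -> d x <= d c.
    move=> sx xc; have ax : a < x by exact: le_lt_trans sx.
    have cb' : c < b by exact: lt_le_trans ub.
    have [_ /(_ x c (lexx _) xc (lexx _))] := dAC x c ax xc cb'.
    move=> E; rewrite -subr_ge0 E; apply: I_ge0 => t /andP[xt tc].
    apply: mulr_ge0.
      by apply: k0; rewrite (lt_le_trans ax xt) (le_lt_trans tc).
    apply: le_trans Wc _; apply: Wmono => //; first exact: lt_le_trans xt.
    move=> r /andP[tr rc]; apply: Hs; rewrite rc andbT.
    by rewrite (lt_le_trans sx)// (le_trans xt).
  (* As [0 <= d s], continuity keeps [d] above [d c] just to the right of [s], against [H]. *)
  have /within_continuousP cd' := cdl.
  have sI : `[a, c]%classic s by rewrite /= in_itv/= as_ ltW.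
  have dc' : 0 < - d c by rewrite oppr_gt0.
  have [e e0 He] := cd' s sI _ dc'.
  pose x := Num.min c (s + e / 2).
  have sx : s < x by rewrite lt_min sc ltrDl divr_gt0.
  have xc : x <= c by rewrite ge_min lexx.
  have xe : x <= s + e / 2 by rewrite ge_min lexx orbT.
  have : `|d s - d x| < - d c.
    apply: He; first by rewrite /= in_itv/= xc (le_trans as_ (ltW sx)).
    by rewrite ler0_norm ?subr_le0 ?ltW//; lra.
  have := H x sx xc; move: ds; rewrite ltr_norml; lra.
- have H x : c <= x -> x < u -> d x <= d c.
    move=> cx xu; have xb : x < b by exact: lt_le_trans ub.
    have ac' : a < c by exact: le_lt_trans sc.
    have := dAC c x ac' cx xb => -[_ /(_ c x (lexx _) cx (lexx _))].
    move=> E; rewrite -subr_le0 E -oppr_ge0 -I_N; last first.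
      exact: (dAC c x ac' cx xb).1.
    apply: I_ge0 => t /andP[ct tx]; rewrite -mulrN; apply: mulr_ge0.
      by apply: k0; rewrite (lt_le_trans ac' ct) (le_lt_trans tx).
    rewrite oppr_ge0; apply: le_trans (ltW Wc); apply: Wmono => //.
      exact: le_lt_trans xb.
    move=> r /andP[cr rt]; apply: Hu; rewrite cr/=.
    by rewrite (le_lt_trans rt)// (le_lt_trans tx).
  have /within_continuousP cd' := cdr.
  have uI : `[c, b]%classic u by rewrite /= in_itv/= ub ltW.
  have dc' : 0 < - d c by rewrite oppr_gt0.
  have [e e0 He] := cd' u uI _ dc'.
  pose x := Num.max c (u - e / 2).
  have xu : x < u by rewrite gt_max cu gtrBl divr_gt0.
  have cx : c <= x by rewrite le_max lexx.
  have xe : u - e / 2 <= x by rewrite le_max lexx orbT.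
  have : `|d u - d x| < - d c.
    apply: He; first by rewrite /= in_itv/= cx (le_trans (ltW xu)).
    by rewrite ger0_norm ?subr_ge0 ?ltW//; lra.
  have := H x cx xu; move: du; rewrite ltr_norml; lra.
Qed.

End MaximumPrinciple.

Section LinearEquations.
Context {R : realType}.
Implicit Types (a b c x y t : R) (d k f g h u v F Q : R -> R).

(** Integrating an equation twice leaves such iterated integrals; this is the passage to the limit
    in them, by dominated convergence inside and then outside. *)
Lemma iterated_dominated a b k (g_ : nat -> R -> R) g h :
  {within `[a, b], continuous k} ->
  (forall n, measurable_fun `[a, b] (g_ n)) ->
  (forall x, a <= x <= b -> g_ ^~ x @ \oo --> g x) ->
  itg a b h -> (forall n x, a <= x <= b -> `|g_ n x| <= h x) ->
  itg a b g /\ forall x, a <= x <= b ->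
    (fun n => I a x (fun t => k t * I a t (g_ n))) @ \oo -->
    I a x (fun t => k t * I a t g).
Proof.
move=> ck mg cg hi gh.
have [gi _] := I_dominated mg cg hi gh.
split=> // x /andP[ax xb].
have g_i n : itg a b (g_ n).
  apply: itg_le hi _ => // t tab; rewrite (le_trans (gh n _ tab))//.
  exact: ler_norm.
have sub t : t <= x -> `[a, t] `<=` `[a, b].
  by move=> tx; apply: subset_itv; rewrite bnd_simp// (le_trans tx).
apply: (@I_dominated _ a x (fun n t => k t * I a t (g_ n))
  (fun t => k t * I a t g) (fun t => I a b h * `|k t|) _ _ _ _).2.
- move=> n; apply: continuous_measurable => t.
  have ckx : {within `[a, x], continuous k}.
    by apply: continuous_subspaceW ck; exact: sub.
  have cI := AC_continuous (AC_int (itg_sub (lexx _) xb (g_i n))).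
  exact: (continuousM (ckx t) (cI t)).
- move=> t /andP[at_ tx]; apply: cvgMr.
  have tb := le_trans tx xb.
  apply: (@I_dominated _ a t g_ g h _ _ _ _).2.
  + by move=> n; apply: measurable_funS (mg n) => //; exact: sub.
  + by move=> s /andP[as_ st]; apply: cg; rewrite as_ (le_trans st).
  + exact: itg_sub hi.
  + by move=> n s /andP[as_ st]; apply: gh; rewrite as_ (le_trans st).
- by apply: itgZ; apply: itg_norm; apply: itg_sub (continuous_itg ck).
- move=> n t /andP[at_ tx]; have tb := le_trans tx xb.
  rewrite normrM mulrC ler_wpM2r//.
  apply: le_trans (I_norm _) _; first exact: itg_sub (g_i n).
  apply: le_trans (_ : I a t h <= _).
    apply: I_le; [by apply: itg_norm; exact: itg_sub (g_i n)|exact: itg_sub hi|].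
    by move=> s /andP[as_ st]; apply: gh; rewrite as_ (le_trans st).
  apply: I_ge0_mono => // s sab; apply: le_trans (gh 0%N s sab); exact: normr_ge0.
Qed.


Lemma AC_expR a b F f : AC a b F f ->
  AC a b (fun x => expR (F x)) (fun x => expR (F x) * f x).
Proof.
move=> FA; have [M _ FM] := continuous_bounded (AC_continuous FA).
apply: (@AC_comp _ a b (- M) M (expR M) expR expR) => //.
- by move=> x xab; have := FM x xab; rewrite ler_norml.
- move=> z w; wlog zw : z w / z <= w => [H|].
    have [zw|/ltW wz] := leP z w; first exact: H.
    by move=> zl wl; rewrite distrC [in leRHS]distrC; exact: H.
  move=> /andP[z0 zh] /andP[w0 wh].
  have [|c] := @MVT_segment _ expR expR z w zw _.
  + by apply: continuous_subspaceT => c; exact: continuous_expR.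
  + rewrite in_itv/= => /andP[zc cw] E1.
    rewrite distrC E1 normrM distrC ler_wpM2r// ger0_norm ?expR_ge0//.
    by rewrite ler_expR (le_trans cw).
Qed.

(* Bounded monotone iteration: [expR (T * int Q)] is a supersolution, where
   [T] is the integral of [k]. *)
Lemma positive_homogeneous_solution a b k Q : a <= b ->
  {within `[a, b], continuous k} -> (forall x, a <= x <= b -> 0 <= k x) ->
  itg a b Q -> (forall x, a <= x <= b -> 0 <= Q x) ->
  exists phi Y : R -> R, [/\ forall x, a <= x <= b -> 1 <= phi x,
    AC a b phi (fun x => k x * Y x) & AC a b Y (fun x => Q x * phi x)].
Proof.
move=> ab ck k0 Qi Q0; have ki := continuous_itg ck.
pose T := I a b k.
have T0 : 0 <= T by exact: I_ge0.
pose E x := expR (T * I a x Q).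
have IQ0 x : x <= b -> 0 <= I a x Q.
  by move=> xb; apply: I_ge0 => t /andP[at_ tx]; apply: Q0; rewrite at_ (le_trans tx).
have EAC : AC a b E (fun x => E x * (T * Q x)).
  by apply: AC_expR; apply: AC_Z; exact: AC_int.
(* A fixed point of [A] solves the homogeneous equation with value 1 and slope 0 at [a]. *)
pose A (y : R -> R) := fun x => 1 + I a x (fun t => k t * I a t (fun s => Q s * y s)).
pose y_ n := iter n A (fun=> 1).
have Ea : E a = 1 by rewrite /E I_xx mulr0 expR0.
have E1 x : a <= x <= b -> 1 <= E x.
  by move=> /andP[ax xb]; rewrite -expR0 ler_expR mulr_ge0// IQ0.
have cE := AC_continuous EAC.
have main n : [/\ {within `[a, b], continuous (y_ n)},
    forall x, a <= x <= b -> 1 <= y_ n x & forall x, a <= x <= b -> y_ n x <= E x].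
  elim: n => [|n [cy y1 yE]].
    split=> [x|x _|x]//=; last exact: E1.
    exact: cst_continuous.
  have Qyi : itg a b (fun x => Q x * y_ n x) by exact: itgM_continuous.
  have cI := AC_continuous (AC_int Qyi).
  have kIi : itg a b (fun t => k t * I a t (fun s => Q s * y_ n s)).
    exact: itgM_continuous.
  have Qy0 x : a <= x <= b -> 0 <= Q x * y_ n x.
    by move=> xab; rewrite mulr_ge0 ?Q0// (le_trans ler01)// y1.
  have IQy0 x : x <= b -> 0 <= I a x (fun x => Q x * y_ n x).
    move=> xb; apply: I_ge0 => t /andP[at_ tx]; apply: Qy0.
    by rewrite at_ (le_trans tx).
  split=> [|x /andP[ax xb]|x /andP[ax xb]] /=.
  - apply: AC_continuous (AC_D (AC_cst a b 1) (AC_int kIi)).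
  - rewrite /A lerDl; apply: I_ge0 => t /andP[at_ tx].
    by rewrite mulr_ge0 ?k0 ?IQy0 ?at_ ?(le_trans tx).
  - have -> : E x = 1 + I a x (fun t => T * Q t * E t).
      have [_ /(_ a x (lexx _) ax xb)] := EAC.
      rewrite Ea => /eqP; rewrite subr_eq addrC => /eqP ->; congr (_ + _).
      by apply: I_ext => t _; rewrite mulrC.
    rewrite /A lerD2l.
    have Qyx : itg a x (fun x => Q x * y_ n x) by exact: itg_sub Qyi.
    (* Enlarging the inner integral from [a, t] to [a, x] decouples the two integrals, and [k]
       contributes at most [T]. What remains is the integral equation of [E]. *)
    apply: le_trans (_ : I a x (fun t => I a x (fun x => Q x * y_ n x) * k t) <= _).
      apply: I_le; [exact: itg_sub kIi|by apply: itgZ; exact: itg_sub ki|].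
      move=> t /andP[at_ tx]; rewrite mulrC ler_wpM2r ?k0 ?at_ ?(le_trans tx)//.
      apply: I_ge0_mono => // s /andP[as_ sx]; apply: Qy0.
      by rewrite as_ (le_trans sx).
    rewrite I_Z; last exact: itg_sub ki.
    apply: le_trans (_ : I a x (fun x => Q x * y_ n x) * T <= _).
      by apply: ler_wpM2l; [exact: IQy0|exact: I_ge0_mono].
    rewrite mulrC -I_Z//; apply: I_le; first exact: itgZ.
      apply: itg_sub (itgM_continuous (itgZ T Qi) cE) => //.
    move=> t /andP[at_ tx]; have tab : a <= t <= b by rewrite at_ (le_trans tx).
    by rewrite -mulrA; apply: ler_wpM2l => //; apply: ler_wpM2l; rewrite ?Q0 ?yE.
have Qyi n : itg a b (fun x => Q x * y_ n x).
  by have [cy _ _] := main n; exact: itgM_continuous.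
have mono n x : a <= x <= b -> y_ n x <= y_ n.+1 x.
  elim: n x => [x xab|n IH x /andP[ax xb]]; first by have [_ + _] := main 1%N; exact.
  rewrite /= /A lerD2l.
  have kIi m : itg a b (fun t => k t * I a t (fun s => Q s * y_ m s)).
    by apply: itgM_continuous => //; exact: AC_continuous (AC_int (Qyi m)).
  apply: I_le; [exact: itg_sub (kIi n)|exact: itg_sub (kIi n.+1)|].
  move=> t /andP[at_ tx]; have tb := le_trans tx xb.
  apply: ler_wpM2l; first by rewrite k0 ?at_.
  apply: I_le; [exact: itg_sub (Qyi n)|exact: itg_sub (Qyi n.+1)|].
  move=> s /andP[as_ st]; have sab : a <= s <= b by rewrite as_ (le_trans st).
  by apply: ler_wpM2l; [exact: Q0|exact: IH].
pose phi x := limn (fun n => y_ n x).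
have cvg x : a <= x <= b -> (fun n => y_ n x) @ \oo --> phi x.
  move=> xab; apply: nondecreasing_is_cvgn.
    by apply/nondecreasing_seqP => n; exact: mono.
  by exists (E x) => _ [n _ <-]; have [_ _] := main n; exact.
have QyE n x : a <= x <= b -> `|Q x * y_ n x| <= Q x * E x.
  move=> xab; have [_ y1 yE] := main n.
  rewrite ger0_norm; first by apply: ler_wpM2l; [exact: Q0|exact: yE].
  by rewrite mulr_ge0 ?Q0// (le_trans ler01)// y1.
have cQ x : a <= x <= b -> (fun n => Q x * y_ n x) @ \oo --> Q x * phi x.
  by move=> xab; apply: cvgMr; exact: cvg.
have [Qphi cvgI] := @iterated_dominated a b k (fun n x => Q x * y_ n x)
    (fun x => Q x * phi x) (fun x => Q x * E x) ck
    (fun n => itg_measurable (Qyi n)) cQ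
    (itgM_continuous Qi cE) QyE.
have phiE x : a <= x <= b ->
    phi x = 1 + I a x (fun t => k t * I a t (fun s => Q s * phi s)).
  move=> xab; have h1 : (fun n => y_ n.+1 x) @ \oo --> phi x.
    by rewrite (cvg_shiftS (fun n => y_ n x)); exact: cvg.
  apply: (cvg_unique _ h1) => //=.
  by apply: cvgD; [exact: cvg_cst|exact: cvgI].
have YAC := AC_int Qphi.
exists phi, (fun x => I a x (fun s => Q s * phi s)); split=> //.
  move=> x xab; apply: limr_ge; first by apply: cvgP; exact: cvg.
  by apply: nearW => n; have [_ + _] := main n; exact.
have kYi := itgM_continuous (AC_itg YAC) ck.
have kYi' : itg a b (fun t => k t * I a t (fun s => Q s * phi s)).
  by apply: itg_ext kYi => t _; rewrite mulrC.
apply: AC_ext (AC_D (AC_cst a b 1) (AC_int kYi')) => // x xab.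
  by rewrite phiE.
by rewrite add0r.
Qed.

End LinearEquations.

(** * Green's formula and two-sided bounds without zeroth order term *)

Section BoundaryValueProblem.
Context {R : realType}.
Implicit Types (a b c x y t : R) (d k f g h u v w Q U V W : R -> R).

Lemma continuous_gt0_bounded a b k : a <= b -> {within `[a, b], continuous k} ->
  (forall x, a <= x <= b -> 0 < k x) ->
  exists2 c, 0 < c & forall x, a <= x <= b -> c <= k x.
Proof.
move=> ab ck k0; have [c cab H] := EVT_min ab ck.
exists (k c); first by apply: k0; move: cab; rewrite in_itv.
by move=> x xab; apply: H; rewrite in_itv.
Qed.

Lemma I_gt0 a b k : a < b -> {within `[a, b], continuous k} ->
  (forall x, a <= x <= b -> 0 < k x) -> 0 < I a b k.
Proof.
move=> ab ck k0; have [c c0 kc] := continuous_gt0_bounded (ltW ab) ck k0.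
apply: (@lt_le_trans _ _ (c * (b - a))); first by rewrite mulr_gt0 ?subr_gt0.
rewrite -(I_cst c (ltW ab)); apply: I_le => //; first exact: itg_cst.
exact: continuous_itg.
Qed.

(** Both bounds compare [v] with [I a x k * I x b k], the product of the distances to the end points
    measured by [k]: from above through the L1 norm of [g], from below through the mass of [g] on an
    inner interval. Having the same profile on both sides is what later allows comparison up to the
    boundary. *)
Lemma dirichlet_exists a b k g : a < b -> {within `[a, b], continuous k} ->
  (forall x, a <= x <= b -> 0 < k x) -> itg a b g ->
  exists v V, [/\ v a = 0, v b = 0, AC a b v (fun t => k t * V t),
    AC a b V (fun t => - g t) &
    (forall x, a <= x <= b -> `|v x| <=
       2 / I a b k * I a b (fun t => `|g t|) * (I a x k * I x b k)) /\
    ((forall x, a <= x <= b -> 0 <= g x) -> forall p q x, a <= p -> p <= q ->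
       q <= b -> a <= x <= b -> I p q g * Num.min (I a p k) (I q b k) *
         (I a x k * I x b k) <= I a b k ^+ 2 * v x)].
Proof.
move=> ab ck kpos gi.
have ki := continuous_itg ck.
have k0 x : a <= x <= b -> 0 <= k x by move=> /kpos/ltW.
have T0 : 0 < I a b k by exact: I_gt0.
set T1 := I a b k in T0 *.
pose S x := I a x g.
have SAC : AC a b S g by exact: AC_int.
have cS := AC_continuous SAC.
have kSi : itg a b (fun t => k t * S t) by exact: itgM_continuous.
(* The slope at [a] that makes [v] vanish at [b]. *)
pose kappa := I a b (fun t => k t * S t) / T1.
pose V x := kappa - S x.
pose v x := kappa * I a x k - I a x (fun t => k t * S t).
(* Green's formula with a free parameter, since the two terms in [s] cancel. The upper bound takes
   [s = 0]; the lower bound takes [s = S x], which makes both integrands nonnegative as [S] is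
   nondecreasing. *)
have vE s x : a <= x <= b -> T1 * v x = I a x k * I x b (fun t => k t * (S t - s)) +
    I x b k * I a x (fun t => k t * (s - S t)).
  move=> /andP[ax xb].
  have kx : itg a x k by exact: itg_sub ki.
  have kx' : itg x b k by exact: itg_sub ki.
  have kSx : itg a x (fun t => k t * S t) by exact: itg_sub kSi.
  have kSx' : itg x b (fun t => k t * S t) by exact: itg_sub kSi.
  have -> : I x b (fun t => k t * (S t - s)) = I x b (fun t => k t * S t) - s * I x b k.
    rewrite -I_Z// -I_B//; last exact: itgZ.
    by apply: I_ext => t _; ring.
  have -> : I a x (fun t => k t * (s - S t)) = s * I a x k - I a x (fun t => k t * S t).
    rewrite -I_Z// -I_B//; last exact: itgZ.
    by apply: I_ext => t _; ring.
  have T1E : T1 = I a x k + I x b k by exact: I_split.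
  have kE : kappa * T1 = I a x (fun t => k t * S t) + I x b (fun t => k t * S t).
    by rewrite divfK ?gt_eqF//; exact: I_split.
  rewrite /v mulrBr mulrA [T1 * kappa]mulrC kE T1E; ring.
have Ik0 x y : a <= x -> y <= b -> 0 <= I x y k.
  move=> ax yb; apply: I_ge0 => t /andP[xt ty]; apply: k0.
  by rewrite (le_trans ax xt) (le_trans ty yb).
exists v, V; split.
- by rewrite /v !I_xx mulr0 subr0.
- by rewrite /v divfK ?gt_eqF// subrr.
- apply: AC_ext (AC_B (AC_Z kappa (AC_int ki)) (AC_int kSi)) => // x _.
  by rewrite /V; ring.
- by apply: AC_ext (AC_B (AC_cst a b kappa) SAC) => // x _; rewrite sub0r.
split=> [x xab|g0 p q x ap pq qb xab].
- have /andP[ax xb] := xab.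
  set S1 := I a b (fun t => `|g t|).
  have SS1 t : a <= t <= b -> `|S t| <= S1.
    move=> /andP[at_ tb]; apply: le_trans (I_norm (itg_sub (lexx _) tb gi)) _.
    by apply: I_ge0_mono => //; exact: itg_norm.
  have bnd y z : a <= y -> z <= b -> `|I y z (fun t => k t * S t)| <= S1 * I y z k.
    move=> ay zb; have h1 : itg y z (fun t => k t * S t) by exact: itg_sub kSi.
    have h2 : itg y z k by exact: itg_sub ki.
    apply: le_trans (I_norm h1) _; rewrite -I_Z//.
    apply: I_le; [exact: itg_norm|exact: itgZ|move=> t /andP[yt tz]].
    have tab : a <= t <= b by rewrite (le_trans ay yt) (le_trans tz zb).
    by rewrite normrM mulrC (ger0_norm (k0 _ tab)) ler_wpM2r ?k0// SS1.
  have b1 := bnd x b ax (lexx _); have b2 := bnd a x (lexx _) xb.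
  rewrite -(ler_pM2l T0) -{1}(gtr0_norm T0) -normrM (vE 0 x xab).
  have -> : T1 * (2 / T1 * S1 * (I a x k * I x b k)) =
      I a x k * (S1 * I x b k) + I x b k * (S1 * I a x k).
    by field; rewrite gt_eqF.
  apply: le_trans (ler_normD _ _) _; rewrite !normrM.
  rewrite (ger0_norm (Ik0 a x (lexx _) xb)) (ger0_norm (Ik0 x b ax (lexx _))).
  apply: lerD; apply: ler_wpM2l; rewrite ?Ik0//.
    by apply: le_trans b1; rewrite le_eqVlt; apply/orP; left; apply/eqP; congr `|_|;
      apply: I_ext => t _; rewrite subr0.
  rewrite -normrN -I_N; last first.
    by apply: itg_ext (itgN (itg_sub (lexx _) xb kSi)) => t _; rewrite sub0r mulrN.
  by apply: le_trans b2; rewrite le_eqVlt; apply/orP; left; apply/eqP; congr `|_|;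
    apply: I_ext => t _; rewrite sub0r mulrN opprK.
- have /andP[ax xb] := xab.
  have Smono y z : a <= y -> y <= z -> z <= b -> S y <= S z.
    move=> ay yz zb; rewrite -subr_ge0; have [_ ->//] := SAC.
    by apply: I_ge0 => t /andP[yt tz]; apply: g0; rewrite (le_trans ay yt) (le_trans tz).
  have qb' := itg_sub (le_trans ap pq) (lexx b) ki.
  have ap' := itg_sub (lexx a) (le_trans pq qb) ki.
  have kSs y z s : a <= y -> z <= b -> itg y z (fun t => k t * (S t - s)).
    move=> ay zb; apply: itg_sub ay zb _.
    by apply: itg_ext (itgB kSi (itgZ s ki)) => t _; ring.
  have kSs' y z s : a <= y -> z <= b -> itg y z (fun t => k t * (s - S t)).
    move=> ay zb; apply: itg_ext (itgN (kSs y z s ay zb)) => t _; ring.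
  set A := I x b (fun t => k t * (S t - S x)).
  set B := I a x (fun t => k t * (S x - S t)).
  have A0 : 0 <= A.
    apply: I_ge0 => t /andP[xt tb]; rewrite mulr_ge0 ?k0 ?(le_trans ax xt)//.
    by rewrite subr_ge0 Smono.
  have B0 : 0 <= B.
    apply: I_ge0 => t /andP[at_ tx]; rewrite mulr_ge0 ?k0 ?at_ ?(le_trans tx xb)//.
    by rewrite subr_ge0 Smono.
  have Aq : x <= q -> (S q - S x) * I q b k <= A.
    move=> xq; have aq := le_trans ax xq.
    rewrite -(I_Z (S q - S x) qb').
    apply: (@le_trans _ _ (I q b (fun t => k t * (S t - S x)))).
      apply: I_le; [exact: itgZ|exact: kSs|move=> t /andP[qt tb]].
      rewrite mulrC ler_wpM2l ?k0 ?tb ?(le_trans aq qt)// lerD2r.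
      exact: Smono.
    apply: I_ge0_mono => //; first exact: kSs.
    move=> t /andP[xt tb]; rewrite mulr_ge0 ?k0 ?(le_trans ax xt)//.
    by rewrite subr_ge0 Smono.
  have Bp : p <= x -> (S x - S p) * I a p k <= B.
    move=> px; have pb := le_trans px xb.
    rewrite -(I_Z (S x - S p) ap').
    apply: (@le_trans _ _ (I a p (fun t => k t * (S x - S t)))).
      apply: I_le; [exact: itgZ|exact: kSs'|move=> t /andP[at_ tp]].
      rewrite mulrC ler_wpM2l ?k0 ?at_ ?(le_trans tp pb)// lerD2l lerN2.
      exact: Smono.
    apply: I_ge0_mono => //; first exact: kSs'.
    move=> t /andP[at_ tx]; rewrite mulr_ge0 ?k0 ?at_ ?(le_trans tx xb)//.
    by rewrite subr_ge0 Smono.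
  set m := Num.min _ _.
  have m1 : m <= I a p k by rewrite ge_min lexx.
  have m2 : m <= I q b k by rewrite ge_min lexx orbT.
  have m0 : 0 <= m by rewrite le_min !Ik0// ?(le_trans ap pq)// (le_trans pq qb).
  have Ipq : I p q g = S q - S p by have [_ ->] := SAC.
  (* The mass of [g] on [p, q] lies to the right of [x], to its left, or is split at [x]; [A]
     controls the part on the right and [B] the part on the left. *)
  have AB : (S q - S p) * m <= A + B.
    have [xp|/ltW px] := leP x p.
      have xq := le_trans xp pq.
      have h : (S q - S p) * m <= (S q - S x) * I q b k.
        by apply: ler_pM; rewrite ?subr_ge0 ?Smono// lerD2l lerN2 Smono// (le_trans pq).
      by apply: le_trans h _; apply: le_trans (Aq xq) _; rewrite lerDl.
    have [qx|/ltW xq] := leP q x.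
      have h : (S q - S p) * m <= (S x - S p) * I a p k.
        by apply: ler_pM; rewrite ?subr_ge0 ?Smono// lerD2r Smono// (le_trans ap).
      by apply: le_trans h _; apply: le_trans (Bp px) _; rewrite lerDr.
    have h1 : (S q - S x) * m <= A.
      by apply: le_trans (Aq xq); apply: ler_wpM2l; rewrite ?subr_ge0 ?Smono.
    have h2 : (S x - S p) * m <= B.
      by apply: le_trans (Bp px); apply: ler_wpM2l; rewrite ?subr_ge0 ?Smono.
    by apply: le_trans (lerD h1 h2); rewrite -mulrDl addrA subrK.
  rewrite Ipq expr2 -[leRHS]mulrA (vE (S x) x xab) -/A -/B.
  set Tl := I a x k; set Tr := I x b k.
  have T1E : T1 = Tl + Tr by exact: I_split.
  have Tl0 : 0 <= Tl by exact: Ik0.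
  have Tr0 : 0 <= Tr by exact: Ik0.
  apply: (@le_trans _ _ ((A + B) * (Tl * Tr))).
    by apply: ler_wpM2r => //; exact: mulr_ge0.
  rewrite T1E -subr_ge0.
  have -> : (Tl + Tr) * (Tl * A + Tr * B) - (A + B) * (Tl * Tr) =
    Tl * (Tl * A) + Tr * (Tr * B) by ring.
  by rewrite addr_ge0// !mulr_ge0.
Qed.

End BoundaryValueProblem.

(** * The Dirichlet problem with nonnegative zeroth order term *)

Section DirichletProblem.
Context {R : realType}.
Implicit Types (a b c x y t : R) (d k f g h u v w Q U V W : R -> R).

Lemma AC_inv a b F f : (forall x, a <= x <= b -> 1 <= F x) -> AC a b F f ->
  AC a b (fun x => (F x)^-1) (fun x => - (F x) ^- 2 * f x).
Proof.
move=> F1 FA; have [M _ FM] := continuous_bounded (AC_continuous FA).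
apply: (@AC_comp _ a b 1 M 2 GRing.inv (fun z => - z ^- 2)) => //.
- by move=> x xab; rewrite F1//= (le_trans (ler_norm _))// FM.
- move=> z /andP[z1 _]; have z0 : z != 0 by rewrite gt_eqF// (lt_le_trans ltr01).
  have := @is_deriveV R id z 1 1 z0 (is_derive_id _ _).
  by rewrite /GRing.scale/= mulr1.
- move=> z w /andP[z1 _] /andP[w1 _].
  have z0 : 0 < z by exact: lt_le_trans ltr01 z1.
  have w0 : 0 < w by exact: lt_le_trans ltr01 w1.
  rewrite (_ : - z ^- 2 - - w ^- 2 = (z^-1 * w^-1) * (z^-1 + w^-1) * (z - w)); last first.
    by field; rewrite !gt_eqF.
  rewrite normrM ler_wpM2r// ger0_norm; last first.
    by rewrite mulr_ge0 ?addr_ge0 ?mulr_ge0 ?invr_ge0 ?ltW.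
  have zi : z^-1 <= 1 by rewrite invf_le1.
  have wi : w^-1 <= 1 by rewrite invf_le1.
  have zi0 : 0 <= z^-1 by rewrite invr_ge0 ltW.
  have wi0 : 0 <= w^-1 by rewrite invr_ge0 ltW.
  by rewrite (le_trans (ler_pM _ _ (mulr_ile1 zi0 wi0 zi wi) (lerD zi wi)))// ?mulr_ge0 ?addr_ge0// mul1r.
Qed.

(** The Dirichlet problem for [- (u'/k)' + Q u = f], as a first order system. *)
Definition BVP a b k Q f u W := [/\ u a = 0, u b = 0,
  AC a b u (fun x => k x * W x) & AC a b W (fun x => Q x * u x - f x)].

(* Doob's transform: [u = phi * v] with [phi] a positive homogeneous solution
   turns the equation for [u] into one for [v] without zeroth order term. *)
Lemma BVP_exists a b k Q : a < b -> {within `[a, b], continuous k} ->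
  (forall x, a <= x <= b -> 0 < k x) ->
  itg a b Q -> (forall x, a <= x <= b -> 0 <= Q x) ->
  exists d, exists2 C : R, (forall x, a < x < b -> 0 < d x) &
    forall f, itg a b f -> exists u W, [/\ BVP a b k Q f u W,
      forall x, a <= x <= b -> `|u x| <= C * I a b (fun t => `|f t|) * d x &
      (forall x, a <= x <= b -> 0 <= f x) -> forall p q, a < p -> p <= q ->
        q < b -> 0 < I p q f ->
        exists2 c, 0 < c & forall x, a <= x <= b -> c * d x <= u x].
Proof.
move=> ab ck kpos Qi Q0.
have k0 x : a <= x <= b -> 0 <= k x by move=> /kpos/ltW.
have [phi [Y [phi1 phiAC YAC]]] := positive_homogeneous_solution (ltW ab) ck k0 Qi Q0.
have cphi := AC_continuous phiAC.
have invAC := AC_inv phi1 phiAC.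
have cinv := AC_continuous invAC.
have phi0 x : a <= x <= b -> 0 < phi x by move=> /phi1; exact: lt_le_trans.
have [M M0 phiM] := continuous_bounded cphi.
(* For [u = phi * v] the equation reads [(v' / k2)' = - f * phi] with [k2 = k / phi^2]. *)
pose k2 x := k x * (phi x)^-1 * (phi x)^-1.
have ck2 : {within `[a, b], continuous k2}.
  by move=> x; apply: continuousM (cinv x); exact: (continuousM (ck x) (cinv x)).
have k2pos x : a <= x <= b -> 0 < k2 x.
  by move=> xab; rewrite /k2 !mulr_gt0 ?invr_gt0 ?kpos ?phi0.
have T0 := I_gt0 ab ck2 k2pos.
have sub x y : a <= x -> y <= b -> {within `[x, y], continuous k2}.
  move=> ax yb; apply: continuous_subspaceW ck2.
  by apply: subset_itv; rewrite bnd_simp.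
have I2 x y : a <= x -> x < y -> y <= b -> 0 < I x y k2.
  move=> ax xy yb; apply: I_gt0 => //; first exact: sub.
  by move=> t /andP[xt ty]; apply: k2pos; rewrite (le_trans ax xt) (le_trans ty).
(* The profile does not depend on the source [f], so solutions with different sources can be
   compared with each other. *)
exists (fun x => phi x * (I a x k2 * I x b k2)), (2 / I a b k2 * M).
  move=> x /andP[ax xb]; have xab : a <= x <= b by rewrite !ltW.
  by apply: mulr_gt0; [exact: phi0|apply: mulr_gt0; apply: I2 => //; exact: ltW].
move=> f fi.
have gi : itg a b (fun x => f x * phi x) by exact: itgM_continuous.
have [v [V [va vb vAC VAC [vup vlow]]]] := dirichlet_exists ab ck2 k2pos gi.
(* The second component is [u' / k], computed from [phi' = k * Y] and [v' = k2 * V]. *)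
exists (fun x => phi x * v x), (fun x => Y x * v x + V x * (phi x)^-1); split.
- split; rewrite ?va ?vb ?mulr0//.
    apply: AC_ext (AC_mul phiAC vAC) => // x xab; rewrite /k2; field.
    by rewrite gt_eqF// phi0.
  apply: AC_ext (AC_D (AC_mul YAC vAC) (AC_mul VAC invAC)) => // x xab.
  by rewrite /k2; field; rewrite gt_eqF// phi0.
- move=> x xab; rewrite normrM (gtr0_norm (phi0 x xab)).
  rewrite [leRHS]mulrCA; apply: ler_wpM2l; first exact: ltW (phi0 x xab).
  apply: le_trans (vup x xab) _; apply: ler_wpM2r.
    by move: xab => /andP[ax xb]; rewrite mulr_ge0// I_ge0// => t /andP[t1 t2];
      rewrite ltW// k2pos// ?t1 ?t2 ?(le_trans t2)// ?andbT (le_trans ax).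
  rewrite -[leRHS]mulrA; apply: ler_wpM2l; first by rewrite divr_ge0// ltW.
  rewrite -I_Z; last exact: itg_norm.
  apply: I_le; [exact: itg_norm|by apply: itgZ; exact: itg_norm|move=> t tab].
  by rewrite normrM mulrC ler_wpM2r// phiM.
move=> f0 p q ap pq qb Ipq.
have g0 x : a <= x <= b -> 0 <= f x * phi x.
  by move=> xab; rewrite mulr_ge0 ?f0// ltW ?phi0.
have Ig : 0 < I p q (fun x => f x * phi x).
  apply: lt_le_trans Ipq _; apply: I_le.
  - by apply: itg_sub fi; exact: ltW.
  - by apply: itg_sub gi; exact: ltW.
  - move=> x /andP[px xq]; have xab : a <= x <= b.
      by rewrite (le_trans (ltW ap) px) (le_trans xq (ltW qb)).
    by rewrite ler_peMr ?f0 ?phi1.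
set m := Num.min (I a p k2) (I q b k2).
have m0 : 0 < m by rewrite lt_min !I2// ?(le_trans (ltW ap))// ?(le_trans pq)// ltW.
exists (I p q (fun x => f x * phi x) * m / I a b k2 ^+ 2).
  by rewrite divr_gt0 ?mulr_gt0 ?exprn_gt0.
move=> x xab; rewrite mulrCA; apply: ler_wpM2l; first exact: ltW (phi0 x xab).
rewrite mulrAC ler_pdivrMr ?exprn_gt0// [leRHS]mulrC.
by apply: vlow => //; exact: ltW.
Qed.

End DirichletProblem.

(** * Sublinear equations *)

Section Powers.
Context {R : realType}.
Implicit Types (s t q l c : R).

Lemma cvgn_ge (s_ : nat -> R) s c : s_ @ \oo --> s -> (forall n, c <= s_ n) -> c <= s.
Proof.
move=> ss cs; rewrite -(cvg_lim _ ss)//; apply: limr_ge; first exact: cvgP ss.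
exact: nearW.
Qed.

Lemma cvgn_le (s_ : nat -> R) s c : s_ @ \oo --> s -> (forall n, s_ n <= c) -> s <= c.
Proof.
move=> ss cs; rewrite -(cvg_lim _ ss)//; apply: limr_le; first exact: cvgP ss.
exact: nearW.
Qed.

Lemma ler_powRl q s t : 0 <= q -> 0 <= s -> s <= t -> s `^ q <= t `^ q.
Proof.
move=> q0 s0 st; apply: ge0_ler_powR => //; rewrite nnegrE//.
exact: le_trans st.
Qed.

Lemma cvg_powR q (s_ : nat -> R) s : 0 < q -> (forall n, 0 <= s_ n) ->
  s_ @ \oo --> s -> (fun n => s_ n `^ q) @ \oo --> s `^ q.
Proof.
move=> q0 s0 ss; have := cvgn_ge ss s0.
rewrite le_eqVlt => /predU1P[z|sp].
  rewrite -z powR0 ?gt_eqF//; rewrite -z in ss.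
  apply/cvgrPdist_lt => e e0.
  have e0' : 0 < e `^ q^-1 by exact: powR_gt0.
  move/cvgrPdist_lt : ss => /(_ _ e0'); apply: filterS => n.
  rewrite !sub0r !normrN ger0_norm// ger0_norm ?powR_ge0// => h.
  have -> : e = (e `^ q^-1) `^ q by rewrite -powRrM mulVf ?gt_eqF// powRr1// ltW.
  by apply: gt0_ltr_powR; rewrite ?nnegrE// ltW.
have [+ _] := is_derive1_powR q sp.
move/derivable1_diffP/differentiable_continuous => cs.
exact: cvg_comp ss cs.
Qed.

(* The Lipschitz truncation [min (s^q) (l s)] of the power [s^q]. *)
Definition trunc_pow q l s := Num.min (s `^ q) (l * s).

Lemma trunc_pow_ge0 q l s : 0 <= l -> 0 <= s -> 0 <= trunc_pow q l s.
Proof. by move=> l0 s0; rewrite le_min powR_ge0 mulr_ge0. Qed.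

Lemma trunc_pow_le q l l' s : 0 <= s -> l <= l' -> trunc_pow q l s <= trunc_pow q l' s.
Proof.
move=> s0 ll; rewrite le_min !ge_min lexx/=; apply/orP; right.
exact: ler_wpM2r.
Qed.

Lemma trunc_pow_le_powR q l s : trunc_pow q l s <= s `^ q.
Proof. by rewrite ge_min lexx. Qed.

Lemma trunc_pow_le_lin q l s : trunc_pow q l s <= l * s.
Proof. by rewrite ge_min lexx orbT. Qed.

(** This makes the iteration monotone. Where it is positive, the remainder equals
    [s^q * (l * s^(1 - q) - 1)], a product of nonnegative nondecreasing factors; elsewhere it is
    0. *)
Lemma trunc_pow_remainder q l s t : 0 < q -> q < 1 -> 0 <= l -> 0 <= s -> s <= t ->
  l * s - trunc_pow q l s <= l * t - trunc_pow q l t.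
Proof.
move=> q0 q1 l0 s0 st; have t0 := le_trans s0 st.
have gt : trunc_pow q l t <= l * t by exact: trunc_pow_le_lin.
have [->|s_0] := eqVneq s 0.
  by rewrite /trunc_pow mulr0 powR0 ?gt_eqF// minxx subrr subr_ge0.
rewrite {1}/trunc_pow minEle; case: ifPn => [h|_]; last first.
  by rewrite subrr subr_ge0.
apply: (@le_trans _ _ (l * t - t `^ q)).
  have E z : 0 < z -> l * z - z `^ q = z `^ q * (l * z `^ (1 - q) - 1).
    move=> z0; rewrite mulrBr mulr1 mulrCA -powRD; last by apply/implyP => _; rewrite gt_eqF.
    by rewrite [q + (1 - q)]addrC subrK powRr1// ltW.
  have q1' : 0 <= 1 - q by rewrite subr_ge0 ltW.
  have sp : 0 < s by rewrite lt_neqAle eq_sym s_0.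
  have sq : 0 < s `^ q by rewrite powR_gt0.
  have h' : 0 <= l * s `^ (1 - q) - 1.
    by rewrite -(pmulr_rge0 _ sq) -E// subr_ge0.
  rewrite !E//; last exact: lt_le_trans st.
  apply: ler_pM => //; [exact: ltW|exact: ler_powRl (ltW q0) s0 st|].
  by rewrite lerD2r ler_wpM2l// ler_powRl.
by rewrite lerD2l lerN2 trunc_pow_le_powR.
Qed.

Lemma cvg_trunc_pow q l (s_ : nat -> R) s : 0 < q -> (forall n, 0 <= s_ n) ->
  s_ @ \oo --> s -> (fun n => trunc_pow q l (s_ n)) @ \oo --> trunc_pow q l s.
Proof.
move=> q0 s0 ss; rewrite /trunc_pow minr_absE.
under eq_fun do rewrite minr_absE.
have cq := cvg_powR q0 s0 ss.
have cl : (fun n => l * s_ n) @ \oo --> l * s by exact: cvgMr.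
by apply: cvgMl; apply: cvgB; [exact: cvgD|apply: cvg_norm; exact: cvgB].
Qed.

(** The positive lower bound [s] makes the truncation inactive as soon as [n.+1 * s] exceeds a bound
    of the powers. *)
Lemma cvg_trunc_powR q (s_ : nat -> R) s : 0 < q -> 0 < s -> (forall n, s <= s_ n) ->
  s_ @ \oo --> s -> (fun n => trunc_pow q n.+1%:R (s_ n)) @ \oo --> s `^ q.
Proof.
move=> q0 s0 sn ss.
have cq : (fun n => s_ n `^ q) @ \oo --> s `^ q.
  by apply: cvg_powR => // n; rewrite (le_trans (ltW s0)).
have [N _ sN] : \forall n \near \oo, s_ n `^ q <= n.+1%:R * s_ n.
  have [N _ HN] : \forall n \near \oo, s_ n `^ q < s `^ q + 1.
    by apply: cvgr_lt cq _ _; rewrite ltrDl.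
  exists (maxn N (Num.truncn ((s `^ q + 1) / s)).+1) => // n /=.
  rewrite geq_max => /andP[Nn Tn].
  apply: le_trans (ltW (HN _ Nn)) _.
  apply: le_trans (_ : n.+1%:R * s <= _); last by rewrite ler_wpM2l.
  rewrite -ler_pdivrMr//.
  apply: le_trans (_ : (Num.truncn ((s `^ q + 1) / s)).+1%:R <= _).
    have h0 : 0 <= (s `^ q + 1) / s by rewrite divr_ge0 ?addr_ge0 ?powR_ge0// ltW.
    by have /andP[_ /ltW] := truncn_itv h0.
  by rewrite ler_nat ltnW.
apply: cvg_trans cq; apply: near_eq_cvg; exists N => // n Nn.
by rewrite /trunc_pow min_l//; exact: sN.
Qed.

End Powers.

(** * Subsolutions, comparison and limits for the linear problem *)

Section Subsolutions.
Context {R : realType}.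
Context (a b : R) (k : R -> R).
Context (ab : a < b) (ck : {within `[a, b], continuous k})
  (kpos : forall x, a <= x <= b -> 0 < k x).
Implicit Types (x y t : R) (f g h u v w Q U V W : R -> R).

(** The inequality is asked on compact subintervals of the open interval only: powers of a solution
    will be subsolutions, and the chain rule for them needs a positive lower bound, which fails at
    the end points. *)
Definition subsol Q f w := [/\ {within `[a, b], continuous w}, w a <= 0, w b <= 0 &
  exists V, forall x y, a < x -> x <= y -> y < b ->
    AC x y w (fun t => k t * V t) /\ I x y (fun t => Q t * w t - f t) <= V y - V x].

Lemma BVP_subsol Q f u W : BVP a b k Q f u W -> subsol Q f u.
Proof.
move=> [ua ub uAC WAC]; split; rewrite ?ua ?ub//; first exact: AC_continuous uAC.
exists W => x y ax xy yb; split; first by apply: AC_sub uAC; exact: ltW.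
by have [_ ->] := WAC; rewrite // ltW.
Qed.

Lemma subsol_le Q Q' f g w : itg a b Q -> itg a b Q' -> itg a b f -> itg a b g ->
  (forall x, a < x < b -> Q' x * w x - g x <= Q x * w x - f x) ->
  subsol Q f w -> subsol Q' g w.
Proof.
move=> Qi Q'i fi gi fg [cw wa wb [V HV]]; split=> //; exists V => x y ax xy yb.
have [AV IV] := HV x y ax xy yb; split=> //; apply: le_trans IV.
have H h z : itg a b h -> itg a b z -> itg x y (fun t => h t * w t - z t).
  move=> hi zi; apply: itg_sub (itgB (itgM_continuous hi cw) zi); exact: ltW.
apply: I_le; [exact: H|exact: H|move=> t /andP[xt ty]; apply: fg].
by rewrite (lt_le_trans ax xt) (le_lt_trans ty yb).
Qed.

(** Where [u < w] one has [Q u - f <= Q w - g], so [W - V] is nonincreasing there, as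
    [max_principle] demands for [u - w]. *)
Lemma subsol_le_BVP Q f g u W w : itg a b Q -> (forall x, a <= x <= b -> 0 <= Q x) ->
  itg a b f -> itg a b g ->
  (forall x, a < x < b -> u x < w x -> g x <= f x) ->
  BVP a b k Q f u W -> subsol Q g w -> forall x, a <= x <= b -> w x <= u x.
Proof.
move=> Qi Q0 fi gi gf [ua ub uAC WAC] [cw wa wb [V HV]] x xab; rewrite -subr_ge0.
have cu := AC_continuous uAC.
apply: (@max_principle _ a b (fun x => u x - w x) k (fun x => W x - V x)) => //.
- by move=> z; apply: continuousB; [exact: cu|exact: cw].
- by rewrite ua sub0r oppr_ge0.
- by rewrite ub sub0r oppr_ge0.
- by move=> z /andP[az zb]; apply/ltW/kpos; rewrite !ltW.
- move=> {xab} {}x y ax xy yb; have [wAC _] := HV x y ax xy yb.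
  apply: AC_ext (AC_B (AC_sub (ltW ax) (ltW yb) uAC) wAC) => // t _.
  by rewrite mulrBr.
- move=> {xab} {}x y ax xy yb neg; have [_ IV] := HV x y ax xy yb.
  have [_ /(_ x y (ltW ax) xy (ltW yb)) IW] := WAC.
  suff : W y - W x <= V y - V x by lra.
  apply: le_trans IV; rewrite IW; apply: I_le.
  - exact: itg_sub (ltW ax) (ltW yb) (itgB (itgM_continuous Qi cu) fi).
  - exact: itg_sub (ltW ax) (ltW yb) (itgB (itgM_continuous Qi cw) gi).
  move=> t /andP[xt ty].
  have at_ : a < t by exact: lt_le_trans xt.
  have tb : t < b by exact: le_lt_trans yb.
  have n : u t < w t by rewrite -subr_lt0; apply: neg; rewrite xt.
  apply: lerB; last by apply: gf; rewrite ?at_.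
  by apply: ler_wpM2l; [apply: Q0; rewrite !ltW|exact: ltW].
Qed.

Lemma BVP_le Q f g u U v V : itg a b Q -> (forall x, a <= x <= b -> 0 <= Q x) ->
  itg a b f -> itg a b g -> (forall x, a < x < b -> g x <= f x) ->
  BVP a b k Q f u U -> BVP a b k Q g v V -> forall x, a <= x <= b -> v x <= u x.
Proof.
move=> Qi Q0 fi gi gf uB /BVP_subsol vS.
by apply: (subsol_le_BVP Qi Q0 fi gi _ uB vS) => x xab _; exact: gf.
Qed.

Lemma BVP_ge0 Q f u U : itg a b Q -> (forall x, a <= x <= b -> 0 <= Q x) ->
  itg a b f -> (forall x, a < x < b -> 0 <= f x) ->
  BVP a b k Q f u U -> forall x, a <= x <= b -> 0 <= u x.
Proof.
move=> Qi Q0 fi f0 uB; apply: (BVP_le Qi Q0 fi (itg_cst a b 0) f0 uB (V := fun=> 0)).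
split=> //; first by apply: AC_ext (AC_cst a b 0) => // x _; rewrite mulr0.
by apply: AC_ext (AC_cst a b 0) => // x _; rewrite mulr0 subr0.
Qed.

(** Pointwise convergence suffices. Integrated twice, the equation expresses [u_ n] by [W_ n a] and
    a double integral; the boundary value at [b] gives the slope [W_ n a] itself as such an
    integral, and dominated convergence handles both. *)
Lemma BVP_limit Q (f_ u_ W_ : nat -> R -> R) f u h (M : R) : itg a b Q ->
  (forall n, BVP a b k Q (f_ n) (u_ n) (W_ n)) -> (forall n, itg a b (f_ n)) ->
  (forall x, a <= x <= b -> f_ ^~ x @ \oo --> f x) ->
  (forall x, a <= x <= b -> u_ ^~ x @ \oo --> u x) ->
  itg a b h -> (forall n x, a <= x <= b -> `|f_ n x| <= h x) ->
  (forall n x, a <= x <= b -> `|u_ n x| <= M) ->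
  itg a b f /\ exists W, BVP a b k Q f u W.
Proof.
move=> Qi uB fi cf cu hi fh uM.
have fi' : itg a b f.
  by apply: (I_dominated _ cf hi fh).1 => n; exact: itg_measurable.
split=> //.
pose g_ n x := f_ n x - Q x * u_ n x.
pose g x := f x - Q x * u x.
have g_i n : itg a b (g_ n).
  have [_ _ uAC _] := uB n.
  by apply: itgB => //; apply: itgM_continuous => //; exact: AC_continuous uAC.
have aab : a <= a <= b by rewrite lexx ltW.
have bab : a <= b <= b by rewrite lexx ltW.
have [||||gi cI] := @iterated_dominated R a b k g_ g (fun x => h x + M * `|Q x|) ck.
- by move=> n; exact: itg_measurable.
- by move=> x xab; apply: cvgB; [exact: cf|apply: cvgMr; exact: cu].
- by apply: itgD => //; apply: itgZ; exact: itg_norm.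
- move=> n x xab; apply: le_trans (ler_normB _ _) _.
  by apply: lerD; [exact: fh|rewrite normrM mulrC ler_wpM2r// uM].
have ki := continuous_itg ck.
pose N_ n x := I a x (fun t => k t * I a t (g_ n)).
pose N x := I a x (fun t => k t * I a t g).
have u_E n x : a <= x <= b -> u_ n x = W_ n a * I a x k - N_ n x.
  move=> /andP[ax xb]; have [ua _ [_ uAC] [_ WAC]] := uB n.
  have gAC := AC_int (g_i n).
  have kgi : itg a x (fun t => k t * I a t (g_ n)).
    by apply: itg_sub (itgM_continuous ki (AC_continuous gAC)).
  have kx : itg a x k by exact: itg_sub ki.
  have := uAC a x (lexx _) ax xb; rewrite ua subr0 => ->.
  rewrite -I_Z// -I_B//; last exact: itgZ.
  apply: I_ext => t /andP[at_ tx]; have tb := le_trans tx xb.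
  have := WAC a t (lexx _) at_ tb.
  have -> : I a t (fun x => Q x * u_ n x - f_ n x) = - I a t (g_ n).
    rewrite -I_N; last exact: itg_sub (g_i n).
    by apply: I_ext => s _; rewrite opprB.
  by move=> h'; rewrite (_ : W_ n t = W_ n a - I a t (g_ n)); [ring|lra].
have T0 : 0 < I a b k by exact: I_gt0.
have kE n : W_ n a = N_ n b / I a b k.
  have := u_E n b bab; have [_ -> _ _] := uB n => /eqP.
  by rewrite eq_sym subr_eq0 => /eqP <-; rewrite mulfK// gt_eqF.
pose W t := N b / I a b k - I a t g.
have uE x : a <= x <= b -> u x = N b / I a b k * I a x k - N x.
  move=> xab; have := cu x xab; rewrite (_ : u_^~ x = fun n => N_ n b / I a b k * I a x k - N_ n x).
    move/(cvg_unique (@Rhausdorff R)); apply; apply: cvgB; last exact: cI.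
    by apply: cvgMl; apply: cvgMl; exact: cI.
  by apply/funext => n; rewrite u_E// kE.
exists W; split.
- by rewrite uE// /N !I_xx mulr0 subr0.
- by rewrite uE// divfK ?gt_eqF// subrr.
- have kgi : itg a b (fun t => k t * I a t g).
    exact: itgM_continuous ki (AC_continuous (AC_int gi)).
  apply: AC_ext (AC_B (AC_Z (N b / I a b k) (AC_int ki)) (AC_int kgi)) => x xab.
    by rewrite uE.
  by rewrite /W; ring.
- apply: AC_ext (AC_B (AC_cst a b (N b / I a b k)) (AC_int gi)) => // x _.
  by rewrite sub0r /g opprB.
Qed.

End Subsolutions.

(** * Monotone iteration and removal of the truncation *)

Section Sublinear.
Context {R : realType}.
Context (a b : R) (k cc mp mn : R -> R) (q : R).
Context (ab : a < b) (ck : {within `[a, b], continuous k})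
  (kpos : forall x, a <= x <= b -> 0 < k x).
Context (cci : itg a b cc) (mpi : itg a b mp) (mni : itg a b mn).
Context (cc0 : forall x, a <= x <= b -> 0 <= cc x)
  (mp0 : forall x, a <= x <= b -> 0 <= mp x)
  (mn0 : forall x, a <= x <= b -> 0 <= mn x).
Context (q0 : 0 < q) (q1 : q < 1).
Implicit Types (x y t l : R) (f g h u v w Q U V W : R -> R).

Lemma itgM_powR h u : itg a b h -> {within `[a, b], continuous u} ->
  (forall x, a <= x <= b -> 0 <= u x) -> itg a b (fun x => h x * u x `^ q).
Proof.
move=> hi cu u0; have [M M0 uM] := continuous_bounded cu.
apply: (@itgM_bounded _ a b (M `^ q)) => //.
  apply: (measurableT_comp (measurable_powR q)).
  exact: continuous_measurable.
move=> x xab; rewrite ger0_norm ?powR_ge0//; apply: ler_powRl; rewrite ?(ltW q0) ?u0//.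
by rewrite (le_trans (ler_norm _))// uM.
Qed.

Lemma itgM_trunc_pow l h u : 0 <= l -> itg a b h -> {within `[a, b], continuous u} ->
  (forall x, a <= x <= b -> 0 <= u x) -> itg a b (fun x => h x * trunc_pow q l (u x)).
Proof.
move=> l0 hi cu u0; have [M M0 uM] := continuous_bounded cu.
have mu_ := continuous_measurable cu.
apply: (@itgM_bounded _ a b (l * M)) => //.
  apply: measurable_minr; last exact: measurable_funM.
  exact: (measurableT_comp (measurable_powR q)).
move=> x xab; rewrite ger0_norm ?trunc_pow_ge0 ?u0//.
apply: le_trans (trunc_pow_le_lin _ _ _) _; apply: ler_wpM2l => //.
by rewrite (le_trans (ler_norm _))// uM.
Qed.

Lemma maximal_truncated_solution (K l : R) u0 W0 : 0 <= l ->
  BVP a b k cc (fun x => K * mp x) u0 W0 ->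
  (forall x, a <= x <= b -> 0 <= u0 x) ->
  (forall x, a <= x <= b -> u0 x `^ q <= K) ->
  exists u, [/\ exists W, BVP a b k cc
      (fun x => mp x * u x `^ q - mn x * trunc_pow q l (u x)) u W,
    forall x, a <= x <= b -> 0 <= u x <= u0 x &
    forall v, (forall x, a <= x <= b -> 0 <= v x <= u0 x) ->
      subsol a b k cc (fun x => mp x * v x `^ q - mn x * trunc_pow q l (v x)) v ->
      forall x, a <= x <= b -> v x <= u x].
Proof.
move=> l0 u0B u00 u0K.
have cu0 : {within `[a, b], continuous u0} by case: u0B => _ _ /AC_continuous.
have [M M0 u0M] := continuous_bounded cu0.
pose Q x := cc x + l * mn x.
have Qi : itg a b Q by apply: itgD => //; exact: itgZ.
have Q0 x : a <= x <= b -> 0 <= Q x.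
  by move=> xab; rewrite addr_ge0 ?cc0// mulr_ge0 ?mn0.
(* Adding [l * mn * u] to both sides leaves a right-hand side that is nonnegative and nondecreasing
   in [u], at the price of the larger coefficient [Q]. *)
pose F (u : R -> R) x := mp x * u x `^ q + mn x * (l * u x - trunc_pow q l (u x)).
have Fi u : {within `[a, b], continuous u} -> (forall x, a <= x <= b -> 0 <= u x) ->
    itg a b (F u).
  move=> cu u_0; apply: itgD; first exact: itgM_powR.
  apply: itg_ext (itgB (itgZ l (itgM_continuous mni cu)) (itgM_trunc_pow l0 mni cu u_0)).
  by move=> x _; ring.
have F0 u x : a <= x <= b -> 0 <= u x -> 0 <= F u x.
  move=> xab u_0; rewrite addr_ge0// ?mulr_ge0 ?powR_ge0 ?mp0 ?mn0//.
  by rewrite subr_ge0 trunc_pow_le_lin.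
have Fmono u v x : a <= x <= b -> 0 <= u x -> u x <= v x -> F u x <= F v x.
  move=> xab u_0 uv; apply: lerD; apply: ler_wpM2l; rewrite ?mp0 ?mn0//.
    exact: ler_powRl (ltW q0) _ _.
  exact: trunc_pow_remainder.
pose sol f := xget (fun=> 0) [set u | exists W, BVP a b k Q f u W].
have solP f : itg a b f -> exists W, BVP a b k Q f (sol f) W.
  move=> fi; have [d [C _ /(_ f fi)[u [W [uB _ _]]]]] := BVP_exists ab ck kpos Qi Q0.
  by rewrite /sol; case: xgetP => [v -> //|/(_ u)[]]; exists W.
pose u_ n := iter n (fun u => sol (F u)) u0.
(* The last item says that [u_ n] is a supersolution: it solves the linear problem with a source [f]
   above [F (u_ n)]. Comparison gives [u_ n.+1 <= u_ n], and [F (u_ n)] is then the source [f] for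
   the next index. *)
have inv n : [/\ {within `[a, b], continuous (u_ n)},
    forall x, a <= x <= b -> 0 <= u_ n x <= u0 x &
    exists f W, [/\ itg a b f, BVP a b k Q f (u_ n) W &
      forall x, a <= x <= b -> F (u_ n) x <= f x]].
  elim: n => [|n [cu u_0 [f [W [fi fB Ff]]]]].
    split=> //; first by move=> x xab; rewrite u00//=.
    exists (fun x => K * mp x + l * mn x * u0 x), W0; split.
    - by apply: itgD; [exact: itgZ|apply: itgM_continuous => //; exact: itgZ].
    - case: u0B => u0a u0b u0AC W0AC; split=> //; apply: AC_ext W0AC => // x _.
      by rewrite /Q /u_ /=; ring.
    - move=> x xab; apply: lerD; first by rewrite mulrC ler_wpM2r ?mp0 ?u0K.
      rewrite (_ : l * mn x * u0 x = mn x * (l * u0 x)); last by ring.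
      apply: ler_wpM2l; first exact: mn0.
      by rewrite gerBl trunc_pow_ge0 ?u00.
  have un0 x : a <= x <= b -> 0 <= u_ n x by move=> /u_0/andP[].
  have Fni : itg a b (F (u_ n)) by exact: Fi.
  have [W' WB] := solP _ Fni.
  have le_u x : a <= x <= b -> u_ n.+1 x <= u_ n x.
    apply: (BVP_le kpos Qi Q0 fi Fni _ fB WB) => // {}x /andP[ax xb].
    by apply: Ff; rewrite !ltW.
  have ge_u x : a <= x <= b -> 0 <= u_ n.+1 x.
    apply: (BVP_ge0 kpos Qi Q0 Fni _ WB) => // {}x /andP[ax xb].
    by apply: F0; rewrite ?un0// !ltW.
  split.
  - by case: WB => _ _ /AC_continuous.
  - move=> x xab; rewrite ge_u//=; apply: le_trans (le_u x xab) _.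
    by have /andP[] := u_0 x xab.
  - exists (F (u_ n)), W'; split=> // x xab.
    by apply: Fmono => //; [exact: ge_u|exact: le_u].
have cu_ n : {within `[a, b], continuous (u_ n)} by have [] := inv n.
have un0 n x : a <= x <= b -> 0 <= u_ n x by have [_ + _ xab] := inv n => /(_ x xab)/andP[].
have unu0 n x : a <= x <= b -> u_ n x <= u0 x by have [_ + _ xab] := inv n => /(_ x xab)/andP[].
have Fni n : itg a b (F (u_ n)) by apply: Fi => // x; exact: un0.
have SB n : exists W, BVP a b k Q (F (u_ n)) (u_ n.+1) W by exact: solP.
have dec n x : a <= x <= b -> u_ n.+1 x <= u_ n x.
  have [_ _ [f [W [fi fB Ff]]]] := inv n; have [W' WB] := SB n.
  apply: (BVP_le kpos Qi Q0 fi (Fni n) _ fB WB) => // {}x /andP[ax xb].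
  by apply: Ff; rewrite !ltW.
pose u x := limn (fun n => u_ n x).
have cvgu x : a <= x <= b -> (fun n => u_ n x) @ \oo --> u x.
  move=> xab; apply: nonincreasing_is_cvgn.
    by apply/nonincreasing_seqP => n; exact: dec.
  by exists 0 => _ [n _ <-]; exact: un0.
have [W_ WB] := choice SB.
have FK n x : a <= x <= b -> `|F (u_ n) x| <= K * mp x + l * M * mn x.
  move=> xab; rewrite ger0_norm; last by apply: F0 => //; exact: un0.
  apply: lerD.
    rewrite mulrC ler_wpM2r ?mp0//; apply: le_trans (u0K x xab).
    by apply: ler_powRl; rewrite ?(ltW q0) ?un0 ?unu0.
  rewrite mulrC ler_wpM2r ?mn0//; apply: (@le_trans _ _ (l * u_ n x)).
    by rewrite gerBl trunc_pow_ge0// un0.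
  rewrite ler_wpM2l// (le_trans (unu0 n x xab))//.
  by rewrite (le_trans (ler_norm _))// u0M.
have [|||||Fui [W uB]] := @BVP_limit R a b k ab ck kpos Q (fun n => F (u_ n))
    (fun n => u_ n.+1) W_ (F u) u (fun x => K * mp x + l * M * mn x) M Qi WB Fni.
- move=> x xab; have u_p n : 0 <= u_ n x by exact: un0.
  apply: cvgD; apply: cvgMr; first exact: cvg_powR (cvgu x xab).
  by apply: cvgB; [apply: cvgMr; exact: cvgu|apply: cvg_trunc_pow => //; exact: cvgu].
- by move=> x xab; rewrite (cvg_shiftS (fun n => u_ n x)); exact: cvgu.
- by apply: itgD; exact: itgZ.
- by move=> n x xab; exact: FK.
- move=> n x xab; rewrite ger0_norm ?un0// (le_trans (unu0 _ x xab))//.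
  by rewrite (le_trans (ler_norm _))// u0M.
exists u; split.
- exists W; case: uB => ua ub uAC WAC; split=> //; apply: AC_ext WAC => // x _.
  by rewrite /Q /F; ring.
- move=> x xab; apply/andP; split.
    by apply: cvgn_ge (cvgu x xab) _ => n; exact: un0.
  by apply: cvgn_le (cvgu x xab) _ => n; exact: unu0.
move=> v vu0 vS; have [cv _ _ _] := vS.
have v0 x : a <= x <= b -> 0 <= v x by move=> /vu0/andP[].
have vSQ : subsol a b k Q (F v) v.
  apply: subsol_le vS => //; last by move=> x _; rewrite /Q /F; rewrite le_eqVlt; apply/orP; left; apply/eqP; ring.
  - by apply: itgB; [exact: itgM_powR|exact: itgM_trunc_pow].
  - exact: Fi.
have vun n x : a <= x <= b -> v x <= u_ n x.
  elim: n x => [x /vu0/andP[]//|n IH].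
  apply: (subsol_le_BVP kpos Qi Q0 (Fni n) (Fi _ cv v0) _ (WB n) vSQ).
  move=> x /andP[ax xb] _; have xab : a <= x <= b by rewrite !ltW.
  by apply: Fmono => //; [exact: v0|exact: IH].
by move=> x xab; apply: cvgn_ge (cvgu x xab) _ => n; exact: vun.
Qed.

(* The maximal solutions of the problems truncated at levels [n + 1] decrease
   to a solution. *)
Lemma positive_solution w : {within `[a, b], continuous w} ->
  (forall x, a <= x <= b -> 0 <= w x) -> (forall x, a < x < b -> 0 < w x) ->
  subsol a b k cc (fun x => mp x * w x `^ q - mn x * w x `^ q) w ->
  exists u W, (forall x, a < x < b -> 0 < u x) /\
    BVP a b k cc (fun x => mp x * u x `^ q - mn x * u x `^ q) u W.
Proof.
move=> cw w0 wpos wS.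
have [Mw Mw0 wM] := continuous_bounded cw.
have [d [C _ /(_ mp mpi)[Phi [W' [PhiB _ _]]]]] := BVP_exists ab ck kpos cci cc0.
have cPhi : {within `[a, b], continuous Phi} by case: PhiB => _ _ /AC_continuous.
have Phi0 x : a <= x <= b -> 0 <= Phi x.
  apply: (BVP_ge0 kpos cci cc0 mpi _ PhiB) => // {}x /andP[ax xb].
  by rewrite mp0// !ltW.
have [B B0 PhiM] := continuous_bounded cPhi.
(* [K * Phi] is a supersolution once [(K * B)^q <= K], that is [B^q <= K^(1 - q)]; hence the
   exponent. The maximum with 1 keeps [D] positive, and [K] also exceeds [Mw^q] so that [K * Phi]
   lies above [w]. *)
pose D := (Num.max 1 B) `^ (q / (1 - q)).
pose K := Num.max (Mw `^ q) D.
have q1' : 0 < 1 - q by rewrite subr_gt0.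
have B1 : 0 < Num.max 1 B by rewrite lt_max ltr01.
have D0 : 0 < D by exact: powR_gt0.
have K0 : 0 < K by rewrite lt_max D0 orbT.
have KB : (K * B) `^ q <= K.
  rewrite powRM ?(ltW K0)//.
  apply: (@le_trans _ _ (K `^ q * K `^ (1 - q))).
    apply: ler_wpM2l; first exact: powR_ge0.
    apply: (@le_trans _ _ (D `^ (1 - q))); last first.
      by apply: ler_powRl; [exact: ltW|exact: ltW|rewrite le_max lexx orbT].
    rewrite /D -powRrM divfK ?gt_eqF//; apply: ler_powRl; rewrite ?(ltW q0)//.
    by rewrite le_max lexx orbT.
  rewrite -powRD; last by apply/implyP => _; rewrite gt_eqF.
  by rewrite addrC subrK powRr1// ltW.
pose u0 x := K * Phi x.
have u0B : BVP a b k cc (fun x => K * mp x) u0 (fun x => K * W' x).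
  case: PhiB => Pa Pb PAC W'AC; split; rewrite /u0 ?Pa ?Pb ?mulr0//.
    by apply: AC_ext (AC_Z K PAC) => // x _; ring.
  by apply: AC_ext (AC_Z K W'AC) => // x _; ring.
have u00 x : a <= x <= b -> 0 <= u0 x by move=> xab; rewrite mulr_ge0 ?(ltW K0) ?Phi0.
have u0K x : a <= x <= b -> u0 x `^ q <= K.
  move=> xab; apply: le_trans KB; apply: ler_powRl; rewrite ?(ltW q0) ?u00//.
  by apply: ler_wpM2l; [exact: ltW|rewrite (le_trans (ler_norm _))// PhiM].
have mw_i : itg a b (fun x => mp x * w x `^ q - mn x * w x `^ q).
  by apply: itgB; exact: itgM_powR.
have wu0 x : a <= x <= b -> w x <= u0 x.
  apply: (subsol_le_BVP kpos cci cc0 (itgZ K mpi) mw_i _ u0B wS) => {}x /andP[ax xb] _.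
  have xab : a <= x <= b by rewrite !ltW.
  apply: (@le_trans _ _ (mp x * w x `^ q)).
    by rewrite gerBl mulr_ge0 ?mn0 ?powR_ge0.
  rewrite mulrC ler_wpM2r ?mp0// le_max; apply/orP; left.
  by apply: ler_powRl; rewrite ?(ltW q0) ?w0// (le_trans (ler_norm _))// wM.
have TS n : exists u, [/\ exists W, BVP a b k cc
      (fun x => mp x * u x `^ q - mn x * trunc_pow q n.+1%:R (u x)) u W,
    forall x, a <= x <= b -> 0 <= u x <= u0 x &
    forall v, (forall x, a <= x <= b -> 0 <= v x <= u0 x) ->
      subsol a b k cc (fun x => mp x * v x `^ q - mn x * trunc_pow q n.+1%:R (v x)) v ->
      forall x, a <= x <= b -> v x <= u x].
  exact: maximal_truncated_solution (ler0n _ _) u0B u00 u0K.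
have [u_ /all_and3[uB u_u0 umax]] := choice TS.
have [W_ WB] := choice uB.
have un0 n x : a <= x <= b -> 0 <= u_ n x by move=> xab; have /andP[] := u_u0 n x xab.
have unu0 n x : a <= x <= b -> u_ n x <= u0 x by move=> xab; have /andP[] := u_u0 n x xab.
have cun n : {within `[a, b], continuous (u_ n)} by case: (WB n) => _ _ /AC_continuous.
pose f_ n x := mp x * u_ n x `^ q - mn x * trunc_pow q n.+1%:R (u_ n x).
have fi m n : itg a b (fun x => mp x * u_ n x `^ q - mn x * trunc_pow q m.+1%:R (u_ n x)).
  apply: itgB; first by apply: itgM_powR => // x; exact: un0.
  by apply: itgM_trunc_pow => // x; exact: un0.
have dec n x : a <= x <= b -> u_ n.+1 x <= u_ n x.
  apply: umax; first exact: u_u0.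
  apply: subsol_le (BVP_subsol (WB n.+1)) => //.
  move=> {}x /andP[ax xb]; have xab : a <= x <= b by rewrite !ltW.
  rewrite lerD2l lerN2 lerD2l lerN2; apply: ler_wpM2l; first exact: mn0.
  by apply: trunc_pow_le; rewrite ?un0// ler_nat.
have wun n x : a <= x <= b -> w x <= u_ n x.
  apply: umax; first by move=> {}x xab; rewrite w0// wu0.
  apply: subsol_le wS => //.
    by apply: itgB; [exact: itgM_powR|exact: itgM_trunc_pow].
  move=> {}x /andP[ax xb]; have xab : a <= x <= b by rewrite !ltW.
  rewrite lerD2l lerN2 lerD2l lerN2; apply: ler_wpM2l; first exact: mn0.
  exact: trunc_pow_le_powR.
pose u x := limn (fun n => u_ n x).
have cvgu x : a <= x <= b -> (fun n => u_ n x) @ \oo --> u x.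
  move=> xab; apply: nonincreasing_is_cvgn.
    by apply/nonincreasing_seqP => n; exact: dec.
  by exists 0 => _ [n _ <-]; exact: un0.
have uun x n : a <= x <= b -> u x <= u_ n x.
  move=> xab; apply: nonincreasing_cvgn_ge; last exact: cvgP (cvgu x xab).
  by apply/nonincreasing_seqP => m; exact: dec.
have upos x : a < x < b -> 0 < u x.
  move=> xab; apply: lt_le_trans (wpos x xab) _; move: xab => /andP[ax xb].
  have xab : a <= x <= b by rewrite !ltW.
  by apply: cvgn_ge (cvgu x xab) _ => n; exact: wun.
have cu0 : {within `[a, b], continuous u0} by case: u0B => _ _ /AC_continuous.
have [M M0 u0M] := continuous_bounded cu0.
have unb n x : x \in [:: a; b] -> u_ n x = 0.
  by rewrite !inE => /orP[] /eqP ->; case: (WB n).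
have fh n x : a <= x <= b -> `|f_ n x| <= K * mp x + K * mn x.
  move=> xab; have uK : u_ n x `^ q <= K.
    by apply: le_trans (u0K x xab); apply: ler_powRl; rewrite ?(ltW q0) ?un0 ?unu0.
  apply: le_trans (ler_normB _ _) _.
  rewrite !ger0_norm ?mulr_ge0 ?mn0 ?mp0 ?powR_ge0 ?trunc_pow_ge0 ?un0//.
  apply: lerD; rewrite mulrC ler_wpM2r ?mp0 ?mn0//.
  by apply: le_trans uK; exact: trunc_pow_le_powR.
have [||||_ [W uBVP]] := @BVP_limit R a b k ab ck kpos cc f_ u_ W_
    (fun x => mp x * u x `^ q - mn x * u x `^ q) u (fun x => K * mp x + K * mn x) M
    cci WB (fun n => fi n n) _ cvgu.
(* At the end points all [u_ n] vanish and the sources are constant in [n]. Inside, the positive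
   limit bounds the decreasing sequence from below, and [cvg_trunc_powR] applies. *)
- move=> x xab; have [/unb ux|] := boolP (x \in [:: a; b]).
    have u_0 : u x = 0.
      apply: (cvg_unique (@Rhausdorff R) (cvgu x xab)).
      rewrite (_ : (fun n => u_ n x) = fun=> 0); first exact: cvg_cst.
      by apply/funext => n; exact: ux.
    rewrite (_ : f_^~ x = fun=> mp x * u x `^ q - mn x * u x `^ q); first exact: cvg_cst.
    apply/funext => n; rewrite /f_ ux u_0 /trunc_pow powR0 ?gt_eqF//.
    by rewrite !mulr0 minxx mulr0.
  rewrite !inE negb_or => /andP[xa xb].
  have xab' : a < x < b.
    by move: xab => /andP[ax xb']; rewrite !lt_neqAle eq_sym xa ax xb.
  apply: cvgB; apply: cvgMr.
    by apply: cvg_powR (cvgu x xab) => // n; exact: un0.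
  apply: cvg_trunc_powR (cvgu x xab) => //; first exact: upos.
  by move=> n; exact: uun.
- by apply: itgD; exact: itgZ.
- exact: fh.
- move=> n x xab; rewrite ger0_norm ?un0// (le_trans (unu0 _ x xab))//.
  by rewrite (le_trans (ler_norm _))// u0M.
by exists u, W.
Qed.

End Sublinear.

(** * Powers of a solution as subsolutions for larger exponents *)

Section PowersOfSolutions.
Context {R : realType}.
Implicit Types (a b x y s t p q lo hi : R) (k cc mp mn f u w F W : R -> R).

Lemma powR_within_continuous A u s : 0 < s -> (forall x, A x -> 0 <= u x) ->
  {within A, continuous u} -> {within A, continuous (fun x => u x `^ s)}.
Proof.
move=> s0 u0 /within_continuousP cu; apply/within_continuousP => x Ax e e0.
have [ux|ux] := eqVneq (u x) 0.
  have e0' : 0 < e `^ s^-1 by exact: powR_gt0.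
  have [d d0 H] := cu x Ax _ e0'; exists d => // y Ay xyd.
  have := H y Ay xyd; rewrite ux powR0 ?gt_eqF// !sub0r !normrN.
  rewrite ger0_norm ?u0// ger0_norm ?powR_ge0// => h.
  have -> : e = (e `^ s^-1) `^ s by rewrite -powRrM mulVf ?gt_eqF// powRr1// ltW.
  by apply: gt0_ltr_powR; rewrite ?nnegrE ?u0// ltW.
have uxp : 0 < u x by rewrite lt_neqAle eq_sym ux u0.
have [+ _] := is_derive1_powR s uxp.
move=> /derivable1_diffP/differentiable_continuous/cvgrPdist_lt/(_ _ e0)[h /= h0 Hh].
have [d d0 H] := cu x Ax h h0; exists d => // y Ay xyd.
exact/Hh/H.
Qed.

Lemma powR_lipschitz lo hi s : 0 < lo -> exists L, forall z w : R,
  lo <= z <= hi -> lo <= w <= hi -> `|z `^ s - w `^ s| <= L * `|z - w|.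
Proof.
(* The power [z^(s - 1)] is monotone, in a direction depending on the sign of [s - 1]; the sum of
   its end values bounds it in either case. *)
move=> lo0; exists (`|s| * (lo `^ (s - 1) + hi `^ (s - 1))) => z w.
wlog zw : z w / z <= w => [H|].
  have [zw|/ltW wz] := leP z w; first exact: H.
  by move=> zl wl; rewrite distrC [in leRHS]distrC; exact: H.
move=> /andP[lz zh] /andP[lw wh].
have pos c : z <= c -> 0 < c by move=> /(le_trans lz)/(lt_le_trans lo0).
have [c|c|c] := @MVT_segment _ (fun c : R => c `^ s) (fun c => s * c `^ (s - 1)) z w zw.
- by rewrite in_itv/= => /andP[/ltW zc _]; apply: is_derive1_powR; exact: pos.
- apply: continuous_subspace_itv => {}c; rewrite in_itv/= => /andP[zc cw].
  have [+ _] := is_derive1_powR s (pos c zc).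
  by move=> /derivable1_diffP/differentiable_continuous.
- rewrite in_itv/= => /andP[zc cw] E1.
  have c0 := pos c zc.
  rewrite distrC E1 normrM [in leRHS]distrC ler_wpM2r// normrM ler_wpM2l//.
  rewrite ger0_norm ?powR_ge0//; have [s1|s1] := leP 0 (s - 1).
    apply: (@le_trans _ _ (hi `^ (s - 1))); last by rewrite lerDr powR_ge0.
    by apply: ler_powRl; rewrite ?(ltW c0)// (le_trans cw).
  apply: (@le_trans _ _ (lo `^ (s - 1))); last by rewrite lerDl powR_ge0.
  rewrite -[s - 1]opprK [leLHS]powRN [leRHS]powRN lef_pV2 ?posrE ?powR_gt0//.
  by apply: ler_powRl; rewrite ?oppr_ge0 ?(ltW s1) ?(ltW lo0)// (le_trans lz).
Qed.

Lemma AC_powR a b lo s F f : 0 < lo -> (forall x, a <= x <= b -> lo <= F x) ->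
  AC a b F f -> AC a b (fun x => F x `^ s) (fun x => s * F x `^ (s - 1) * f x).
Proof.
move=> lo0 Flo FA; have [M _ FM] := continuous_bounded (AC_continuous FA).
have [L HL] := @powR_lipschitz lo M (s - 1) lo0.
apply: (@AC_comp _ a b lo M (`|s| * L) (fun z : R => z `^ s) (fun z => s * z `^ (s - 1))) => //.
- by move=> x xab; rewrite Flo//= (le_trans (ler_norm _))// FM.
- by move=> z /andP[lz _]; apply: is_derive1_powR; exact: lt_le_trans lz.
- move=> z w zl wl; rewrite -mulrBr normrM -mulrA ler_wpM2l//.
  exact: HL.
Qed.

(* The exponent [g] is chosen so that [g - 1 + p = g * q], the factor [t] so
   that [t * g = t^q]. *)
Lemma power_subsol a b k cc mp mn p q u W : a < b ->
  (forall x, a <= x <= b -> 0 < k x) ->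
  {within `[a, b], continuous k} ->
  itg a b cc -> (forall x, a <= x <= b -> 0 <= cc x) ->
  itg a b mp -> itg a b mn -> 0 < p -> p < q -> q < 1 ->
  (forall x, a < x < b -> 0 < u x) ->
  BVP a b k cc (fun x => mp x * u x `^ p - mn x * u x `^ p) u W ->
  exists w, [/\ {within `[a, b], continuous w},
    forall x, a <= x <= b -> 0 <= w x, forall x, a < x < b -> 0 < w x &
    subsol a b k cc (fun x => mp x * w x `^ q - mn x * w x `^ q) w].
Proof.
move=> ab kpos ck cci cc0 mpi mni p0 pq q1 upos [ua ub uAC WAC].
have q0 := lt_trans p0 pq; have p1 := lt_trans pq q1.
have q1' : 0 < 1 - q by rewrite subr_gt0.
pose g := (1 - p) / (1 - q).
have g1 : 1 < g by rewrite ltr_pdivlMr// mul1r ltrD2l ltrN2.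
have g0 : 0 < g by exact: lt_trans g1.
have gq : g * q = g - 1 + p by rewrite /g; field; rewrite gt_eqF.
pose t := g `^ (q - 1)^-1.
have t0 : 0 < t by exact: powR_gt0.
have tq : t `^ q = t * g.
  have q1n : q - 1 != 0 by rewrite subr_eq0 lt_eqF.
  rewrite -[q in LHS](subrK 1) powRD; last by apply/implyP => _; rewrite gt_eqF.
  by rewrite powRr1 ?(ltW t0)// /t -powRrM mulVf// powRr1 ?(ltW g0)// mulrC.
have cu := AC_continuous uAC.
have u0 x : a <= x <= b -> 0 <= u x.
  move=> /andP[ax xb]; have [->|xa] := eqVneq x a; first by rewrite ua.
  have [->|xb'] := eqVneq x b; first by rewrite ub.
  by apply/ltW/upos; rewrite !lt_neqAle eq_sym xa ax xb' xb.
pose w x := t * u x `^ g.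
have cw : {within `[a, b], continuous w}.
  have cug : {within `[a, b], continuous (fun x => u x `^ g)}.
    by apply: powR_within_continuous => // x; rewrite /= in_itv/=; exact: u0.
  by move=> x; apply: continuousM (cug x); exact: cst_continuous.
exists w; split=> //.
- by move=> x xab; rewrite mulr_ge0 ?powR_ge0// ltW.
- by move=> x xab; rewrite mulr_gt0 ?powR_gt0// upos.
split=> //.
- by rewrite /w ua powR0 ?gt_eqF// mulr0.
- by rewrite /w ub powR0 ?gt_eqF// mulr0.
(* This is [w' / k], since [u' = k * W]. *)
exists (fun x => t * g * (u x `^ (g - 1) * W x)) => x y ax xy yb.
have xyab z : x <= z <= y -> a < z < b.
  by move=> /andP[xz zy]; rewrite (lt_le_trans ax xz) (le_lt_trans zy yb).
have cuxy : {within `[x, y], continuous u}.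
  by apply: continuous_subspaceW cu; apply: subset_itv; rewrite bnd_simp ltW.
have [lo lo0 ulo] : exists2 lo, 0 < lo & forall z, x <= z <= y -> lo <= u z.
  by apply: continuous_gt0_bounded => // z /xyab; exact: upos.
have uACxy := AC_sub (ltW ax) (ltW yb) uAC.
have WACxy := AC_sub (ltW ax) (ltW yb) WAC.
have ugAC := AC_powR g lo0 ulo uACxy.
have ug1AC := AC_powR (g - 1) lo0 ulo uACxy.
split.
  by apply: AC_ext (AC_Z t ugAC) => // z _; ring.
have VAC := AC_Z (t * g) (AC_mul ug1AC WACxy).
have [Vi /(_ x y (lexx _) xy (lexx _)) ->] := VAC.
have sub h : itg a b h -> itg x y h by apply: itg_sub; exact: ltW.
apply: I_le => //.
  apply: sub; apply: itgB; first exact: itgM_continuous.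
  by apply: itgB; apply: itgM_powR => // z zab; rewrite mulr_ge0 ?powR_ge0// ltW.
move=> z zxy; have uz : 0 < u z by exact/upos/xyab.
have zab : a <= z <= b by have /andP[h1 h2] := xyab z zxy; rewrite !ltW.
have wq : w z `^ q = t * g * (u z `^ (g - 1) * u z `^ p).
  rewrite /w powRM ?powR_ge0 ?(ltW t0)// tq -powRrM gq powRD//.
  by apply/implyP => _; rewrite gt_eqF.
have wz : w z = t * (u z `^ (g - 1) * u z).
  rewrite /w -[g in LHS](subrK 1) powRD; last by apply/implyP => _; rewrite gt_eqF.
  by rewrite powRr1// ltW.
rewrite wq wz.
set A := u z `^ (g - 1); set B := u z `^ p.
have A0 : 0 <= A by exact: powR_ge0.
rewrite -subr_ge0.
(* The choice of [g] and [t] cancels the terms in [mp] and [mn], whatever their signs. A convexity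
   term in [W^2] and a term in [cc] remain, both nonnegative because [g > 1]. *)
have -> : t * g * ((g - 1) * u z `^ (g - 1 - 1) * (k z * W z) * W z +
   A * (cc z * u z - (mp z * B - mn z * B))) -
  (cc z * (t * (A * u z)) - (mp z * (t * g * (A * B)) - mn z * (t * g * (A * B)))) =
  t * g * ((g - 1) * u z `^ (g - 1 - 1) * k z * (W z * W z)) +
  t * (g - 1) * (A * (cc z * u z)) by ring.
have g10 : 0 <= g - 1 by rewrite subr_ge0 ltW.
have W2 : 0 <= W z * W z by rewrite -expr2 sqr_ge0.
have tg0 : 0 <= t * g by rewrite mulr_ge0 ?ltW.
have kz : 0 <= k z by apply/ltW/kpos.
apply: addr_ge0.
  by do 4!apply: mulr_ge0 => //; exact: powR_ge0.
apply: mulr_ge0; first by apply: mulr_ge0 => //; exact: ltW.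
by apply: mulr_ge0 => //; apply: mulr_ge0; [exact: cc0|exact: ltW].
Qed.

End PowersOfSolutions.

(** * A subsolution near a Lebesgue point *)

Section LocalBarrier.
Context {R : realType}.
Implicit Types (a b x y s t p q r : R) (k cc mp mn f u w Q F W : R -> R).

(** Young's inequality for [x^p * 1] with exponents [1/p] and [1/(1-p)], the resulting [p * x] being
    weakened to [x]. *)
Lemma powR_le_affine p x : 0 < p -> p < 1 -> 0 <= x -> x `^ p <= 1 - p + x.
Proof.
move=> p0 p1 x0; have p1' : 0 < 1 - p by rewrite subr_gt0.
have pE : p^-1^-1 + (1 - p)^-1^-1 = 1 by rewrite !invrK addrC subrK.
have ip : 0 < p^-1 by rewrite invr_gt0.
have iq : 0 < (1 - p)^-1 by rewrite invr_gt0.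
have := conjugate_powR (powR_ge0 x p) ler01 ip iq pE.
rewrite !invrK.
rewrite mulr1 -powRrM divff ?gt_eqF// powRr1// powR1 mul1r => /le_trans; apply.
by rewrite addrC lerD2l ler_piMr// ltW.
Qed.

Lemma I_between x y (k1 k2 : R) k : x <= y -> itg x y k ->
  (forall t, x <= t <= y -> k1 <= k t <= k2) ->
  k1 * (y - x) <= I x y k <= k2 * (y - x).
Proof.
move=> xy ki H; rewrite -!(I_cst _ xy); apply/andP; split; apply: I_le => //;
  by [exact: itg_cst|move=> t /H/andP[]].
Qed.

(* On [x0 - 2r, x0 + 2r] compare [psi] with the solution of the Dirichlet
   problem with right-hand side [f - M Q], where [M] is an upper bound for that
   solution. *)
Lemma local_barrier (x0 r k1 k2 D : R) k f Q psi Psi :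
  let a := x0 - 2 * r in let b := x0 + 2 * r in
  0 < r -> 0 < k1 -> 0 < D -> {within `[a, b], continuous k} ->
  (forall x, a <= x <= b -> k1 <= k x <= k2) ->
  itg a b f -> (forall x, a <= x <= b -> 0 <= f x <= D) ->
  itg a b Q -> (forall x, a <= x <= b -> 0 <= Q x) ->
  AC a b psi (fun x => k x * Psi x) -> AC a b Psi (fun x => Q x * psi x - f x) ->
  (forall x, a <= x <= b -> 0 <= psi x) ->
  forall x, x0 - r <= x <= x0 + r ->
    r * k1 ^+ 3 / (16 * k2 ^+ 2) * I (x0 - r) (x0 + r) f -
      256 * k2 ^+ 2 * D * r ^+ 3 * I a b Q <= psi x.
Proof.
move=> a b r0 k10 D0 ck kk fi fD Qi Q0 pAC PAC p0 x /andP[xl xr].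
have ab : a < b by rewrite /a /b; lra.
have kpos t : a <= t <= b -> 0 < k t by move=> /kk/andP[h _]; exact: lt_le_trans h.
have k20 : 0 < k2.
  have /andP[h1 h2] : k1 <= k a <= k2 by apply: kk; rewrite lexx ltW.
  exact: lt_le_trans k10 (le_trans h1 h2).
have ki := continuous_itg ck.
have kII y z : a <= y -> y <= z -> z <= b -> k1 * (z - y) <= I y z k <= k2 * (z - y).
  move=> ay yz zb; apply: I_between => //; first exact: itg_sub ki.
  by move=> t /andP[yt tz]; apply: kk; rewrite (le_trans ay yt) (le_trans tz zb).
have T0 := I_gt0 ab ck kpos.
have /andP[T1l T1u] := kII a b (lexx _) (ltW ab) (lexx _).
set T1 := I a b k in T0 T1l T1u.
have baE : b - a = 4 * r by rewrite /a /b; ring.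
rewrite baE in T1l T1u.
(* The upper bound of [dirichlet_exists] is at most [8 * k2 * r] times the L1 norm of the source, as
   the total mass of [k] is at most [4 * k2 * r]. For the source [f] the norm is at most
   [4 * r * D], whence [M]; for the source [M * Q] the result is the constant with 256. *)
pose M := 32 * k2 * D * r ^+ 2.
have M0 : 0 < M by rewrite !mulr_gt0 ?exprn_gt0.
have QMi : itg a b (fun x => M * Q x) by exact: itgZ.
have [w1 [V1 [w1a w1b w1AC V1AC [w1u w1l]]]] := dirichlet_exists ab ck kpos fi.
have [w2 [V2 [w2a w2b w2AC V2AC [w2u w2l]]]] := dirichlet_exists ab ck kpos QMi.
have TT y : a <= y <= b -> 0 <= I a y k * I y b k <= T1 ^+ 2.
  move=> /andP[ay yb].
  have E : T1 = I a y k + I y b k by exact: I_split.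
  have /andP[l1 _] := kII a y (lexx _) ay yb.
  have /andP[l2 _] := kII y b ay yb (lexx _).
  have Ia0 : 0 <= I a y k by apply: le_trans l1; rewrite mulr_ge0 ?subr_ge0// ltW.
  have Ib0 : 0 <= I y b k by apply: le_trans l2; rewrite mulr_ge0 ?subr_ge0// ltW.
  by rewrite mulr_ge0//= expr2; apply: ler_pM => //; rewrite E ?lerDl ?lerDr.
have up S y : 0 <= S -> a <= y <= b ->
    2 / T1 * S * (I a y k * I y b k) <= 8 * k2 * r * S.
  move=> S0 yab; have /andP[_ h] := TT y yab.
  have c0 : 0 <= 2 / T1 * S by rewrite mulr_ge0// divr_ge0// ltW.
  apply: le_trans (ler_wpM2l c0 h) _.
  rewrite (_ : 2 / T1 * S * T1 ^+ 2 = 2 * S * T1); last by field; rewrite gt_eqF.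
  rewrite (_ : 8 * k2 * r * S = 2 * S * (k2 * (4 * r))); last by ring.
  by apply: ler_wpM2l => //; rewrite mulr_ge0.
have IfD : I a b (fun t => `|f t|) <= D * (4 * r).
  rewrite -baE -(I_cst _ (ltW ab)); apply: I_le; [exact: itg_norm|exact: itg_cst|].
  by move=> t /fD/andP[f0 fDt]; rewrite ger0_norm.
have If0 : 0 <= I a b (fun t => `|f t|) by apply: I_ge0 => t _.
have w1M y : a <= y <= b -> w1 y <= M.
  move=> yab; apply: le_trans (ler_norm _) _; apply: le_trans (w1u y yab) _.
  apply: le_trans (up _ y If0 yab) _.
  have c0 : 0 <= 8 * k2 * r by rewrite !mulr_ge0 ?ltW.
  apply: le_trans (ler_wpM2l c0 IfD) _.
  by rewrite le_eqVlt; apply/orP; left; apply/eqP; rewrite /M; ring.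
have IQ0 : 0 <= I a b Q by exact: I_ge0.
have IMQ : I a b (fun t => `|M * Q t|) = M * I a b Q.
  rewrite -I_Z//; apply: I_ext => t tab.
  by rewrite ger0_norm// mulr_ge0 ?Q0// ltW.
have w2U y : a <= y <= b -> w2 y <= 256 * k2 ^+ 2 * D * r ^+ 3 * I a b Q.
  move=> yab; apply: le_trans (ler_norm _) _; apply: le_trans (w2u y yab) _.
  rewrite IMQ; apply: le_trans (up _ y _ yab) _; first by rewrite mulr_ge0// ltW.
  by rewrite le_eqVlt; apply/orP; left; apply/eqP; rewrite /M; ring.
have w20 y : a <= y <= b -> 0 <= w2 y.
  move=> yab; have MQ0 z : a <= z <= b -> 0 <= M * Q z.
    by move=> zab; rewrite mulr_ge0 ?Q0// ltW.
  have := w2l MQ0 a a y (lexx _) (lexx _) (ltW ab) yab.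
  by rewrite I_xx !mul0r pmulr_rge0// exprn_gt0.
have xab : a <= x <= b by rewrite /a /b; apply/andP; split; lra.
(* Three integrals of [k] over intervals of length at least [r] give [(r * k1)^3], to be divided by
   the square of the total mass, at most [(4 * k2 * r)^2]. *)
have w1L : r * k1 ^+ 3 / (16 * k2 ^+ 2) * I (x0 - r) (x0 + r) f <= w1 x.
  have f0 z : a <= z <= b -> 0 <= f z by move=> /fD/andP[].
  have al : a <= x0 - r by rewrite /a; lra.
  have lr : x0 - r <= x0 + r by lra.
  have rb : x0 + r <= b by rewrite /b; lra.
  have := w1l f0 (x0 - r) (x0 + r) x al lr rb xab.
  set Jf := I (x0 - r) (x0 + r) f; rewrite -/T1 => h.
  have Jf0 : 0 <= Jf.
    apply: I_ge0 => z /andP[z1 z2]; apply: f0; apply/andP; split.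
      exact: le_trans al z1.
    exact: le_trans z2 rb.
  have low y z : a <= y -> y <= z -> z <= b -> r <= z - y -> r * k1 <= I y z k.
    move=> ay yz zb rzy; have /andP[l _] := kII y z ay yz zb.
    by apply: le_trans l; rewrite mulrC ler_wpM2l// ltW.
  have rk0 : 0 <= r * k1 by rewrite mulr_ge0 ?ltW.
  have /andP[ax xb] := xab.
  have h1 : r * k1 <= Num.min (I a (x0 - r) k) (I (x0 + r) b k).
    have e1 : x0 - r - a = r by rewrite /a; ring.
    have e2 : b - (x0 + r) = r by rewrite /b; ring.
    rewrite le_min; apply/andP; split; apply: low; rewrite ?e1 ?e2//.
      exact: le_trans lr rb.
    exact: le_trans al lr.
  have h2 : r * k1 <= I a x k by apply: low; rewrite // /a; lra.
  have h3 : r * k1 <= I x b k by apply: low; rewrite // /b; lra.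
  have h4 : Jf * (r * k1) * ((r * k1) * (r * k1)) <= T1 ^+ 2 * w1 x.
    apply: le_trans h; apply: ler_pM; [exact: mulr_ge0|exact: mulr_ge0| |].
      exact: ler_wpM2l.
    exact: ler_pM.
  have T2 : 0 < T1 ^+ 2 by rewrite exprn_gt0.
  rewrite -(ler_pM2l T2); apply: le_trans h4.
  have h5 : T1 ^+ 2 <= (k2 * (4 * r)) ^+ 2.
    by rewrite !expr2; apply: ler_pM => //; exact: ltW.
  have c0 : 0 <= r * k1 ^+ 3 / (16 * k2 ^+ 2) * Jf.
    apply: mulr_ge0 => //; apply/ltW/divr_gt0; rewrite ?mulr_gt0 ?exprn_gt0//.
  apply: le_trans (ler_wpM2r c0 h5) _.
  rewrite le_eqVlt; apply/orP; left; apply/eqP; field.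
  by rewrite gt_eqF.
suff : 0 <= psi x - (w1 x - w2 x).
  rewrite subr_ge0; apply: le_trans; apply: lerB => //; exact: w2U.
apply: (@max_principle _ a b (fun x => psi x - (w1 x - w2 x)) k
  (fun x => Psi x - (V1 x - V2 x))) => //.
- apply: AC_continuous (AC_B pAC (AC_B w1AC w2AC)).
- by rewrite w1a w2a !subr0 p0// lexx ltW.
- by rewrite w1b w2b !subr0 p0// lexx ltW.
- by move=> y /andP[ay yb]; rewrite ltW// kpos// !ltW.
- move=> y z ay yz zb; apply: AC_sub (ltW ay) (ltW zb) _.
  by apply: AC_ext (AC_B pAC (AC_B w1AC w2AC)) => // t _; ring.
move=> y z ay yz zb neg.
have [di /(_ y z (ltW ay) yz (ltW zb)) dE] := AC_B PAC (AC_B V1AC V2AC).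
rewrite -subr_le0 dE -oppr_ge0 -I_N; last exact: itg_sub (ltW ay) (ltW zb) di.
apply: I_ge0 => t tyz; have n := neg t tyz; move: tyz => /andP[yt tz].
have tab : a <= t <= b by rewrite (le_trans (ltW ay) yt) (le_trans tz (ltW zb)).
(* The right-hand side is nonnegative here: where the difference is negative,
   [psi < w1 - w2 <= M]. *)
have -> : - (Q t * psi t - f t - (- f t - - (M * Q t))) = Q t * (M - psi t) by ring.
have wM := w1M t tab; have w2t := w20 t tab.
by apply: mulr_ge0; [exact: Q0|lra].
Qed.

End LocalBarrier.

Section LebesguePoint.
Context {R : realType}.
Implicit Types (a b x y s t p q r : R) (k cc m f u w Q F W : R -> R).

(** The subsolution is a multiple of [w = s * psi - e * lam * chi], where [psi] and [chi] solve the
    linear problem with potential [cc + lam * mn] and sources [f <= mp] and [mn]. It suffices that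
    [f <= lam / 2 * mp * psi], which concerns only a small interval around [x0], and that
    [e * lam * chi <= s * psi / 2], which holds for [e] small. *)
Lemma subsol_of_lebesgue_point a b k cc m (x0 D C : R) :
  a < b -> {within `[a, b], continuous k} -> (forall x, a <= x <= b -> 0 < k x) ->
  itg a b cc -> (forall x, a <= x <= b -> 0 <= cc x <= C) -> itg a b m ->
  0 < D -> a < x0 < b ->
  (forall e : R, 0 < e -> exists2 rho : R, 0 < rho & forall s, 0 < s -> s < rho ->
     I (x0 - s) (x0 + s) (fun t => `|m t - D|) <= e * s) ->
  exists p w, [/\ 0 < p < 1, {within `[a, b], continuous w},
    forall x, a <= x <= b -> 0 <= w x, forall x, a < x < b -> 0 < w x &
    subsol a b k cc (fun x => Num.max (m x) 0 * w x `^ p -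
                              Num.max (- m x) 0 * w x `^ p) w].
Proof.
move=> ab ck kpos cci ccC mi D0 /andP[ax0 x0b] LP.
pose mp x := Num.max (m x) 0; pose mn x := Num.max (- m x) 0.
have mp0 x : 0 <= mp x by rewrite /mp le_max lexx orbT.
have mn0 x : 0 <= mn x by rewrite /mn le_max lexx orbT.
have mm := itg_measurable mi.
have mpm : measurable_fun `[a, b] mp by exact: measurable_maxr.
have mpi : itg a b mp.
  apply: itg_le mi _ => // x _; rewrite ger0_norm// /mp ge_max normr_ge0 andbT.
  exact: ler_norm.
have mni : itg a b mn.
  apply: itg_le mi _ => [|x _].
    by apply: measurable_maxr => //; exact: measurable_funN.
  by rewrite ger0_norm// /mn ge_max normr_ge0 andbT -normrN ler_norm.
have [k1 k10 kk1] := continuous_gt0_bounded (ltW ab) ck kpos.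
have [k2 _ kk2] := continuous_bounded ck.
have k12 x : a <= x <= b -> k1 <= k x <= k2.
  by move=> xab; rewrite kk1//= (le_trans (ler_norm _))// kk2.
have k20 : 0 < k2.
  have /andP[h1 h2] : k1 <= k a <= k2 by apply: k12; rewrite lexx ltW.
  exact: lt_le_trans k10 (le_trans h1 h2).
have C0 : 0 <= C.
  by have /andP[h1 h2] : 0 <= cc a <= C by [apply: ccC; rewrite lexx ltW]; exact: le_trans h1 h2.
(* The main term of [local_barrier] is at least [c1 * r^2] when the source has mass at least
   [r * D]. With [Lam = 4 / c1], the bound [psi >= c1 / 2 * r^2] yields [lam / 2 * psi >= 1]. *)
pose c1 := D * k1 ^+ 3 / (16 * k2 ^+ 2).
have c10 : 0 < c1 by rewrite divr_gt0 ?mulr_gt0 ?exprn_gt0.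
pose Lam := 4 / c1.
have Lam0 : 0 < Lam by rewrite divr_gt0.
pose G := 256 * k2 ^+ 2 * D.
have G0 : 0 < G.
  apply: (mulr_gt0 (mulr_gt0 _ (exprn_gt0 2 k20)) D0).
  by rewrite ltr0n.
have GE : G = 256 * k2 ^+ 2 * D by [].
have c1E : c1 = D * k1 ^+ 3 / (16 * k2 ^+ 2) by [].
have LamE : Lam = 4 / c1 by [].
clearbody G Lam c1.
(* The first bound leaves the source [f] a mass of at least [r * D]; the second limits the loss due
   to [lam * mn] to [c1 / 4 * r^2]. *)
pose eta := Num.min (D / 2) (c1 / (8 * G * Lam)).
have eta0 : 0 < eta by rewrite lt_min divr_gt0//= divr_gt0// !mulr_gt0.
have eta1 : eta <= D / 2 by rewrite ge_min lexx.
have eta2 : G * Lam * eta <= c1 / 8.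
  have : eta <= c1 / (8 * G * Lam) by rewrite ge_min lexx orbT.
  have GL : 0 < G * Lam by rewrite mulr_gt0.
  move=> /(ler_wpM2l (ltW GL)) /le_trans; apply.
  by rewrite le_eqVlt; apply/orP; left; apply/eqP; field; rewrite !gt_eqF.
clearbody eta.
have [rho rho0 Hrho] := LP eta eta0.
(* The interval of radius [2 * r] has to stay within [rho] of [x0] and inside [a, b]. The last bound
   limits the loss due to [cc] to [c1 / 4 * r^2]. *)
pose r0 := Num.min (Num.min (rho / 4) 1)
  (Num.min (Num.min ((x0 - a) / 4) ((b - x0) / 4)) (c1 / (16 * G * (C + 1)))).
have C1 : 0 < C + 1 by rewrite ltr_wpDl.
have GC : 0 < 16 * G * (C + 1) by rewrite !mulr_gt0.
have r0p : 0 < r0.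
  by rewrite /r0 !lt_min ltr01 !divr_gt0 ?subr_gt0.
set r := r0 in r0p.
have r1 : r <= rho / 4 by rewrite /r /r0 !ge_min lexx.
have r2 : r <= 1 by rewrite /r /r0 !ge_min lexx !orbT.
have r3 : r <= (x0 - a) / 4 by rewrite /r /r0 !ge_min lexx !orbT.
have r4 : r <= (b - x0) / 4 by rewrite /r /r0 !ge_min lexx !orbT.
have r5 : r <= c1 / (16 * G * (C + 1)) by rewrite /r /r0 !ge_min lexx !orbT.
clearbody r.
(* [psi] is of order [r^2] near [x0], so [lam * psi] is bounded below independently of [r]. The
   error caused by [lam * mn] is at most [G * r^3 * lam * (eta * (2 * r)) = 2 * G * Lam * eta *
   r^2], of the same order in [r]; it is small through [eta] only. *)
pose lam := Lam / r ^+ 2.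
have lam0 : 0 < lam by rewrite divr_gt0 ?exprn_gt0.
pose Q x := cc x + lam * mn x.
have cc0 x : a <= x <= b -> 0 <= cc x by move=> /ccC/andP[].
have Qi : itg a b Q by apply: itgD => //; exact: itgZ.
have Q0 x : a <= x <= b -> 0 <= Q x.
  by move=> xab; rewrite addr_ge0 ?cc0// mulr_ge0// ltW.
pose J := `[x0 - r, x0 + r]%classic : set R.
(* Cutting at [D] gives the bounded source that [local_barrier] requires; cutting to [J] leaves
   [f <= lam / 2 * mp * psi] to be checked near [x0] only. *)
pose f x := Num.min (mp x) D * \1_J x.
have f0 x : 0 <= f x by rewrite mulr_ge0// le_min mp0 ltW.
have fmp x : f x <= mp x.
  apply: (@le_trans _ _ (Num.min (mp x) D)); last by rewrite ge_min lexx.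
  apply: ler_piMr; first by rewrite le_min mp0 ltW.
  by rewrite indicE; case: (x \in J).
have fD x : f x <= D.
  apply: (@le_trans _ _ (Num.min (mp x) D)); last by rewrite ge_min lexx orbT.
  apply: ler_piMr; first by rewrite le_min mp0 ltW.
  by rewrite indicE; case: (x \in J).
have fi : itg a b f.
  apply: (itg_le _ mpi) => [|x _]; last by rewrite !ger0_norm.
  apply: measurable_funM; first by apply: measurable_minr => //; exact: measurable_cst.
  by apply: measurable_indic; exact: measurable_itv.
have fJ x : ~~ (x0 - r <= x <= x0 + r) -> f x = 0.
  by move=> xJ; rewrite /f indicE memNset ?mulr0// /J/= in_itv/=; exact/negP.
have fJ' x : x0 - r <= x <= x0 + r -> f x = Num.min (mp x) D.
  by move=> xJ; rewrite /f indicE mem_set ?mulr1// /J/= in_itv.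
have [d [Cd d0 HB]] := BVP_exists ab ck kpos Qi Q0.
have [psi [Psi [psiB _ psil]]] := HB f fi.
(* Subtracting [e * lam * chi] produces the term [e * lam * mn] left over by [w^p <= e + w]. *)
have [chi [Chi [chiB chiu _]]] := HB mn mni.
have [al lr rb aal rbb] : [/\ a < x0 - r, x0 - r <= x0 + r, x0 + r < b,
    a <= x0 - 2 * r & x0 + 2 * r <= b].
  by clear -r3 r4 r0p; split; lra.
have [rrho rrho2] : r < rho /\ 2 * r < rho by clear -r1 r0p; split; lra.
have sub h : itg a b h -> itg (x0 - 2 * r) (x0 + 2 * r) h by exact: itg_sub.
have sub1 h : itg a b h -> itg (x0 - r) (x0 + r) h by apply: itg_sub; exact: ltW.
have mDi : itg a b (fun t => `|m t - D|).
  by apply: itg_norm; apply: itgB => //; exact: itg_cst.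
have mDJ2 : I (x0 - 2 * r) (x0 + 2 * r) (fun t => `|m t - D|) <= eta * (2 * r).
  by apply: Hrho => //; rewrite mulr_gt0.
have mDJ : I (x0 - r) (x0 + r) (fun t => `|m t - D|) <= eta * r.
  exact: Hrho.
have If : r * D <= I (x0 - r) (x0 + r) f.
  apply: (@le_trans _ _ (I (x0 - r) (x0 + r) (fun t => D - `|m t - D|))).
    rewrite I_B; [|exact: itg_cst|exact: sub1].
    rewrite I_cst//; have : eta * r <= D / 2 * r by rewrite ler_wpM2r// ltW.
    have : 0 <= D * r by rewrite mulr_ge0// ltW.
    by move: mDJ; clear; lra.
  apply: I_le; [by apply: itgB; [exact: itg_cst|exact: sub1]|exact: sub1|].
  move=> t tJ; rewrite fJ'//; apply: le_trans (_ : Num.min (m t) D <= _).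
    rewrite le_min; apply/andP; split; last by rewrite gerBl.
    by have := ler_norm (D - m t); rewrite distrC; clear; lra.
  by rewrite le_min !ge_min lexx orbT andbT /mp le_max lexx.
have IJf : 0 < I (x0 - r) (x0 + r) f by apply: lt_le_trans If; rewrite mulr_gt0.
have [cd cd0 psid] := psil (fun x _ => f0 x) _ _ al lr rb IJf.
have [pa pb pAC PAC] := psiB.
have psi0 x : a <= x <= b -> 0 <= psi x.
  by apply: (BVP_ge0 kpos Qi Q0 fi _ psiB) => // y _.
have IQ : I (x0 - 2 * r) (x0 + 2 * r) Q <= 4 * r * C + lam * (eta * (2 * r)).
  rewrite I_D; [|exact: sub|by apply: itgZ; exact: sub].
  rewrite I_Z; last exact: sub.
  have E : 4 * r = x0 + 2 * r - (x0 - 2 * r) by ring.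
  apply: lerD.
    have a2b2 : x0 - 2 * r <= x0 + 2 * r by clear -r0p; lra.
    rewrite [4 * r * C]mulrC E -(I_cst C a2b2).
    apply: I_le; [exact: sub|exact: itg_cst|move=> t /andP[t1 t2]].
    have /ccC/andP[]// : a <= t <= b by rewrite (le_trans aal t1) (le_trans t2).
  apply: ler_wpM2l; first exact: ltW.
  apply: le_trans mDJ2; apply: I_le; [exact: sub|exact: sub|move=> t _].
  rewrite /mn ge_max normr_ge0 andbT -normrN.
  by apply: le_trans (ler_norm _); clear -D0; lra.
have psiJ x : x0 - r <= x <= x0 + r -> c1 / 2 * r ^+ 2 <= psi x.
  move=> xJ.
  have ck' : {within `[x0 - 2 * r, x0 + 2 * r], continuous k}.
    by apply: continuous_subspaceW ck; apply: subset_itv; rewrite bnd_simp.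
  have sab y : x0 - 2 * r <= y <= x0 + 2 * r -> a <= y <= b.
    by move=> /andP[y1 y2]; rewrite (le_trans aal y1) (le_trans y2).
  have := @local_barrier R x0 r k1 k2 D k f Q psi Psi r0p k10 D0 ck'
    (fun y yJ => k12 y (sab y yJ)) (sub _ fi) _ (sub _ Qi) (fun y yJ => Q0 y (sab y yJ))
    (AC_sub aal rbb pAC) (AC_sub aal rbb PAC) (fun y yJ => psi0 y (sab y yJ)) x xJ.
  move=> /(_ (fun y _ => introT andP (conj (f0 y) (fD y)))); apply: le_trans.
  have e1 : c1 * r ^+ 2 <= r * k1 ^+ 3 / (16 * k2 ^+ 2) * I (x0 - r) (x0 + r) f.
    have c0 : 0 <= r * k1 ^+ 3 / (16 * k2 ^+ 2).
      by rewrite ltW// divr_gt0 ?mulr_gt0 ?exprn_gt0.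
    apply: le_trans (ler_wpM2l c0 If).
    by rewrite le_eqVlt; apply/orP; left; apply/eqP; rewrite c1E; field; rewrite gt_eqF.
  have e2 : 256 * k2 ^+ 2 * D * r ^+ 3 * I (x0 - 2 * r) (x0 + 2 * r) Q <= c1 / 2 * r ^+ 2.
    have c0 : 0 <= 256 * k2 ^+ 2 * D * r ^+ 3 by rewrite -GE mulr_ge0 ?exprn_ge0 ?ltW.
    apply: le_trans (ler_wpM2l c0 IQ) _.
    apply: (@le_trans _ _ ((4 * (G * C * r ^+ 2) + 2 * (G * Lam * eta)) * r ^+ 2)).
      rewrite le_eqVlt; apply/orP; left; apply/eqP.
      by rewrite GE /lam; field; rewrite gt_eqF.
    apply: ler_wpM2r; first by rewrite exprn_ge0// ltW.
    have e3 : G * C * r ^+ 2 <= c1 / 16.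
      apply: (@le_trans _ _ (G * (C + 1) * r)).
        rewrite expr2 mulrA; apply: ler_pM; rewrite ?(ltW r0p)//.
          by rewrite !mulr_ge0// ltW.
        rewrite -mulrA; apply: ler_pM; rewrite ?(ltW G0)//.
          by rewrite mulr_ge0// ltW.
        apply: (@le_trans _ _ (C * 1)); first exact: ler_wpM2l.
        by rewrite mulr1 lerDl.
      have GC1 : 0 <= G * (C + 1) by rewrite mulr_ge0 ?ltW.
      apply: le_trans (ler_wpM2l GC1 r5) _.
      by rewrite le_eqVlt; apply/orP; left; apply/eqP; field; rewrite !gt_eqF.
    by move: e3 eta2; clear; lra.
  by move: e1 e2; clear; lra.
have xJab x : x0 - r <= x <= x0 + r -> a <= x <= b.
  by move=> /andP[h1 h2]; rewrite (le_trans (ltW al) h1) (le_trans h2 (ltW rb)).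
have fpsi x : a <= x <= b -> f x <= lam / 2 * (mp x * psi x).
  move=> xab; have c0 : 0 <= lam / 2 by rewrite ltW// divr_gt0.
  have [xJ|xJ] := boolP (x0 - r <= x <= x0 + r); last first.
    by rewrite fJ//; apply: mulr_ge0 => //; apply: mulr_ge0; [|exact: psi0].
  apply: le_trans (fmp x) _.
  rewrite mulrCA ler_peMr//.
  apply: le_trans (ler_wpM2l c0 (psiJ x xJ)).
  by rewrite le_eqVlt; apply/orP; left; apply/eqP; rewrite /lam LamE; field; rewrite !gt_eqF.
have chi0 x : a <= x <= b -> 0 <= chi x.
  by apply: (BVP_ge0 kpos Qi Q0 mni _ chiB) => // y _; exact: mn0.
have [ca cb cAC CAC] := chiB.
have [Mp Mp0 psiM] := continuous_bounded (AC_continuous pAC).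
have Mp1 : 0 < Mp + 1 by rewrite ltr_wpDl.
(* This normalisation gives [w <= 1], hence [w <= w^p]. *)
pose s := (Mp + 1)^-1.
have s0 : 0 < s by rewrite invr_gt0.
have spsi1 x : a <= x <= b -> s * psi x <= 1.
  move=> xab; rewrite mulrC ler_pdivrMr// mul1r.
  by rewrite (le_trans (ler_norm _))// (le_trans (psiM x xab))// lerDl.
pose K := `|Cd| * I a b (fun t => `|mn t|).
have K0 : 0 <= K by rewrite mulr_ge0// I_ge0.
have K1 : 0 < K + 1 by rewrite ltr_wpDl.
(* [chi <= K * d] and [psi >= cd * d] with the same [d], so this [e] gives
   [e * lam * chi <= s * psi / 2] up to the boundary. *)
pose e := Num.min (2^-1) (s * cd / (2 * lam * (K + 1))).
have e0 : 0 < e.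
  rewrite lt_min; apply/andP; split; first by rewrite invr_gt0.
  by apply: divr_gt0; apply: mulr_gt0 => //; exact: mulr_gt0.
have e1 : e <= 2^-1 by rewrite ge_min lexx.
have e2 : e * lam * K <= s * cd / 2.
  have lK : 0 < lam * (K + 1) by rewrite mulr_gt0.
  apply: (@le_trans _ _ (e * (lam * (K + 1)))).
    by rewrite -mulrA; apply: ler_wpM2l; [exact: ltW|apply: ler_wpM2l; [exact: ltW|rewrite lerDl]].
  have : e <= s * cd / (2 * lam * (K + 1)) by rewrite ge_min lexx orbT.
  move=> /(ler_wpM2r (ltW lK)) /le_trans; apply.
  by rewrite le_eqVlt; apply/orP; left; apply/eqP; field; rewrite !gt_eqF.
clearbody e.
pose p := 1 - e.
have p01 : 0 < p < 1 by rewrite /p; clear -e0 e1; apply/andP; split; lra.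
have /andP[p0 p1] := p01.
have chipsi x : a <= x <= b -> e * lam * chi x <= s * psi x / 2.
  move=> /andP[ax xb]; have [->|xa] := eqVneq x a; first by rewrite ca pa !mulr0 mul0r.
  have [->|xb'] := eqVneq x b; first by rewrite cb pb !mulr0 mul0r.
  have xab : a < x < b by rewrite !lt_neqAle eq_sym xa ax xb' xb.
  have dx := d0 x xab.
  have xab' : a <= x <= b by rewrite ax.
  have h1 : chi x <= K * d x.
    apply: le_trans (ler_norm _) _; apply: le_trans (chiu x xab') _.
    apply: ler_wpM2r; first exact: ltW.
    by apply: ler_wpM2r; [exact: I_ge0|exact: ler_norm].
  have el : 0 <= e * lam by rewrite mulr_ge0 ?ltW.
  apply: le_trans (ler_wpM2l el h1) _; rewrite mulrA.
  apply: le_trans (ler_wpM2r (ltW dx) e2) _.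
  rewrite mulrAC ler_wpM2r ?invr_ge0// -mulrA; apply: ler_wpM2l; first exact: ltW.
  exact: psid.
pose w x := s * psi x - e * lam * chi x.
have wpsi x : a <= x <= b -> s * psi x / 2 <= w x.
  by move=> /chipsi; rewrite /w; clear; lra.
have w0 x : a <= x <= b -> 0 <= w x.
  move=> xab; apply: le_trans (wpsi x xab).
  by rewrite divr_ge0// mulr_ge0 ?psi0// ltW.
have w1 x : a <= x <= b -> w x <= 1.
  move=> xab; apply: le_trans (spsi1 x xab); rewrite /w gerBl.
  by rewrite mulr_ge0 ?chi0// mulr_ge0// ltW.
have wpos x : a < x < b -> 0 < w x.
  move=> xab; have xab' : a <= x <= b by move: xab => /andP[h1 h2]; rewrite !ltW.
  apply: lt_le_trans (wpsi x xab'); rewrite divr_gt0// mulr_gt0//.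
  by apply: lt_le_trans (psid x xab'); rewrite mulr_gt0 ?d0.
(* As [t^p = t * lam], rescaling [w] by [t] supplies the factor [lam] in front of [m]. *)
pose t := lam `^ (p - 1)^-1.
have t0 : 0 < t by exact: powR_gt0.
have tp : t `^ p = t * lam.
  have p1n : p - 1 != 0 by rewrite subr_eq0 lt_eqF.
  rewrite -[p in LHS](subrK 1) powRD; last by apply/implyP => _; rewrite gt_eqF.
  by rewrite powRr1 ?(ltW t0)// /t -powRrM mulVf// powRr1 ?(ltW lam0)// mulrC.
have twAC : AC a b (fun x => t * w x) (fun x => k x * (t * (s * Psi x - e * lam * Chi x))).
  by apply: AC_ext (AC_Z t (AC_B (AC_Z s pAC) (AC_Z (e * lam) cAC))) => // x _; ring.
have VAC := AC_Z t (AC_B (AC_Z s PAC) (AC_Z (e * lam) CAC)).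
have ctw := AC_continuous twAC.
exists p, (fun x => t * w x); split => //.
- by move=> x xab; rewrite mulr_ge0 ?w0// ltW.
- by move=> x xab; rewrite mulr_gt0 ?wpos.
split=> //.
- by rewrite /w pa ca !mulr0 subr0 mulr0.
- by rewrite /w pb cb !mulr0 subr0 mulr0.
exists (fun x => t * (s * Psi x - e * lam * Chi x)) => x y ax xy yb.
split; first exact: AC_sub (ltW ax) (ltW yb) twAC.
have [Vi /(_ x y (ltW ax) xy (ltW yb)) ->] := VAC.
have subxy h : itg a b h -> itg x y h by apply: itg_sub; exact: ltW.
have tw0 z : a <= z <= b -> 0 <= t * w z by move=> zab; rewrite mulr_ge0 ?w0// ltW.
apply: I_le => //.
- apply: subxy; apply: itgB; first exact: itgM_continuous.
  by apply: itgB; apply: itgM_powR.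
- exact: subxy.
move=> z /andP[xz zy].
have zab : a <= z <= b by rewrite (le_trans (ltW ax) xz) (le_trans zy (ltW yb)).
rewrite -/(mp z) -/(mn z).
rewrite powRM ?(ltW t0) ?w0// tp.
set B := w z `^ p.
(* Near the exponent [1], [w^p <= e + w]: the term with [m^-] is carried by the
   zeroth order term [lam * mn] of [psi] and by the correction [chi]. *)
have hB : B <= e + w z.
  have -> : e = 1 - p by rewrite /p subKr.
  by apply: powR_le_affine => //; exact: w0.
have hw : w z <= B.
  rewrite /B; have := w1 z zab; have := w0 z zab; rewrite le_eqVlt => /predU1P[<-|wz] w1z.
    exact: powR_ge0.
  by apply: ger1_powR; rewrite ?wz// ltW.
have h1 : lam * mn z * B <= lam * mn z * (e + w z).
  by apply: ler_wpM2l => //; rewrite mulr_ge0// ltW.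
have h2 : s * f z <= lam * mp z * B.
  apply: (@le_trans _ _ (lam * mp z * w z)); last first.
    by apply: ler_wpM2l => //; rewrite mulr_ge0// ltW.
  apply: le_trans (ler_wpM2l (ltW s0) (fpsi z zab)) _.
  apply: (@le_trans _ _ (lam * mp z * (s * psi z / 2))).
    by rewrite le_eqVlt; apply/orP; left; apply/eqP; field.
  by apply: ler_wpM2l; [rewrite mulr_ge0// ltW|exact: wpsi].
have -> : cc z * (t * w z) - (mp z * (t * lam * B) - mn z * (t * lam * B)) =
  t * (cc z * w z - lam * mp z * B + lam * mn z * B) by ring.
apply: ler_wpM2l; first exact: ltW.
rewrite (_ : s * (Q z * psi z - f z) - e * lam * (Q z * chi z - mn z) =
  cc z * w z + lam * mn z * (e + w z) - s * f z); last by rewrite /Q /w; ring.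
by move: h1 h2; clear; lra.
Qed.
End LebesguePoint.

(** * Smooth bumps and weak derivatives *)

Section Smooth.
Context {R : realType}.
Implicit Types (a b c x t : R) (f g F : R -> R) (n : nat).

Record smooth f : Prop := Smooth {
  smooth_derivable : forall n x, derivable (f^`(n))%classic x 1 }.

Lemma derive1_val f x (d : R) : is_derive x 1 f d -> (f^`())%classic x = d.
Proof. by move=> fd; rewrite derive1E; exact: derive_val. Qed.

Lemma smooth_is_derive f x : smooth f -> is_derive x 1 f ((f^`())%classic x).
Proof. by move=> [/(_ 0%N x) fd]; rewrite derive1E; exact: derivableP. Qed.

Lemma smooth_derive1 f : smooth f -> smooth (f^`())%classic.
Proof. by move=> [fs]; split=> n x; rewrite -derive1Sn; exact: fs. Qed.

(** A coinduction principle: in a class of functions closed under differentiation every member is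
    smooth. *)
Lemma smooth_ind (C : (R -> R) -> Prop) :
  (forall f, C f -> exists2 g, C g & forall x, is_derive x 1 f (g x)) ->
  forall f, C f -> smooth f.
Proof.
move=> CC f Cf.
have CD n : C (f^`(n))%classic.
  elim: n => [//|n IH]; rewrite derive1nS.
  have [g Cg gd] := CC _ IH.
  by rewrite (_ : ((f^`(n))^`())%classic = g)//; apply/funext => x; exact: derive1_val.
by split=> n x; have [g _ /(_ x)[]] := CC _ (CD n).
Qed.

Lemma smooth_continuous f : smooth f -> continuous f.
Proof.
by move=> [fs] x; have := fs 0%N x => /derivable1_diffP/differentiable_continuous.
Qed.

Lemma smooth_primitive F f : smooth f -> (forall x, is_derive x 1 F (f x)) -> smooth F.
Proof.
move=> [fs] Fd; split=> -[|n] x; first by have [] := Fd x.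
rewrite derive1Sn (_ : (F^`())%classic = f)//.
by apply/funext => y; exact: derive1_val.
Qed.

(** Products alone are not closed under differentiation; by Leibniz' rule their finite sums are. *)
Inductive smooth_products : (R -> R) -> Prop :=
| smooth_prod f g : smooth f -> smooth g -> smooth_products (fun x => f x * g x)
| smooth_sum f g : smooth_products f -> smooth_products g ->
    smooth_products (fun x => f x + g x).

Lemma smoothM f g : smooth f -> smooth g -> smooth (fun x => f x * g x).
Proof.
move=> fs gs; apply: (@smooth_ind smooth_products); last exact: smooth_prod.
move=> h; elim=> [f1 g1 f1s g1s|f1 f2 _ [g1 Cg1 d1] _ [g2 Cg2 d2]].
  exists (fun x => f1 x * (g1^`())%classic x + g1 x * (f1^`())%classic x).
    apply: smooth_sum; apply: smooth_prod => //; exact: smooth_derive1.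
  move=> x; have fd := smooth_is_derive x f1s; have gd := smooth_is_derive x g1s.
  exact: is_deriveM.
exists (fun x => g1 x + g2 x); first exact: smooth_sum.
by move=> x; exact: is_deriveD.
Qed.

Lemma smoothD f g : smooth f -> smooth g -> smooth (fun x => f x + g x).
Proof.
move=> fs gs.
apply: (@smooth_ind (fun h => exists f g, [/\ smooth f, smooth g & h = fun x => f x + g x])); last by exists f, g.
move=> h [f1 [g1 [f1s g1s ->]]].
exists (fun x => (f1^`())%classic x + (g1^`())%classic x).
  by exists (f1^`())%classic, (g1^`())%classic; split=> //; exact: smooth_derive1.
move=> x; have fd := smooth_is_derive x f1s; have gd := smooth_is_derive x g1s.
exact: is_deriveD.
Qed.

Lemma smooth_cst c : smooth (fun=> c).
Proof.
apply: (@smooth_ind (fun h => exists c, h = fun=> c)); last by exists c.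
move=> h [d ->]; exists (fun=> 0); first by exists 0.
by move=> x; exact: is_derive_cst.
Qed.

Lemma smoothZ c f : smooth f -> smooth (fun x => c * f x).
Proof. by move=> fs; apply: smoothM => //; exact: smooth_cst. Qed.

Lemma smooth_affine f a b : smooth f -> smooth (fun x => f (a * x + b)).
Proof.
move=> fs.
apply: (@smooth_ind (fun h => exists c f, smooth f /\ h = fun x => c * f (a * x + b))); last first.
  by exists 1, f; split=> //; apply/funext => x; rewrite mul1r.
move=> h [c [f1 [f1s ->]]].
exists (fun x => c * a * (f1^`())%classic (a * x + b)).
  by exists (c * a), (f1^`())%classic; split=> //; exact: smooth_derive1.
move=> x; have fd := smooth_is_derive (a * x + b) f1s.
have ad : is_derive x 1 (fun x => a * x + b) a.
  apply: is_derive_eq (is_deriveD (is_deriveM (is_derive_cst a x 1) (is_derive_id x 1)) (is_derive_cst b x 1)) _.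
  by rewrite /GRing.scale/= mulr1 mulr0 !addr0.
have := is_deriveM (is_derive_cst c x 1) (@is_derive1_comp R f1 (fun x => a * x + b) x _ _ fd ad).
move=> hd; apply: is_derive_eq hd _.
by rewrite /GRing.scale/=; ring.
Qed.

(** [flat 0] is the classical smooth function [exp (- 1/t)] extended by 0. The powers of [1/t] are
    included because the linear combinations of these functions are closed under differentiation. *)
Definition flat n t := if 0 < t then (t^-1) ^+ n * expR (- t^-1) else 0.

Lemma flat_ge0 n t : 0 <= flat n t.
Proof.
rewrite /flat; case: ifPn => // t0.
by rewrite mulr_ge0 ?expR_ge0// exprn_ge0// invr_ge0 ltW.
Qed.

(** One term of the exponential series bounds [exp (1/t)] from below. A quadratic bound is what
    makes the derivative at 0 exist and vanish. *)
Lemma flat_le n t : flat n t <= (n.+2)`!%:R * t ^+ 2.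
Proof.
rewrite /flat; case: ifPn => [t0|_]; last by rewrite mulr_ge0 ?sqr_ge0.
have s0 : 0 < t^-1 by rewrite invr_gt0.
have := @expR_ge1Dxn _ t^-1 n.+1 (ltW s0).
set E := expR t^-1; rewrite expRN -/E => h.
have E0 : 0 < E by exact: expR_gt0.
have F0 : 0 < (n.+2)`!%:R :> R by rewrite ltr0n fact_gt0.
have h2 : t^-1 ^+ n.+2 <= (n.+2)`!%:R * E.
  rewrite mulrC -ler_pdivrMr//; apply: le_trans h; by rewrite lerDr.
rewrite ler_pdivrMr//.
rewrite (_ : t^-1 ^+ n = t^-1 ^+ n.+2 * t ^+ 2); last first.
  by rewrite -addn2 exprD -mulrA -exprMn mulVf ?gt_eqF// expr1n mulr1.
by rewrite [leRHS]mulrAC ler_wpM2r// sqr_ge0.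
Qed.

Lemma is_derive_quotient f x (l : R) :
  (forall e : R, 0 < e -> exists2 d : R, 0 < d & forall h, h != 0 -> `|h| < d ->
     `|h^-1 * (f (h + x) - f x) - l| < e) -> is_derive x 1 f l.
Proof.
move=> H.
have cv : h^-1 *: (f (h *: 1 + x) - f x) @[h --> 0^'] --> l.
  apply/cvgrPdist_lt => e e0; have [d d0 Hd] := H e e0.
  rewrite /= /dnbhs/= near_withinE; apply/nbhs_ballP; exists d => //= h.
  rewrite /ball/= sub0r normrN => hd h0.
  by rewrite distrC /GRing.scale/= mulr1; exact: Hd.
apply: DeriveDef; first by apply/cvg_ex; exists l.
exact/cvg_lim.
Qed.

Lemma flat_is_derive n t : is_derive t 1 (flat n) (- n%:R * flat n.+1 t + flat n.+2 t).
Proof.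
have [t0|t0|t0] := ltgtP t 0.
- have -> : - n%:R * flat n.+1 t + flat n.+2 t = 0 by rewrite /flat ltNge ltW//= mulr0 addr0.
  apply: near_eq_is_derive (is_derive_cst 0 t 1).
  apply/nbhs_ballP; exists (- t) => /=; first by rewrite oppr_gt0.
  move=> s; rewrite /ball/= ltr_norml => /andP[h _].
  by rewrite /flat ifF//; apply/negbTE; rewrite -leNgt; move: h; clear; lra.
- have E : t != 0 by rewrite gt_eqF.
  apply: (@near_eq_is_derive _ _ _ (fun t => t^-1 ^+ n * expR (- t^-1))).
    apply/nbhs_ballP; exists t => //= s; rewrite /ball/= ltr_norml => /andP[_ h].
    by rewrite /flat ifT//; move: h; clear; lra.
  have vd : is_derive t 1 (fun t : R => t^-1) (- t ^- 2).
    apply: is_derive_eq (is_deriveV E (is_derive_id t 1)) _.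
    by rewrite /GRing.scale/= mulr1.
  have ed : is_derive t 1 (fun t : R => expR (- t^-1)) (expR (- t^-1) * t ^- 2).
    have nd : is_derive t 1 (fun t : R => - t^-1) (t ^- 2).
      by apply: is_derive_eq (is_deriveN vd) _; rewrite opprK.
    exact: is_derive1_comp (is_derive_expR _) nd.
  have pd : is_derive t 1 (fun t : R => t^-1 ^+ n) (- n%:R * t^-1 ^+ n.+1).
    elim: n => [|n IH].
      rewrite (_ : (fun t : R => t^-1 ^+ 0) = fun=> 1); last by apply/funext => s; rewrite expr0.
      by rewrite oppr0 mul0r; exact: is_derive_cst.
    have -> : (fun t : R => t^-1 ^+ n.+1) = fun t => t^-1 * t^-1 ^+ n.
      by apply/funext => s; rewrite exprS.
    apply: is_derive_eq (is_deriveM vd IH) _.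
    by rewrite /GRing.scale/= -exprVn !exprS -natr1; ring.
  apply: is_derive_eq (is_deriveM pd ed) _.
  rewrite /flat t0 /GRing.scale/= -exprVn.
  by rewrite !exprS; ring.
- have f00 m : flat m 0 = 0 by rewrite /flat ltxx.
  rewrite t0 !f00 mulr0 addr0; apply: is_derive_quotient => e e0.
  have F0 : 0 < (n.+2)`!%:R :> R by rewrite ltr0n fact_gt0.
  exists (e / (n.+2)`!%:R); first by rewrite divr_gt0.
  move=> h h0 he; rewrite addr0 f00 !subr0 normrM normrV ?unitfE//.
  rewrite (ger0_norm (flat_ge0 n h)).
  rewrite mulrC ltr_pdivrMr ?normr_gt0//; apply: le_lt_trans (flat_le _ _) _.
  rewrite -real_normK ?num_real// expr2 mulrA ltr_pM2r ?normr_gt0//.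
  by rewrite mulrC -ltr_pdivlMr.
Qed.

Inductive flat_span : (R -> R) -> Prop :=
| flat_scaled c n : flat_span (fun t => c * flat n t)
| flat_add f g : flat_span f -> flat_span g -> flat_span (fun t => f t + g t).

Lemma smooth_flat n : smooth (flat n).
Proof.
apply: (@smooth_ind flat_span); last first.
  have -> : flat n = fun t => 1 * flat n t by apply/funext => t; rewrite mul1r.
  exact: flat_scaled.
move=> h; elim=> [c m|f g _ [f' Cf fd] _ [g' Cg gd]].
  exists (fun t => (c * - m%:R) * flat m.+1 t + c * flat m.+2 t).
    by apply: flat_add; exact: flat_scaled.
  move=> t; apply: is_derive_eq (is_deriveM (is_derive_cst c t 1) (flat_is_derive m t)) _.
  by rewrite /GRing.scale/= mulr0 addr0 mulrDr mulrA.
exists (fun t => f' t + g' t); first exact: flat_add.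
by move=> t; exact: is_deriveD.
Qed.

Lemma flat0_le1 t : flat 0 t <= 1.
Proof.
rewrite /flat; case: ifPn => // t0; rewrite expr0 mul1r -expR0 ler_expR oppr_le0.
by rewrite invr_ge0 ltW.
Qed.

Definition bump a b n x := flat 0 (n.+1%:R * (x - a)) * flat 0 (n.+1%:R * (b - x)).

Lemma smooth_bump a b n : smooth (bump a b n).
Proof.
have -> : bump a b n = fun x => flat 0 (n.+1%:R * x + - (n.+1%:R * a)) *
    flat 0 (- n.+1%:R * x + n.+1%:R * b).
  by apply/funext => x; rewrite /bump; congr (flat 0 _ * flat 0 _); ring.
by apply: smoothM; apply: smooth_affine; exact: smooth_flat.
Qed.

Lemma bump_ge0 a b n x : 0 <= bump a b n x.
Proof. by rewrite mulr_ge0 ?flat_ge0. Qed.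

Lemma bump_le1 a b n x : bump a b n x <= 1.
Proof. by rewrite mulr_ile1 ?flat_ge0 ?flat0_le1. Qed.

Lemma bump_eq0 a b n x : ~~ (a < x < b) -> bump a b n x = 0.
Proof.
have H y : y <= 0 -> flat 0 (n.+1%:R * y) = 0.
  by move=> y0; rewrite /flat pmulr_rgt0// ltNge y0.
rewrite negb_and -!leNgt /bump => /orP[h|h].
  by rewrite (H (x - a)) ?subr_le0// mul0r.
by rewrite (H (b - x)) ?subr_le0// mulr0.
Qed.

Lemma bump_gt0 a b n x : a < x < b -> 0 < bump a b n x.
Proof.
have H y : 0 < y -> 0 < flat 0 (n.+1%:R * y).
  by move=> y0; rewrite /flat pmulr_rgt0// y0 expr0 mul1r expR_gt0.
by move=> /andP[ax xb]; rewrite mulr_gt0// H// subr_gt0.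
Qed.

Lemma cvg_bump a b x : bump a b n x @[n --> \oo] --> (((a < x < b)%R)%:R : R).
Proof.
have [/andP[ax xb]|h] := boolP (a < x < b); last first.
  rewrite (_ : (fun n => bump a b n x) = fun=> 0); first exact: cvg_cst.
  by apply/funext => n; exact: bump_eq0.
have H c : 0 < c -> (fun n => flat 0 (n.+1%:R * c)) @ \oo --> (1 : R).
  move=> c0; rewrite (_ : (fun n => flat 0 (n.+1%:R * c)) =
      fun n => expR (- (c^-1 * n.+1%:R^-1))); last first.
    by apply/funext => n; rewrite /flat pmulr_rgt0// c0 expr0 mul1r invfM mulrC.
  have h : (fun n => - (c^-1 * n.+1%:R^-1)) @ \oo --> (0 : R).
    rewrite -[X in _ --> X]oppr0; apply: cvgN; rewrite -[X in _ --> X](mulr0 c^-1).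
    by apply: cvgMr; exact: cvg_harmonic.
  rewrite -[X in _ --> X]expR0; apply: (cvg_comp _ _ h).
  exact: continuous_expR.
by rewrite -[1%:R]mulr1; apply: cvgM; apply: H; rewrite subr_gt0.
Qed.

End Smooth.

(** * Almost everywhere equal integrands without measurability *)

Section NonMeasurable.
Context d (T : measurableType d) (R : realType) (mu : {measure set T -> \bar R}).
Import HBNNSimple.
Local Open Scope ereal_scope.

(** Members of [Lp] are only almost everywhere equal to Borel functions, so the integrals in the
    definitions may have nonmeasurable integrands. Multiplying a simple function below [f] by the
    indicator of the complement of a measurable null set puts it below [g] without changing its
    integral. *)
Lemma ae_le_ereal_sup_sintegral (f g : T -> \bar R) : (forall x, 0 <= g x) ->
  {ae mu, forall x, f x = g x} ->
  ereal_sup [set sintegral mu h | h in [set h : {nnsfun T >-> R} |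
    forall x, (h x)%:E <= f x]] <=
  ereal_sup [set sintegral mu h | h in [set h : {nnsfun T >-> R} |
    forall x, (h x)%:E <= g x]].
Proof.
move=> g0 [N [mN N0 fgN]]; apply: ge_ereal_sup => _ /= [h hf <-].
pose h' := mul_nnsfun h (indic_nnsfun R (measurableC mN)).
have -> : sintegral mu h = sintegral mu h'.
  rewrite -!integralT_nnsfun; apply: ae_eq_integral => //.
  - exact/measurable_EFinP.
  - exact/measurable_EFinP.
  exists N; split=> // x /= xN; apply: contrapT => Nx; apply: xN => _.
  by change ((h x)%:E = (h x * \1_(~` N) x)%R%:E); rewrite indicE mem_set// mulr1.
apply: ereal_sup_ubound; exists h' => //= x.
change ((h x * \1_(~` N) x)%R%:E <= g x).
rewrite indicE; have [Nx|Nx] := boolP (x \in ~` N); last by rewrite mulr0.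
rewrite mulr1; have <- : f x = g x; last exact: hf.
by apply: contrapT => fg; move: Nx; rewrite inE; apply; exact: fgN.
Qed.

Lemma ae_eq_integral_nonmeasurable (D : set T) (f g : T -> \bar R) :
  {ae mu, forall x, D x -> f x = g x} -> \int[mu]_(x in D) f x = \int[mu]_(x in D) g x.
Proof.
move=> fg.
have FG : {ae mu, forall x, (f \_ D) x = (g \_ D) x}.
  apply: filterS fg => x fgx; rewrite !patchE; case: ifPn => //.
  by rewrite inE => /fgx.
rewrite /integral; congr (_ - _); apply/eqP; rewrite eq_le.
  by apply/andP; split; apply: ae_le_ereal_sup_sintegral => //; apply: filterS FG => x;
    rewrite !funeposE => ->.
by apply/andP; split; apply: ae_le_ereal_sup_sintegral => //; apply: filterS FG => x;
  rewrite !funenegE => ->.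
Qed.

End NonMeasurable.

(** * Borel representatives of Lebesgue classes *)

Section Lebesgue.
Context {R : realType}.
Local Notation mu := (@lebesgue_measure R).
Implicit Types (al be a b x y : R) (f g h : R -> R).

Lemma aeS (P Q : R -> Prop) : (forall x, P x -> Q x) ->
  {ae mu, forall x, P x} -> {ae mu, forall x, Q x}.
Proof. by move=> PQ; apply: filterS => //; exact: (ae_filter_ringOfSetsType mu). Qed.

Lemma aeI (P Q : R -> Prop) : {ae mu, forall x, P x} -> {ae mu, forall x, Q x} ->
  {ae mu, forall x, P x /\ Q x}.
Proof. by move=> aP aQ; apply: filterI => //; exact: (ae_filter_ringOfSetsType mu). Qed.

Lemma ae_eq_Rintegral (D : set R) f g : {ae mu, forall x, D x -> f x = g x} ->
  \int[mu]_(x in D) f x = \int[mu]_(x in D) g x.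
Proof.
move=> fg; congr fine; apply: ae_eq_integral_nonmeasurable.
by apply: aeS fg => x fgx /fgx ->.
Qed.

Lemma I_oo al be f : itg al be f -> \int[mu]_(x in `]al, be[) f x = I al be f.
Proof.
move=> fi; have fi' : mu.-integrable `]al, be] (EFin \o f).
  by apply: integrableS fi => //; apply: subset_itv; rewrite bnd_simp.
rewrite IE Rintegral_itv_bndo_bndc.
  by rewrite Rintegral_itv_obnd_cbnd.
by apply: integrableS fi' => //; apply: subset_itv; rewrite bnd_simp.
Qed.

Lemma I_ae_eq al be f g : itg al be f -> itg al be g ->
  {ae mu, forall x, al < x < be -> f x = g x} -> I al be f = I al be g.
Proof.
move=> fi gi fg; rewrite -!I_oo//; apply: ae_eq_Rintegral.
by apply: aeS fg => x fgx; rewrite /= in_itv/=.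
Qed.

Lemma Lfun2_itg_sqr al be g : g \in Lfun mu 2%:E -> itg al be (fun x => g x ^+ 2).
Proof. by move=> /Lfun2_integrable_sqr gi; apply: integrableS gi. Qed.

Lemma Lp2_representative al be f : Lp `]al, be[%classic 2%:E f ->
  exists g, [/\ itg al be g, itg al be (fun x => g x ^+ 2) &
    {ae mu, forall x, al < x < be -> f x = g x}].
Proof.
move=> [g gL fg]; exists g; split.
- have /andP[/set_mem mg _] := gL.
  apply: (@itg_le _ _ _ _ (fun x => 1 + g x ^+ 2)).
  + exact: measurable_funS mg.
  + apply: itgD; first exact: itg_cst.
    exact: Lfun2_itg_sqr gL.
  + move=> x _; rewrite [leRHS]ger0_norm; last by rewrite addr_ge0// sqr_ge0.
    rewrite -[g x ^+ 2]real_normK ?num_real//.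
    by have := sqr_ge0 (`|g x| - 1); rewrite sqrrB1; have := normr_ge0 (g x); lra.
- exact: Lfun2_itg_sqr gL.
- by apply: aeS fg => x; rewrite /= in_itv.
Qed.

Lemma Lp2_intro al be f : measurable_fun `[al, be] f ->
  itg al be (fun x => f x ^+ 2) -> Lp `]al, be[%classic 2%:E f.
Proof.
move=> mf fi; exists (f \_ `[al, be]); last first.
  apply: aeW => x; rewrite /= in_itv/= => /andP[ax xb].
  by rewrite patchE mem_set//= in_itv/= !ltW.
have mg : measurable_fun setT (f \_ `[al, be]).
  by apply/(measurable_restrictT _ _).1.
apply/andP; split; first exact/mem_set.
apply/mem_set; rewrite /= /finite_norm unlock /Lnorm.
apply: poweR_lty.
have : mu.-integrable setT (EFin \o (fun x => f x ^+ 2) \_ `[al, be]).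
  by rewrite -restrict_EFin; apply/integrable_restrict => //=; rewrite setTI.
move=> /integrableP[_].
apply: le_lt_trans; rewrite le_eqVlt; apply/orP; left; apply/eqP.
apply: eq_integral => x _; rewrite /= !patchE; case: ifPn => _ /=.
  by rewrite powR_mulrn// normrX.
by rewrite (_ : point = 0 :> R)// normr0 powR0// pnatr_eq0.
Qed.

Lemma Lpoo_representative al be f : Lp `]al, be[%classic +oo%E f ->
  {ae mu, forall x, `]al, be[%classic x -> 0 <= f x} ->
  exists g (C : R), [/\ measurable_fun setT g, forall x, 0 <= g x <= C &
    {ae mu, forall x, al < x < be -> f x = g x}].
Proof.
move=> [g gL fg] f0; have /andP[/set_mem mg /set_mem] := gL.
rewrite /= /finite_norm unlock /Lnorm.
have -> : (0 < mu [set: R])%E.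
  apply: (@lt_le_trans _ _ (mu [set` `[0%R, 1%R]])).
    by rewrite lebesgue_measure_itv/= lte01 -EFinB subr0 lte01.
  by apply: le_measure; rewrite ?inE.
move=> gfin.
have [C gC] : exists C : R, (ess_sup mu (abse \o (EFin \o g)) <= C%:E)%E.
  move: gfin; case: (ess_sup _ _) => [r _|//|_]; first by exists r.
  by exists 0; rewrite leNye.
move: gC => /ess_supP gC.
(* Clamping makes the two bounds hold everywhere and changes [g] on a null set of the interval
   only. *)
exists (fun x => Num.min (Num.max (g x) 0) (Num.max C 0)), (Num.max C 0); split.
- apply: measurable_minr => //; apply: measurable_maxr => //.
- by move=> x; rewrite le_min ![0 <= Num.max _ _]le_max !lexx !orbT ge_min lexx orbT.
- apply: aeS (aeI (aeI fg f0) gC) => x [[fgx f0x]].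
  rewrite /= lee_fin => gxC xab.
  have xD : `]al, be[%classic x by rewrite /= in_itv.
  have := f0x xD; rewrite fgx// => g0.
  rewrite [Num.max (g x) 0]max_l// min_l// le_max; apply/orP; left.
  by apply: le_trans gxC; exact: ler_norm.
Qed.

End Lebesgue.

(** * Test functions and integration by parts *)

Section WeakDerivatives.
Context {R : realType}.
Local Notation mu := (@lebesgue_measure R).
Implicit Types (al be a b x y t : R) (f g h u v phi psi : R -> R).

Lemma smooth_within f a b : smooth f -> {within `[a, b], continuous f}.
Proof. by move=> fs; apply: continuous_subspaceT; exact: smooth_continuous. Qed.

Lemma smooth_AC f a b : smooth f -> AC a b f (f^`())%classic.
Proof.
move=> fs; have cf' x y : {within `[x, y], continuous (f^`())%classic}.
  by apply: smooth_within; exact: smooth_derive1.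
split=> [|x y ax]; first exact: continuous_itg.
rewrite le_eqVlt => /predU1P[<- _|xy _]; first by rewrite subrr I_xx.
have cf z := smooth_continuous fs (x := z).
have df : derivable_oo_LRcontinuous f x y.
  split; first by move=> z _; have [] := smooth_is_derive z fs.
    by apply: cvg_at_right_filter; exact: cf.
  by apply: cvg_at_left_filter; exact: cf.
by rewrite IE /Rintegral (continuous_FTC2 xy (cf' x y) df (fun _ _ => erefl)).
Qed.

Lemma test_function_out (D : set R) phi x : test_function D phi -> ~ D x -> phi x = 0.
Proof. by move=> [_ [K [_ KD phi0]]] Dx; apply: phi0 => /KD. Qed.

Lemma test_smooth (D : set R) phi : test_function D phi -> smooth phi.
Proof. by move=> [ps _]; split. Qed.

Lemma AC_test_by_parts al be u v phi : al <= be -> AC al be u v ->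
  test_function `]al, be[%classic phi ->
  I al be (fun x => u x * (phi^`())%classic x) = - I al be (fun x => v x * phi x).
Proof.
move=> ab uAC tp; have ps := test_smooth tp.
have [_ /(_ al be (lexx _) ab (lexx _))] := AC_mul uAC (smooth_AC al be ps).
have [vi _] := uAC; have cu := AC_continuous uAC.
have h1 : itg al be (fun x => v x * phi x).
  by apply: itgM_continuous => //; exact: smooth_within.
have h2 : itg al be (fun x => u x * (phi^`())%classic x).
  apply: itgM_continuous; first exact: continuous_itg.
  by apply: smooth_within; exact: smooth_derive1.
rewrite I_D// (test_function_out tp) ?(test_function_out tp (x := al)).
- by rewrite !mulr0 subrr => /eqP; rewrite eq_sym addrC addr_eq0 => /eqP.
- by rewrite /= in_itv/= ltxx.
- by rewrite /= in_itv/= ltxx andbF.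
Qed.

Lemma test_function_itv al be a b phi : al < a -> b < be -> smooth phi ->
  (forall x, ~~ (a <= x <= b) -> phi x = 0) -> test_function `]al, be[%classic phi.
Proof.
move=> ala bbe [ps] p0; split=> //; exists `[a, b]%classic; split.
- exact: segment_compact.
- by apply: subset_itvSoo; rewrite bnd_simp.
- by move=> x /=; rewrite in_itv/= => /negP; exact: p0.
Qed.

Lemma bump_out a b n x : ~~ (a <= x <= b) -> bump a b n x = 0.
Proof.
move=> h; apply: bump_eq0; apply: contra h => /andP[/ltW ax /ltW xb].
by rewrite ax.
Qed.

(** The zero integral makes the primitive from the left vanish again beyond [b], so it keeps its
    support in [a, b]. This tells which functions occur as derivatives of test functions. *)
Lemma test_primitive al be a b h : al < a -> a <= b -> b < be -> smooth h ->
  (forall x, ~~ (a <= x <= b) -> h x = 0) -> I al be h = 0 ->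
  exists2 phi, test_function `]al, be[%classic phi & (phi^`())%classic = h.
Proof.
move=> ala ab bbe hs h0 Ih0; pose phi x := I al x h.
have hi x y : itg x y h by apply: continuous_itg; exact: smooth_within.
have left x : x < a -> phi x = 0.
  move=> xa; rewrite /phi -(I_cst0 al x); apply: I_ext => t /andP[_ tx]; apply: h0.
  by rewrite negb_and -ltNge (le_lt_trans tx xa).
have right x y : b <= x -> x <= y -> I x y h = 0.
  (* The support hypothesis says nothing about [h b]; for [x = b] a short interval next to [b] is
     split off and made negligible. *)
  rewrite le_eqVlt => /predU1P[<-|bx] xy; last first.
    rewrite -(I_cst0 x y); apply: I_ext => t /andP[xt _]; apply: h0.
    by rewrite negb_and orbC -ltNge (lt_le_trans bx xt).
  apply/eqP; rewrite -normr_le0; apply/ler_addgt0Pl => e e0; rewrite addr0.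
  have [d d0 Hd] := I_small (hi b y) e0.
  pose z := Num.min y (b + d / 2).
  have bz : b <= z by rewrite le_min xy lerDl divr_ge0 ?ltW.
  have zy : z <= y by rewrite ge_min lexx.
  have zd : z - b < d.
    have : z <= b + d / 2 by rewrite ge_min lexx orbT.
    by move: d0; clear; lra.
  have h1 : I z y h = 0.
    have [->|zb] := eqVneq z y; first exact: I_xx.
    rewrite -(I_cst0 z y); apply: I_ext => t /andP[zt _]; apply: h0.
    rewrite negb_and orbC -ltNge (lt_le_trans _ zt)//.
    move: zb; rewrite /z minElt; case: ifPn => //; first by rewrite eqxx.
    by move=> _ _; rewrite ltrDl divr_gt0.
  rewrite (I_split bz zy (hi b y)) h1 addr0 (le_trans (I_norm (hi b z)))//.
  exact/ltW/Hd.
have dphi x : is_derive x 1 phi (h x).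
  have [xa|ax] := ltP x a.
    rewrite h0; last by rewrite negb_and -ltNge xa.
    apply: near_eq_is_derive (is_derive_cst 0 x 1).
    apply/nbhs_ballP; exists (a - x) => /=; first by rewrite subr_gt0.
    move=> y; rewrite /ball/= ltr_norml => /andP[h1 _]; rewrite left//.
    by move: h1; clear; lra.
  have alx : al < x by exact: lt_le_trans ax.
  have xx1 : x < x + 1 by rewrite ltrDl.
  have hc : {for x, continuous h} by exact: smooth_continuous.
  have [d1 d2] := continuous_FTC1_closed xx1 (hi al (x + 1)) alx hc.
  have E : phi = fun x => \int[mu]_(t in `[al, x]) h t.
    by apply/funext => y; rewrite /phi IE.
  by rewrite E; apply: DeriveDef; [exact: d1|rewrite -derive1E; exact: d2].
exists phi; last by apply/funext => x; exact: derive1_val.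
apply: (test_function_itv ala bbe); first exact: smooth_primitive dphi.
move=> x; rewrite negb_and -!ltNge => /orP[/left//|bx].
have alb : al <= b by exact: le_trans (ltW ala) ab.
have Ib : I al b h = 0.
  have := I_split alb (ltW bbe) (hi al be); rewrite Ih0 (right b be)// ?addr0//.
  exact: ltW.
rewrite /phi (I_split alb (ltW bx) (hi al x)) Ib add0r right//; exact: ltW.
Qed.

End WeakDerivatives.

(** * Du Bois-Reymond's lemma *)

Section DuBoisReymond.
Context {R : realType}.
Local Notation mu := (@lebesgue_measure R).
Implicit Types (al be a b x y t : R) (f g h u v phi psi : R -> R).

Lemma I_bump_gt0 al be a b n : al <= a -> a < b -> b <= be -> 0 < I al be (bump a b n).
Proof.
move=> ala ab bbe; have bi x y : itg x y (bump a b n).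
  by apply: continuous_itg; apply: smooth_within; exact: smooth_bump.
pose p := a + (b - a) / 3; pose q := a + 2 * (b - a) / 3.
have [ap pq qb] : [/\ a < p, p < q & q < b].
  by rewrite /p /q; split; move: ab; clear; lra.
apply: (@lt_le_trans _ _ (I p q (bump a b n))).
  apply: I_gt0 => //; first by apply: smooth_within; exact: smooth_bump.
  by move=> x /andP[px xq]; apply: bump_gt0; rewrite (lt_le_trans ap px) (le_lt_trans xq).
apply: I_ge0_mono => //; last by move=> x _; exact: bump_ge0.
  by rewrite (le_trans ala)// ltW.
by rewrite (le_trans _ bbe)// ltW.
Qed.

(* The test functions [bump a b n] increase to the indicator of ]a, b[. *)
Lemma cvg_I_bump al be a b g : al <= a -> a <= b -> b <= be -> itg al be g ->
  (fun n => I al be (fun x => g x * bump a b n x)) @ \oo --> I a b g.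
Proof.
move=> ala ab bbe gi.
have cb n : {within `[al, be], continuous (bump a b n)}.
  by apply: smooth_within; exact: smooth_bump.
have -> : I a b g = I al be (fun x => g x * ((a < x < b)%R)%:R).
  rewrite -[LHS](I_oo (itg_sub ala bbe gi)) -[RHS]I_oo; last first.
    apply: (@itgM_bounded _ _ _ 1) => //.
      apply: measurable_fun_cvg (fun n => continuous_measurable (cb n)) _ => x _.
      exact: cvg_bump.
    by move=> x _; rewrite ger0_norm//; case: (a < x < b).
  rewrite Rintegral_mkcond [RHS]Rintegral_mkcond; apply: eq_Rintegral => x _.
  rewrite !patchE; have [xab|xab] := boolP (a < x < b).
    rewrite mem_set ?mem_set ?mulr1// /= in_itv//=.
    by move: xab => /andP[ax xb]; rewrite (le_lt_trans ala ax) (lt_le_trans xb).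
  rewrite mulr0 [LHS]ifF; first by case: ifP.
  by apply/negP; rewrite inE /= in_itv/=; exact/negP.
apply: (@I_dominated _ al be _ _ (fun x => `|g x|) _ _ _ _).2.
- by move=> n; apply: measurable_funM; [exact: itg_measurable|exact: continuous_measurable].
- by move=> x _; apply: cvgMr; exact: cvg_bump.
- exact: itg_norm.
- move=> n x _; rewrite normrM (ger0_norm (bump_ge0 _ _ _ _)).
  by rewrite ler_piMr ?bump_le1.
Qed.

(** Fix a reference bump and let [kappa] be the mean of [g] weighted by it. Any other bump, minus
    the multiple of the reference bump with the same integral, is the derivative of a test function,
    so [g - kappa] is orthogonal to all bumps; in the limit these become indicators of intervals. *)
Lemma du_bois_reymond al be g : al < be -> itg al be g ->
  (forall phi, test_function `]al, be[%classic phi ->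
     I al be (fun x => g x * (phi^`())%classic x) = 0) ->
  exists kappa : R, forall a b, al < a -> a < b -> b < be ->
    I a b (fun x => g x - kappa) = 0.
Proof.
move=> albe gi H.
pose a0 := al + (be - al) / 3; pose b0 := al + 2 * (be - al) / 3.
have [ala0 ab0 b0be] : [/\ al < a0, a0 < b0 & b0 < be].
  by rewrite /a0 /b0; split; move: albe; clear; lra.
have bi a b n x y : itg x y (bump a b n).
  by apply: continuous_itg; apply: smooth_within; exact: smooth_bump.
have gbi a b n : itg al be (fun x => g x * bump a b n x).
  by apply: itgM_continuous => //; apply: smooth_within; exact: smooth_bump.
have r0 := I_bump_gt0 0 (ltW ala0) ab0 (ltW b0be).
pose kappa := I al be (fun x => g x * bump a0 b0 0 x) / I al be (bump a0 b0 0).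
exists kappa => a b ala ab bbe.
have E n : I al be (fun x => (g x - kappa) * bump a b n x) = 0.
  pose s := I al be (bump a b n) / I al be (bump a0 b0 0).
  pose h x := bump a b n x - s * bump a0 b0 0 x.
  have hs : smooth h.
    have -> : h = fun x => bump a b n x + (- s) * bump a0 b0 0 x.
      by apply/funext => x; rewrite /h mulNr.
    by apply: smoothD; [exact: smooth_bump|apply: smoothZ; exact: smooth_bump].
  have [phi tp phi'] : exists2 phi, test_function `]al, be[%classic phi & (phi^`())%classic = h.
    apply: (@test_primitive _ al be (Num.min a a0) (Num.max b b0)) => //.
    - by rewrite lt_min ala.
    - by rewrite (@le_trans _ _ a) ?ge_min ?lexx// le_max (ltW ab).
    - by rewrite gt_max bbe.
    - move=> x xout; rewrite /h !bump_eq0 ?mulr0 ?subrr//; apply: contra xout => /andP[/ltW h1 /ltW h2].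
        by rewrite ge_min le_max h1 h2 !orbT.
      by rewrite ge_min le_max h1 h2.
    - by rewrite I_B ?I_Z//; [rewrite divfK ?gt_eqF// subrr|exact: itgZ].
  have := H phi tp; rewrite phi' => Hh.
  have -> : I al be (fun x => (g x - kappa) * bump a b n x) =
      I al be (fun x => g x * bump a b n x) - kappa * I al be (bump a b n).
    rewrite -I_Z// -I_B//; last exact: itgZ.
    by apply: I_ext => x _; rewrite mulrBl.
  have : I al be (fun x => g x * bump a b n x) - s * I al be (fun x => g x * bump a0 b0 0 x) = 0.
    rewrite -I_Z// -I_B//; last exact: itgZ.
    by rewrite -[RHS]Hh; apply: I_ext => x _; rewrite /h; ring.
  move=> <-; congr (_ - _); rewrite /kappa /s; field.
  by rewrite gt_eqF.
have gk : itg al be (fun x => g x - kappa) by apply: itgB => //; exact: itg_cst.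
have := cvg_I_bump (ltW ala) (ltW ab) (ltW bbe) gk.
rewrite (_ : (fun n => _) = fun=> 0); last by apply/funext => n; exact: E.
by move=> h; apply: (cvg_unique (@Rhausdorff R) h); exact: cvg_cst.
Qed.

Lemma derive1_eq0_near (F : R -> R) x : (\forall y \near x, F y = 0) -> (F^`())%classic x = 0.
Proof.
move=> F0; apply: derive1_val; apply: near_eq_is_derive (is_derive_cst 0 x 1).
by apply: filterS F0 => y ->.
Qed.

Lemma I_eq0_continuous al be h : {within `]al, be[%classic, continuous h} ->
  (forall a b, al < a -> a < b -> b < be -> I a b h = 0) ->
  forall x, al < x < be -> h x = 0.
Proof.
move=> ch Ih x /andP[alx xbe].
have chx : {for x, continuous h}.
  have oD : open (`]al, be[%classic : set R) by exact: itv_open.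
  have := ch; rewrite continuous_open_subspace//.
  by apply; rewrite inE/= in_itv/= alx.
pose a := (al + x) / 2; pose u := (x + be) / 2.
have [ala ax xu ube] : [/\ al < a, a < x, x < u & u < be].
  by rewrite /a /u; split; move: alx xbe; clear; lra.
have hi : itg a u h.
  apply: continuous_itg; apply: continuous_subspaceW ch.
  by apply: subset_itvSoo; rewrite bnd_simp.
have [_ <-] := continuous_FTC1_closed xu hi ax chx.
apply: derive1_eq0_near; apply/nbhs_ballP; exists (Num.min (x - a) (u - x)).
  by rewrite /= lt_min !subr_gt0 ax.
move=> y; rewrite /ball/= lt_min => /andP[h1 h2]; rewrite -IE.
apply: Ih => //; move: h1 h2 ube; rewrite !ltr_norml; clear; lra.
Qed.

Lemma I_eq0_ae al be h : al < be -> itg al be h ->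
  (forall a b, al < a -> a < b -> b < be -> I a b h = 0) ->
  {ae mu, forall x, al < x < be -> h x = 0}.
Proof.
move=> albe hi Ih.
(* [FTC1] is applied to integrals starting at [al], whereas the hypothesis only covers inner
   intervals; absolute continuity of the integral closes the gap. *)
have Ih' x : al < x < be -> I al x h = 0.
  move=> /andP[alx xbe]; apply/eqP; rewrite -normr_le0.
  apply/ler_addgt0Pl => e e0; rewrite addr0.
  have [d d0 Hd] := I_small hi e0.
  pose z := Num.min ((al + x) / 2) (al + d / 2).
  have alz : al < z.
    by rewrite lt_min ltrDl divr_gt0// andbT; move: alx; clear; lra.
  have zx : z < x by rewrite gt_min; apply/orP; left; move: alx; clear; lra.
  have zd : z - al < d.
    have : z <= al + d / 2 by rewrite ge_min lexx orbT.
    by move: d0; clear; lra.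
  have hix : itg al x h by apply: itg_sub hi => //; exact: ltW.
  rewrite (I_split (ltW alz) (ltW zx) hix) (Ih z x alz zx xbe) addr0.
  apply: le_trans (I_norm (itg_sub (lexx _) (ltW zx) hix)) _.
  by apply/ltW/Hd => //; rewrite ltW// (lt_trans zx).
pose h' := h \_ `[al, be].
have hT : mu.-integrable setT (EFin \o h').
  by rewrite /h' -restrict_EFin; apply/integrable_restrict => //=; rewrite setTI.
have loc : locally_integrable setT h'.
  by apply: open_integrable_locally => //; exact: openT.
have h'i y : mu.-integrable [set` Interval (BLeft al) (BRight y)] (EFin \o h').
  by apply: integrableS hT.
apply: aeS (FTC1 h'i loc) => x; rewrite /= => Hx /andP[alx xbe].
have [|_] := Hx; first by rewrite /= lte_fin.
rewrite {2}/h' patchE mem_set/=; last by rewrite in_itv/= !ltW.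
move=> <-; apply: derive1_eq0_near.
apply/nbhs_ballP; exists (Num.min (x - al) (be - x)).
  by rewrite /= lt_min !subr_gt0 alx.
move=> y; rewrite /ball/= lt_min => /andP[h1 h2]; rewrite -IE.
have yab : al < y < be by move: h1 h2; rewrite !ltr_norml; clear; lra.
rewrite -(Ih' y yab); apply: I_ext => t /andP[alt ty]; rewrite /h' patchE mem_set//=.
by rewrite in_itv/= alt (le_trans ty)// ltW//; case/andP: yab.
Qed.

(** [u] minus the primitive of [v] has weak derivative 0. The conclusion is left in integral form
    because it is used in two ways: pointwise for continuous [u], and almost everywhere
    otherwise. *)
Lemma weak_derivative_primitive al be u v : al < be -> itg al be u -> itg al be v ->
  (forall phi, test_function `]al, be[%classic phi ->
     I al be (fun x => u x * (phi^`())%classic x) = - I al be (fun x => v x * phi x)) ->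
  exists kappa : R, forall a b, al < a -> a < b -> b < be ->
    I a b (fun x => u x - (kappa + I al x v)) = 0.
Proof.
move=> albe ui vi H.
have VAC := AC_int vi.
have Vi := AC_itg VAC.
have [|phi tp|kappa Hk] := @du_bois_reymond al be (fun x => u x - I al x v) albe.
- exact: itgB.
- have ps := test_smooth tp.
  have cp' : {within `[al, be], continuous (phi^`())%classic}.
    by apply: smooth_within; exact: smooth_derive1.
  have := AC_test_by_parts (ltW albe) VAC tp; rewrite -H// => E.
  have -> : I al be (fun x => (u x - I al x v) * (phi^`())%classic x) =
    I al be (fun x => u x * (phi^`())%classic x) - I al be (fun x => I al x v * (phi^`())%classic x).
    rewrite -I_B; [by apply: I_ext => x _; rewrite mulrBl|exact: itgM_continuous|exact: itgM_continuous].
  by rewrite -E subrr.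
exists kappa => a b ala ab bbe; rewrite -(Hk a b ala ab bbe).
by apply: I_ext => x _; ring.
Qed.

End DuBoisReymond.

(** * Sobolev spaces on an interval *)

Section SobolevFunctions.
Context {R : realType}.
Local Notation mu := (@lebesgue_measure R).
Context (al be : R).
Context (albe : al < be).
Implicit Types (a b x y t p : R) (c m f g h u v phi U V W F : R -> R).
Local Notation Om := (`]al, be[%classic : set R).

Lemma AC_ae_density a b F f g : AC a b F f -> itg a b g ->
  {ae mu, forall x, a < x < b -> f x = g x} -> AC a b F g.
Proof.
move=> [fi H] gi fg; split=> // x y ax xy yb; rewrite H//.
apply: I_ae_eq; [exact: itg_sub fi|exact: itg_sub gi|].
apply: aeS fg => z fgz /andP[xz zy]; apply: fgz.
by rewrite (le_lt_trans ax xz) (lt_le_trans zy).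
Qed.

(* AM-GM: [2 |z| <= tau + z^2 / tau] *)
Lemma I_norm_le_of_square (tau : R) f : 0 < tau -> itg al be f ->
  itg al be (fun x => f x ^+ 2) -> I al be (fun x => f x ^+ 2) <= tau ^+ 2 ->
  I al be (fun x => `|f x|) <= tau * ((be - al + 1) / 2).
Proof.
move=> t0 fi f2i H; apply: (@le_trans _ _ (I al be (fun x => tau / 2 + (2 * tau)^-1 * f x ^+ 2))).
  apply: I_le; [exact: itg_norm|by apply: itgD; [exact: itg_cst|exact: itgZ]|].
  move=> x _; have t2 : 0 < 2 * tau by rewrite mulr_gt0.
  rewrite -(ler_pM2l t2) mulrDr (mulrA _ (2 * tau)^-1) divff ?gt_eqF// mul1r.
  rewrite -[f x ^+ 2]real_normK ?num_real//.
  have := sqr_ge0 (`|f x| - tau); rewrite sqrrB => h.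
  rewrite (_ : 2 * tau * (tau / 2) = tau ^+ 2); last by field.
  by move: h; rewrite mulr2n; lra.
rewrite I_D; [|exact: itg_cst|exact: itgZ].
rewrite I_cst ?(ltW albe)// I_Z//.
have h : (2 * tau)^-1 * I al be (fun x => f x ^+ 2) <= tau / 2.
  rewrite mulrC ler_pdivrMr ?mulr_gt0//; apply: le_trans H _.
  by rewrite le_eqVlt; apply/orP; left; apply/eqP; field.
apply: le_trans (_ : tau / 2 * (be - al) + tau / 2 <= _); first by rewrite lerD2l.
by rewrite le_eqVlt; apply/orP; left; apply/eqP; field.
Qed.

Lemma itg_test_mul f phi : itg al be f -> test_function Om phi ->
  itg al be (fun x => f x * phi x).
Proof. by move=> fi tp; apply: itgM_continuous => //; exact: smooth_within (test_smooth tp). Qed.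

Lemma Rintegral_ae_I f g : itg al be g -> {ae mu, forall x, al < x < be -> f x = g x} ->
  \int[mu]_(x in Om) f x = I al be g.
Proof.
move=> gi fg; rewrite -I_oo//; apply: ae_eq_Rintegral.
by apply: aeS fg => x fgx; rewrite /= in_itv/=.
Qed.

Lemma test_function_derive1 phi : test_function Om phi -> test_function Om (phi^`())%classic.
Proof.
move=> [ps [K [cK KO p0]]]; split; first by move=> n x; rewrite -derive1Sn.
exists K; split=> // x Kx; apply: derive1_eq0_near.
have cK' : closed K by apply: compact_closed => //; exact: Rhausdorff.
have oK : open (~` K) by rewrite openC.
apply: filterS (open_nbhs_nbhs (conj oK Kx)).
by move=> y; exact: p0.
Qed.

Lemma weak_derivative1_primitive u v : {within Om, continuous u} -> Lp Om 2%:E u ->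
  itg al be v -> weak_derivative Om 1 u v ->
  exists2 U, AC al be U v & forall x, al < x < be -> u x = U x.
Proof.
move=> cu /Lp2_representative[g [gi _ ug]] vi H.
have [phi tp|kappa Hk] := @weak_derivative_primitive R al be g v albe gi vi.
  have tp' := test_function_derive1 tp.
  rewrite -(Rintegral_ae_I (f := fun x => u x * (phi^`())%classic x)).
  - have := H phi tp; rewrite expr1 mulN1r derive1n1 => ->; congr (- _).
    apply: Rintegral_ae_I; first exact: itg_test_mul.
    exact: aeW.
  - exact: itg_test_mul.
  - by apply: aeS ug => x ugx /ugx ->.
have VAC := AC_int vi.
exists (fun x => kappa + I al x v).
  by apply: AC_ext (AC_D (AC_cst al be kappa) VAC) => // x _; rewrite add0r.
have cU : {within `[al, be], continuous (fun x => kappa + I al x v)}.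
  apply: AC_continuous (AC_D (AC_cst al be kappa) VAC).
move=> x xab; apply/eqP; rewrite -subr_eq0; apply/eqP; move: x xab.
have ch : {within Om, continuous (fun x => u x - (kappa + I al x v))}.
  apply: within_continuousB; first exact: cu.
  by apply: continuous_subspaceW cU; apply: subset_itv; rewrite bnd_simp.
apply: (I_eq0_continuous ch) => a b ala ab bbe.
rewrite -(Hk a b ala ab bbe).
have sub : `[a, b] `<=` Om by apply: subset_itvSoo; rewrite bnd_simp.
have sub2 : `[a, b] `<=` `[al, be] by apply: subset_itv; rewrite bnd_simp ltW.
apply: I_ae_eq.
- by apply: continuous_itg; apply: continuous_subspaceW ch.
- apply: itgB; first by apply: itg_sub gi; exact: ltW.
  by apply: continuous_itg; apply: continuous_subspaceW cU.
- apply: aeS ug => x ugx /andP[ax xb]; rewrite ugx//.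
  by rewrite (lt_trans ala ax) (lt_trans xb).
Qed.

Lemma eq0_closure h : {within `[al, be], continuous h} ->
  (forall x, al < x < be -> h x = 0) -> forall x, al <= x <= be -> h x = 0.
Proof.
move=> /within_continuousP ch h0 x /andP[ax xb]; apply/eqP; rewrite -normr_le0 leNgt.
apply/negP => hx; have xI : `[al, be]%classic x by rewrite /= in_itv/= ax xb.
have [d d0 H] := ch x xI _ hx.
have [r [r0 rd rL]] : exists r, [/\ 0 < r, r < d & r < be - al].
  exists (Num.min d (be - al) / 2).
  have M0 : 0 < Num.min d (be - al) by rewrite lt_min d0 subr_gt0.
  have mn : Num.min d (be - al) / 2 < Num.min d (be - al) by move: M0; clear; lra.
  by split; [exact: divr_gt0|apply: lt_le_trans mn _; rewrite ge_min lexx ?orbT..].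
suff [y [yy xy]] : exists y, al < y < be /\ `|x - y| < d.
  have /andP[y1 y2] := yy; have := H y; rewrite (h0 y)// subr0 ltxx => F.
  by have := F _ xy; rewrite /= in_itv/= !ltW// => /(_ isT).
have [xm|xm] := leP x ((al + be) / 2).
- exists (x + r / 2); split; last by rewrite opprD addrA subrr sub0r normrN gtr0_norm; move: rd r0; clear; lra.
  by apply/andP; split; move: ax xm rL r0 albe; clear; lra.
- exists (x - r / 2); split; last by rewrite opprB addrCA subrr addr0 gtr0_norm; move: rd r0; clear; lra.
  by apply/andP; split; move: xb xm rL r0 albe; clear; lra.
Qed.

(** Let [d] be the primitive [U'] of the weak derivative minus a test function [phi]. At an end
    point [phi] vanishes, so there [U'] equals [d], and integrating [|d x| <= |d y| + I al be |d'|]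
    over [y] bounds this value by the W^{1,2} distance from [u] to [phi]. *)
Lemma sobolev0_boundary u U : {within Om, continuous u} -> sobolev0 Om u ->
  {within `[al, be], continuous U} -> (forall x, al < x < be -> u x = U x) ->
  U al = 0 /\ U be = 0.
Proof.
move=> cu [uL [u' [u'L wu H]]] cU uU.
have [v [vi v2i u'v]] := Lp2_representative u'L.
have wv : weak_derivative Om 1 u v.
  move=> phi tp; rewrite (wu phi tp); congr (_ * _).
  apply: ae_eq_Rintegral; apply: aeS u'v => x h; rewrite /= in_itv/=.
  by move=> /h ->.
have [U' U'AC uU'] := weak_derivative1_primitive cu uL vi wv.
have cU' := AC_continuous U'AC.
pose L := be - al.
have L0 : 0 < L by rewrite subr_gt0.
have main x : (x = al) \/ (x = be) -> U' x = 0.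
  move=> xx; have xab : al <= x <= be by case: xx => ->; rewrite ?lexx ?(ltW albe).
  have xout : ~ Om x by rewrite /= in_itv/=; case: xx => ->; rewrite ltxx ?andbF.
  apply/eqP; rewrite -normr_le0 -(pmulr_rle0 _ L0); apply/ler_addgt0Pl => e e0; rewrite addr0.
  (* The integrals of [|d|] and [|d'|] are each at most [e / C * ((L + 1) / 2)], and the latter is
     counted [L] times. *)
  pose C := (1 + L) * ((L + 1) / 2).
  have C0 : 0 < C by move: L0; rewrite /C => l0; apply: mulr_gt0; [|apply: divr_gt0]; move: l0; clear; lra.
  have t0 : 0 < e / C by rewrite divr_gt0.
  have [phi tp] := H _ t0.
  have ps := test_smooth tp.
  pose d y := U' y - phi y.
  pose dl y := v y - (phi^`())%classic y.
  have dAC : AC al be d dl by apply: AC_B => //; exact: smooth_AC.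
  have cd := AC_continuous dAC; have [dli Hd] := dAC.
  have cphi' : {within `[al, be], continuous (phi^`())%classic}.
    by apply: smooth_within; exact: smooth_derive1.
  have d2i : itg al be (fun y => d y ^+ 2).
    by apply: itg_ext (itgM_continuous (AC_itg dAC) cd) => y _.
  have dl2i : itg al be (fun y => dl y ^+ 2).
    have h1 : itg al be (fun y => v y ^+ 2 - 2 * (v y * (phi^`())%classic y)).
      by apply: itgB => //; apply: itgZ; exact: itgM_continuous.
    have h2 := itgM_continuous (continuous_itg cphi') cphi'.
    by apply: itg_ext (itgD h1 h2) => y _; rewrite /dl; ring.
  have ddi : itg al be (fun y => d y ^+ 2 + dl y ^+ 2) by exact: itgD.
  have -> : (\int[mu]_(y in Om) ((u y - phi y) ^+ 2 + (u' y - (phi^`())%classic y) ^+ 2)%:E =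
     \int[mu]_(y in Om) (d y ^+ 2 + dl y ^+ 2)%:E)%E.
    apply: ae_eq_integral_nonmeasurable; apply: aeS u'v => y h.
    by rewrite /= in_itv/= => yab; rewrite uU'// h.
  have ddi' : mu.-integrable Om (EFin \o (fun y => d y ^+ 2 + dl y ^+ 2)).
    by apply: integrableS ddi => //; apply: subset_itv; rewrite bnd_simp.
  have Efin : (\int[mu]_(y in Om) (d y ^+ 2 + dl y ^+ 2)%:E \is a fin_num)%E.
    by apply: (integrable_fin_num _ ddi').
  rewrite -(fineK Efin) lte_fin => Elt.
  have {}Elt : I al be (fun y => d y ^+ 2) + I al be (fun y => dl y ^+ 2) < (e / C) ^+ 2.
    by rewrite -I_D// -I_oo.
  have I1 : 0 <= I al be (fun y => d y ^+ 2) by apply: I_ge0 => y _; exact: sqr_ge0.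
  have I2 : 0 <= I al be (fun y => dl y ^+ 2) by apply: I_ge0 => y _; exact: sqr_ge0.
  have B1 : I al be (fun y => `|d y|) <= e / C * ((L + 1) / 2).
    apply: I_norm_le_of_square => //; first exact: AC_itg dAC.
    by move: Elt I2; clear; lra.
  have B2 : I al be (fun y => `|dl y|) <= e / C * ((L + 1) / 2).
    apply: I_norm_le_of_square => //; by move: Elt I1; clear; lra.
  have -> : U' x = d x by rewrite /d (test_function_out tp xout) subr0.
  have dxy y : al <= y <= be -> `|d x| <= `|d y| + I al be (fun y => `|dl y|).
    move=> yab; have key : `|d x - d y| <= I al be (fun y => `|dl y|).
      have bnd s t : al <= s -> s <= t -> t <= be -> `|d t - d s| <= I al be (fun y => `|dl y|).
        move=> als st tbe; rewrite Hd//; have dst : itg s t dl by exact: itg_sub dli.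
        by apply: le_trans (I_norm dst) _; apply: I_ge0_mono => //; exact: itg_norm.
      move: xab yab => /andP[x1 x2] /andP[y1 y2].
      have [xy|/ltW yx] := leP x y; last exact: bnd.
      by rewrite distrC; exact: bnd.
    rewrite -lerBlDl; apply: le_trans key; exact: lerB_dist.
  have : I al be (fun=> `|d x|) <= I al be (fun y => `|d y| + I al be (fun y => `|dl y|)).
    apply: I_le => //; first exact: itg_cst.
    by apply: itgD; [apply: itg_norm; exact: AC_itg dAC|exact: itg_cst].
  rewrite I_cst ?(ltW albe)// I_D; [|by apply: itg_norm; exact: AC_itg dAC|exact: itg_cst].
  rewrite I_cst ?(ltW albe)// mulrC -/L => h.
  apply: le_trans h _.
  have -> : e = e / C * ((L + 1) / 2) + e / C * ((L + 1) / 2) * L.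
    have h1 : L + 1 != 0 by rewrite gt_eqF// addr_gt0.
    by rewrite /C; field; rewrite ?[1 + L]addrC ?h1.
  by apply: lerD => //; apply: ler_wpM2r => //; exact: ltW.
have UU' x : al <= x <= be -> U x = U' x.
  move=> xab; apply/eqP; rewrite -subr_eq0; apply/eqP; move: x xab.
  apply: eq0_closure => [|x xab]; last by rewrite -uU// uU'// subrr.
  by apply: within_continuousB; [exact: cU|exact: cU'].
by rewrite !UU' ?lexx ?(ltW albe)//; split; apply: main; [left|right].
Qed.

End SobolevFunctions.

(** * Approximation of functions vanishing at the end points by test functions *)

Section Density.
Context {R : realType}.
Local Notation mu := (@lebesgue_measure R).
Implicit Types (a b x y t p : R) (c m f g h u v phi U V W F : R -> R).

Lemma continuous_sqrB_itg a b f g : {within `[a, b], continuous f} -> {within `[a, b], continuous g} ->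
  itg a b (fun x => (f x - g x) ^+ 2).
Proof.
move=> cf cg; have ch : {within `[a, b], continuous (fun x => f x - g x)}.
  exact: within_continuousB.
by apply: itg_ext (itgM_continuous (continuous_itg ch) ch).
Qed.

(** Induction on the number of pieces of length at most [d / 2]: on each new piece ]s, t[, [v] is
    replaced by its left value [v s] times a sharp bump. *)
Lemma step_approximation a b v (eta : R) : ucont a b v -> a <= b -> 0 < eta ->
  exists psi, [/\ smooth psi, forall x, ~~ (a < x < b) -> psi x = 0 &
    I a b (fun x => (v x - psi x) ^+ 2) <= 2 * eta ^+ 2 * (b - a)].
Proof.
move=> uv ab e0; have [d d0 vd] := uv _ e0; have cv := ucont_continuous uv.
have [M M0 vM] := continuous_bounded cv.
suff H n t : a <= t <= b -> t - a <= n%:R * (d / 2) ->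
    exists psi, [/\ smooth psi, forall x, ~~ (a < x < t) -> psi x = 0 &
    I a t (fun x => (v x - psi x) ^+ 2) <= 2 * eta ^+ 2 * (t - a)].
  apply: (H ((Num.truncn ((b - a) / (d / 2))).+1)); first by rewrite ab lexx.
  rewrite -ler_pdivrMr ?divr_gt0//; exact: ltW (truncnS_gt _).
elim: n t => [|n IH] t /andP[at_ tb] tn.
  have -> : t = a by apply/eqP; rewrite eq_le at_ andbT -subr_le0; rewrite mul0r in tn.
  by exists (fun=> 0); split; [exact: smooth_cst|by []|rewrite I_xx subrr mulr0].
move: at_; rewrite le_eqVlt => /predU1P[<-|at_].
  by exists (fun=> 0); split; [exact: smooth_cst|by []|rewrite I_xx subrr mulr0].
pose s := Num.max a (t - d / 2).
have as_ : a <= s by rewrite le_max lexx.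
have st : s < t by rewrite gt_max at_/= ltrBlDr ltrDl divr_gt0.
have sd : t - s <= d / 2 by rewrite lerBlDr -lerBlDl le_max lexx orbT.
have [||psi [ps p0 Ips]] := IH s; first by rewrite as_ (le_trans (ltW st)).
  rewrite /s; have [h|h] := leP a (t - d / 2); last by rewrite subrr mulr_ge0// divr_ge0// ltW.
  by move: tn; rewrite -natr1 mulrDl mul1r; clear; lra.
have cw x y F : a <= x -> y <= b -> {within `[a, b], continuous F} ->
    {within `[x, y], continuous F}.
  by move=> ax yb; apply: continuous_subspaceW; apply: subset_itv; rewrite bnd_simp.
have cvs : {within `[s, t], continuous v} by exact: cw.
have cb n' : {within `[s, t], continuous (fun x => v s * bump s t n' x)}.
  by apply: smooth_within; apply: smoothZ; exact: smooth_bump.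
have mi : measurable_fun `[s, t] (fun x => v s * ((s < x < t)%R)%:R).
  apply: measurable_fun_cvg (fun n => continuous_measurable (cb n)) _ => x _.
  by apply: cvgMr; exact: cvg_bump.
have [Li cvI] : itg s t (fun x => (v x - v s * ((s < x < t)%R)%:R) ^+ 2) /\
    (fun n => I s t (fun x => (v x - v s * bump s t n x) ^+ 2)) @ \oo -->
    I s t (fun x => (v x - v s * ((s < x < t)%R)%:R) ^+ 2).
  apply: (@I_dominated _ s t _ _ (fun=> (M + M) ^+ 2)).
  - by move=> i; exact: itg_measurable (continuous_sqrB_itg cvs (cb i)).
  - move=> x _; rewrite expr2; under eq_fun do rewrite expr2.
    by apply: cvgM; apply: cvgB; (try exact: cvg_cst); apply: cvgMr; exact: cvg_bump.
  - exact: itg_cst.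
  - move=> i x /andP[sx xt]; rewrite normrX lerXn2r ?nnegrE ?addr_ge0//.
    apply: le_trans (ler_normB _ _) _; apply: lerD.
      by apply: vM; rewrite (le_trans as_ sx) (le_trans xt).
    rewrite normrM (ger0_norm (bump_ge0 _ _ _ _)).
    apply: le_trans (_ : `|v s| <= _); first by rewrite ler_piMr ?bump_le1.
    by apply: vM; rewrite as_ (le_trans (ltW st)).
(* The step function itself costs [eta^2 * (t - s)]. The factor 2 makes the inequality strict, hence
   stable when the indicator is replaced by a bump of large index. *)
have Ilim : I s t (fun x => (v x - v s * ((s < x < t)%R)%:R) ^+ 2) < 2 * eta ^+ 2 * (t - s).
  apply: le_lt_trans (_ : eta ^+ 2 * (t - s) < _); last first.
    have : 0 < eta ^+ 2 * (t - s) by rewrite mulr_gt0 ?exprn_gt0 ?subr_gt0.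
    by rewrite -mulrA; move: (eta ^+ 2 * (t - s)); clear => z z0; lra.
  rewrite -(I_cst (eta ^+ 2) (ltW st)).
  have -> : I s t (fun x => (v x - v s * ((s < x < t)%R)%:R) ^+ 2) =
     I s t (fun x => (v x - v s) ^+ 2).
    apply: I_ae_eq => //.
      apply: continuous_sqrB_itg => //; apply: smooth_within; exact: smooth_cst.
    by apply: aeW => x ->; rewrite mulr1.
  apply: I_le; [|exact: itg_cst|].
    apply: continuous_sqrB_itg => //; apply: smooth_within; exact: smooth_cst.
  move=> x /andP[sx xt]; rewrite -[leLHS]ger0_norm ?sqr_ge0// normrX.
  rewrite lerXn2r ?nnegrE// ?(ltW e0)//; apply/ltW/vd => //; first exact: le_trans tb.
  apply: (@le_lt_trans _ _ (d / 2)); first by apply: le_trans sd; rewrite lerB.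
  by move: d0; clear; lra.
have [N _ HN] := cvgr_lt _ cvI _ Ilim.
have {}HN := HN N (leqnn N).
exists (fun x => psi x + v s * bump s t N x); split.
- by apply: smoothD => //; apply: smoothZ; exact: smooth_bump.
- move=> x xat; rewrite p0 ?bump_eq0 ?mulr0 ?addr0//.
    by apply: contra xat => /andP[sx ->]; rewrite andbT (le_lt_trans as_).
  by apply: contra xat => /andP[-> xs]; rewrite (lt_trans xs).
have sn : smooth (fun x => psi x + v s * bump s t N x).
  by apply: smoothD => //; apply: smoothZ; exact: smooth_bump.
rewrite (@I_split _ a s t) ?(ltW st)//; last first.
  apply: continuous_sqrB_itg; first exact: cw.
  by apply: smooth_within.
have -> : 2 * eta ^+ 2 * (t - a) = 2 * eta ^+ 2 * (s - a) + 2 * eta ^+ 2 * (t - s) by ring.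
apply: lerD.
  apply: le_trans Ips; rewrite le_eqVlt; apply/orP; left; apply/eqP.
  apply: I_ext => x /andP[ax xs].
  by rewrite bump_eq0 ?mulr0 ?addr0// negb_and -leNgt xs.
apply: le_trans (ltW HN); rewrite le_eqVlt; apply/orP; left; apply/eqP.
apply: I_ext => x /andP[sx xt]; rewrite p0 ?add0r//.
by rewrite negb_and -[~~ (x < s)]leNgt sx orbT.
Qed.

Lemma sqrD_le (x y : R) : (x + y) ^+ 2 <= 2 * x ^+ 2 + 2 * y ^+ 2.
Proof. by rewrite -subr_ge0; have := sqr_ge0 (x - y); nra. Qed.

Lemma small_square (K e : R) : 0 <= K -> 0 < e -> exists2 tau : R, 0 < tau & K * tau ^+ 2 < e ^+ 2.
Proof.
move=> K0 e0; have K1 : 0 < 1 + K by rewrite ltr_pwDl.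
exists (e / (1 + K)); first exact: divr_gt0.
rewrite exprMn exprVn mulrCA -[ltRHS]mulr1 ltr_pM2l ?exprn_gt0//.
by rewrite ltr_pdivrMr ?exprn_gt0// mul1r; move: K0; clear; nra.
Qed.

Context (al be : R).
Context (albe : al < be).
Local Notation Om := (`]al, be[%classic : set R).

(** The bounds by thirds keep the middle third of the interval inside [a, b]; the correction of the
    mean in [zero_mean_approximation] is supported there. *)
Lemma compact_support_approximation v (tau : R) : ucont al be v -> 0 < tau ->
  exists a b psi, [/\ al < a, a <= al + (be - al) / 3, be - (be - al) / 3 <= b, b < be &
    [/\ smooth psi, forall x, ~~ (a <= x <= b) -> psi x = 0 &
    I al be (fun x => (v x - psi x) ^+ 2) <= tau ^+ 2]].
Proof.
move=> uv t0; have cv := ucont_continuous uv; have [M M0 vM] := continuous_bounded cv.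
set L := be - al; have L0 : 0 < L by rewrite subr_gt0.
have [eta e0 He] := small_square (mulr_ge0 (ler0n R 4) (ltW L0)) t0.
(* Each end strip costs at most [M^2 * del <= tau^2 / 4], and the middle at most
   [2 * eta^2 * L <= tau^2 / 2]. *)
pose del := Num.min (L / 3) (tau ^+ 2 / (4 * (1 + M ^+ 2))).
have M1 : 0 < 1 + M ^+ 2 by rewrite ltr_pwDl ?sqr_ge0.
have del0 : 0 < del.
  by rewrite lt_min divr_gt0//= divr_gt0 ?exprn_gt0 ?mulr_gt0.
have delL : del <= L / 3 by rewrite ge_min lexx.
have delM : M ^+ 2 * del <= tau ^+ 2 / 4.
  have : del <= tau ^+ 2 / (4 * (1 + M ^+ 2)) by rewrite ge_min lexx orbT.
  rewrite ler_pdivlMr ?mulr_gt0// => h; rewrite ler_pdivlMr//; apply: le_trans h.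
  by move: del0; clear; nra.
have ala : al < al + del by rewrite ltrDl.
have bbe : be - del < be by rewrite ltrBlDr ltrDl.
have ab : al + del <= be - del by move: delL L0; rewrite /L; clear; lra.
have [psi [ps p0 Ip]] : exists psi, [/\ smooth psi,
    forall x, ~~ (al + del < x < be - del) -> psi x = 0 &
    I (al + del) (be - del) (fun x => (v x - psi x) ^+ 2) <=
    2 * eta ^+ 2 * (be - del - (al + del))].
  apply: step_approximation => //.
  move=> e /uv[d d0 H]; exists d => // x y ax xy yb; apply: H => //.
    exact: le_trans (ltW ala) ax.
  exact: le_trans yb (ltW bbe).
exists (al + del), (be - del), psi; split=> //.
- by rewrite lerD2l.
- by rewrite lerD2l lerN2.
split=> //.
- move=> x xab; apply: p0; apply: contra xab => /andP[/ltW-> /ltW->].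
  by [].
have ci : itg al be (fun x => (v x - psi x) ^+ 2).
  by apply: continuous_sqrB_itg => //; exact: smooth_within.
rewrite (@I_split _ al (al + del))//; [|exact: ltW|exact: le_trans (ltW bbe)].
rewrite (@I_split _ (al + del) (be - del))//; [|exact: ltW|]; last first.
  by apply: itg_sub ci; rewrite ?lexx// ltW.
have bnd x y : al <= x -> x <= y -> y <= be -> (forall z, x <= z <= y -> psi z = 0) ->
    I x y (fun z => (v z - psi z) ^+ 2) <= M ^+ 2 * (y - x).
  move=> ax xy yb p_0; rewrite -(I_cst _ xy); apply: I_le.
  - exact: itg_sub ci.
  - exact: itg_cst.
  move=> z xyz; rewrite p_0// subr0 -[leLHS]ger0_norm ?sqr_ge0// normrX.
  rewrite lerXn2r ?nnegrE//; apply: vM; move: xyz => /andP[xz zy].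
  by rewrite (le_trans ax xz) (le_trans zy).
have B1 : I al (al + del) (fun z => (v z - psi z) ^+ 2) <= M ^+ 2 * (al + del - al).
  apply: bnd => //; [exact: ltW|exact: le_trans (ltW bbe)|].
  by move=> z /andP[_ zd]; apply: p0; rewrite negb_and -leNgt zd.
have B2 : I (be - del) be (fun z => (v z - psi z) ^+ 2) <= M ^+ 2 * (be - (be - del)).
  apply: bnd => //; [exact: le_trans (ltW ala) ab|exact: ltW|].
  by move=> z /andP[zd _]; apply: p0; rewrite negb_and -![~~ (_ < _)]leNgt zd orbT.
have B3 : 2 * eta ^+ 2 * (be - del - (al + del)) <= 2 * eta ^+ 2 * L.
  apply: ler_wpM2l; first by rewrite mulr_ge0// sqr_ge0.
  by rewrite /L; move: del0; clear; lra.
have E1 : al + del - al = del by ring.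
have E2 : be - (be - del) = del by ring.
rewrite E1 in B1; rewrite E2 in B2.
move: B1 B2 (le_trans Ip B3) delM He; clear; lra.
Qed.

(** Subtracting a multiple of the fixed bump [rho] restores the zero integral. The multiple is small
    because [v] has zero integral, so that the integral of [psi] is at most that of [|v - psi|]. *)
Lemma zero_mean_approximation v (e : R) : ucont al be v -> I al be v = 0 -> 0 < e ->
  exists a b h, [/\ al < a, a <= b, b < be, smooth h &
    [/\ forall x, ~~ (a <= x <= b) -> h x = 0, I al be h = 0 &
    I al be (fun x => (v x - h x) ^+ 2) <= e ^+ 2]].
Proof.
move=> uv Iv0 e0; have cv := ucont_continuous uv.
set L := be - al; have L0 : 0 < L by rewrite subr_gt0.
pose rho := bump (al + L / 3) (be - L / 3) 0.
have rs : smooth rho by exact: smooth_bump.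
have cr : {within `[al, be], continuous rho} by exact: smooth_within.
have J0 : 0 < I al be rho by apply: I_bump_gt0; move: L0; rewrite /L; clear; lra.
set J := I al be rho in J0; set R0 := I al be (fun x => rho x * rho x).
have r2i : itg al be (fun x => rho x * rho x).
  by apply: itgM_continuous => //; exact: continuous_itg.
have R00 : 0 <= R0 by apply: I_ge0 => x _; rewrite -expr2 sqr_ge0.
have K0 : 0 <= 2 + 2 * (((L + 1) / 2) / J) ^+ 2 * R0.
  by rewrite addr_ge0// mulr_ge0// mulr_ge0// sqr_ge0.
have [tau t0 Ht] := small_square K0 e0.
have [a [b [psi [ala aL bL bbe [ps p0 Ip]]]]] := compact_support_approximation uv t0.
have cp : {within `[al, be], continuous psi} by exact: smooth_within.
have vi := continuous_itg cv; have pi_ := continuous_itg cp.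
have di : itg al be (fun x => v x - psi x) by exact: itgB.
have d2i : itg al be (fun x => (v x - psi x) ^+ 2) by exact: continuous_sqrB_itg.
have B1 := I_norm_le_of_square albe t0 di d2i Ip.
pose s := I al be psi.
have sB : `|s| <= tau * ((L + 1) / 2).
  apply: le_trans B1; have -> : s = - I al be (fun x => v x - psi x).
    by rewrite I_B// Iv0 sub0r opprK.
  by rewrite normrN; exact: I_norm.
have ab : a <= b by move: aL bL L0; rewrite /L; clear; lra.
have hs : smooth (fun x => psi x + - (s / J) * rho x) by apply: smoothD => //; exact: smoothZ.
exists a, b, (fun x => psi x + - (s / J) * rho x); split=> //; split.
- move=> x xab; rewrite p0// add0r /rho bump_out ?mulr0//.
  by apply: contra xab => /andP[h1 h2]; rewrite (le_trans aL h1) (le_trans h2 bL).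
- rewrite I_D//; last by apply: itgZ; exact: continuous_itg.
  rewrite I_Z; last exact: continuous_itg.
  by rewrite -/J -/s mulNr divfK ?subrr// gt_eqF.
apply: ltW; apply: le_lt_trans Ht.
apply: (@le_trans _ _ (I al be (fun x => 2 * (v x - psi x) ^+ 2 +
   2 * (s / J) ^+ 2 * (rho x * rho x)))).
  apply: I_le.
  - by apply: continuous_sqrB_itg => //; exact: smooth_within.
  - by apply: itgD; exact: itgZ.
  move=> x _; have -> : v x - (psi x + - (s / J) * rho x) = (v x - psi x) + s / J * rho x by ring.
  by rewrite (_ : 2 * _ * (rho x * _) = 2 * (s / J * rho x) ^+ 2); [exact: sqrD_le|ring].
rewrite I_D; [|exact: itgZ|exact: itgZ].
rewrite !I_Z// -/R0 [leRHS]mulrDl; apply: lerD; first by rewrite ler_wpM2l.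
rewrite [leRHS]mulrAC; apply: ler_wpM2r => //; rewrite -[leRHS]mulrA; apply: ler_wpM2l => //.
rewrite -exprMn -[leLHS]ger0_norm ?sqr_ge0// normrX.
rewrite lerXn2r ?nnegrE//.
  by rewrite mulr_ge0 ?(ltW t0)// divr_ge0 ?(ltW J0)// divr_ge0// addr_ge0// ltW.
rewrite normrM normfV (gtr0_norm J0) ler_pdivrMr//.
apply: le_trans sB _; rewrite le_eqVlt; apply/orP; left; apply/eqP.
by field; rewrite gt_eqF.
Qed.

Lemma AC_weak_derivative1 u v : AC al be u v -> weak_derivative Om 1 u v.
Proof.
move=> uAC phi tp; rewrite derive1n1 expr1 mulN1r.
have tp' := test_function_derive1 tp.
rewrite !I_oo; [|exact: itg_test_mul uAC.1 tp|exact: itg_test_mul (AC_itg uAC) tp'].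
exact: AC_test_by_parts (ltW albe) uAC tp.
Qed.

Lemma AC_weak_derivative2 u v w : AC al be u v -> AC al be v w -> weak_derivative Om 2 u w.
Proof.
move=> uAC vAC phi tp; have tp' := test_function_derive1 tp.
rewrite sqrrN expr1n mul1r [(phi^`(2))%classic]derive1Sn (AC_weak_derivative1 uAC tp').
have := AC_weak_derivative1 vAC tp; rewrite derive1n1 => ->.
by rewrite expr1 !mulN1r opprK.
Qed.

Lemma Lp2_continuous f : {within `[al, be], continuous f} -> Lp Om 2%:E f.
Proof.
move=> cf; apply: Lp2_intro; first exact: continuous_measurable.
by apply: itg_ext (itgM_continuous (continuous_itg cf) cf).
Qed.

(** The boundary values say that [v] has zero integral. A compactly supported smooth [h] of zero
    integral close to [v] is the derivative of a test function, which is then close to [u]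
    uniformly. *)
Lemma sobolev0_AC u v : AC al be u v -> ucont al be v -> u al = 0 -> u be = 0 -> sobolev0 Om u.
Proof.
move=> uAC uv ua ub; have cu := AC_continuous uAC; have cv := ucont_continuous uv.
split; first exact: Lp2_continuous.
exists v; split; [exact: Lp2_continuous|exact: AC_weak_derivative1|].
move=> e e0; set L := be - al; have L0 : 0 < L by rewrite subr_gt0.
have K0 : 0 <= 1 + L * ((L + 1) / 2) ^+ 2.
  by rewrite addr_ge0// mulr_ge0 ?(ltW L0)// sqr_ge0.
have [tau t0 Ht] := small_square K0 e0.
have Iv : I al be v = 0.
  by have [_ <-] := uAC; rewrite ?lexx ?(ltW albe)// ua ub subrr.
have [a [b [h [ala ab bbe hs [h0 Ih Ivh]]]]] := zero_mean_approximation uv Iv t0.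
have [phi tp ph] := test_primitive ala ab bbe hs h0 Ih.
exists phi => //; rewrite ph.
have ps := test_smooth tp.
have ch : {within `[al, be], continuous h} by exact: smooth_within.
have cphi : {within `[al, be], continuous phi} by exact: smooth_within.
have dAC : AC al be (fun x => u x - phi x) (fun x => v x - h x).
  by rewrite -ph; apply: AC_B => //; exact: smooth_AC.
have [di dE] := dAC.
have d2i := continuous_sqrB_itg cu cphi; have dh2i := continuous_sqrB_itg cv ch.
have B1 := I_norm_le_of_square albe t0 di dh2i Ivh.
have B2 x : al <= x <= be -> `|u x - phi x| <= tau * ((L + 1) / 2).
  move=> /andP[ax xb]; apply: le_trans B1.
  have := dE _ _ (lexx al) ax xb; rewrite ua (@test_function_out _ _ _ al tp); last first.
    by rewrite /= in_itv/= ltxx.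
  rewrite subrr subr0 => ->; apply: le_trans (I_norm _) _; first exact: itg_sub di.
  by apply: I_ge0_mono => //; exact: itg_norm.
have B3 : I al be (fun x => (u x - phi x) ^+ 2) <= (tau * ((L + 1) / 2)) ^+ 2 * L.
  rewrite -(I_cst _ (ltW albe)); apply: I_le => //; first exact: itg_cst.
  move=> x xab; rewrite -[leLHS]ger0_norm ?sqr_ge0// normrX.
  rewrite lerXn2r ?nnegrE ?B2//.
  by rewrite mulr_ge0 ?(ltW t0)// divr_ge0// addr_ge0// ltW.
have si : itg al be (fun x => (u x - phi x) ^+ 2 + (v x - h x) ^+ 2) by exact: itgD.
have si' : mu.-integrable Om (EFin \o (fun x => (u x - phi x) ^+ 2 + (v x - h x) ^+ 2)).
  by apply: integrableS si => //; apply: subset_itv; rewrite bnd_simp.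
have Efin : (\int[mu]_(x in Om) ((u x - phi x) ^+ 2 + (v x - h x) ^+ 2)%:E \is a fin_num)%E.
  by apply: (integrable_fin_num _ si').
rewrite -(fineK Efin) lte_fin; apply: le_lt_trans Ht.
have -> : fine (\int[mu]_(x in Om) ((u x - phi x) ^+ 2 + (v x - h x) ^+ 2)%:E)%E =
    I al be (fun x => (u x - phi x) ^+ 2) + I al be (fun x => (v x - h x) ^+ 2).
  by rewrite -I_D// -I_oo.
have -> : (1 + L * ((L + 1) / 2) ^+ 2) * tau ^+ 2 =
  (tau * ((L + 1) / 2)) ^+ 2 * L + tau ^+ 2 by ring.
exact: lerD.
Qed.

End Density.

(** * The boundary value problem *)

Section Problem.
Context {R : realType}.
Local Notation mu := (@lebesgue_measure R).
Context (al be : R) (b c m ct mt : R -> R) (C : R).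
Local Notation Om := (`]al, be[%classic : set R).
Context (albe : al < be) (cb : {within `[al, be], continuous b}).
Context (ctm : measurable_fun setT ct) (ct0 : forall x, 0 <= ct x <= C)
  (cct : {ae mu, forall x, al < x < be -> c x = ct x}).
Context (mti : itg al be mt) (mt2i : itg al be (fun x => mt x ^+ 2))
  (mmt : {ae mu, forall x, al < x < be -> m x = mt x}).
Implicit Types (x y p : R) (u W : R -> R).

Definition weight b al x : R := expR (I al x b).
Definition coweight b al x : R := expR (- I al x b).
Local Notation k := (weight b al).
Local Notation P := (coweight b al).
Local Notation cc := (fun x => P x * ct x).
Local Notation mw := (fun x => P x * mt x).
Local Notation mp := (fun x => Num.max (P x * mt x) 0).
Local Notation mn := (fun x => Num.max (- (P x * mt x)) 0).

Lemma weightK x : k x * P x = 1.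
Proof. by rewrite -expRD subrr expR0. Qed.

Lemma weight_AC : AC al be k (fun x => k x * b x).
Proof. exact: AC_expR (AC_int (continuous_itg cb)). Qed.

Lemma coweight_AC : AC al be P (fun x => P x * - b x).
Proof.
apply: AC_expR; have := AC_Z (-1) (AC_int (continuous_itg cb)).
by apply: AC_ext => x _; rewrite mulN1r.
Qed.

Lemma max0_itg f : itg al be f -> itg al be (fun x => Num.max (f x) 0).
Proof.
move=> fi; apply: (itg_le _ fi) => [|x _].
  by apply: measurable_maxr => //; exact: itg_measurable fi.
by rewrite ger0_norm ?le_max ?lexx ?orbT// ge_max normr_ge0 andbT ler_norm.
Qed.

Lemma max0B (z : R) : Num.max z 0 - Num.max (- z) 0 = z.
Proof.
have [z0|/ltW z0] := leP z 0; first by rewrite max_l ?oppr_ge0// sub0r opprK.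
by rewrite max_r ?oppr_le0// subr0.
Qed.

Lemma ct_itg : itg al be ct.
Proof.
apply: (@itg_bounded _ _ _ C) => [|x _]; first exact: measurable_funS ctm.
by have /andP[h1 h2] := ct0 x; rewrite ger0_norm.
Qed.

Lemma cc_itg : itg al be cc.
Proof.
by apply: itg_ext (itgM_continuous ct_itg (AC_continuous coweight_AC)) => x _; rewrite mulrC.
Qed.

Lemma mw_itg : itg al be mw.
Proof.
by apply: itg_ext (itgM_continuous mti (AC_continuous coweight_AC)) => x _; rewrite mulrC.
Qed.

Lemma mp_itg : itg al be mp. Proof. exact: max0_itg mw_itg. Qed.

Lemma mn_itg : itg al be mn.
Proof. exact: max0_itg (itgN mw_itg). Qed.

(** The values of [u] outside the open interval are arbitrary, so [u] is replaced by its absolutely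
    continuous extension [U]. The weak derivative has an absolutely continuous representative [V],
    and [W] is [V / k]. *)
Lemma solution_BVP p u : 0 < p -> solution Om b c m p u ->
  exists u' W, (forall x, al < x < be -> 0 < u' x) /\
    BVP al be k cc (fun x => mp x * u' x `^ p - mn x * u' x `^ p) u' W.
Proof.
move=> p0 [cu [uL _] us upos [u1 [u2 [u1L w1 u2L w2 eq]]]].
have [v1 [v1i _ uv1]] := Lp2_representative u1L.
have [v2 [v2i _ uv2]] := Lp2_representative u2L.
have w1' : weak_derivative Om 1 u v1.
  move=> phi tp; rewrite (w1 phi tp); congr (_ * _).
  apply: ae_eq_Rintegral; apply: aeS uv1 => x h; rewrite /= in_itv/=.
  by move=> /h ->.
have [U UAC uU] := weak_derivative1_primitive albe cu uL v1i w1'.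
(* [v2] is the weak derivative of [v1]: test the first order relation with the derivative of [phi]
   and compare with the second order one. *)
have [phi tp|kappa Hk] := @weak_derivative_primitive R al be v1 v2 albe v1i v2i.
  have tp' := test_function_derive1 tp.
  have e1 : \int[mu]_(x in Om) (u x * (phi^`(2))%classic x) =
      - \int[mu]_(x in Om) (v1 x * (phi^`())%classic x).
    by rewrite [(phi^`(2))%classic]derive1Sn (w1' _ tp') expr1 mulN1r.
  have e2 : \int[mu]_(x in Om) (u x * (phi^`(2))%classic x) = I al be (fun x => v2 x * phi x).
    rewrite (w2 _ tp) sqrrN expr1n mul1r; apply: Rintegral_ae_I; first exact: itg_test_mul.
    by apply: aeS uv2 => x h /h ->.
  apply: (canRL (@opprK _)); rewrite -e2 e1; congr (- _).
  by rewrite I_oo//; exact: itg_test_mul.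
pose V x := kappa + I al x v2.
have VAC : AC al be V v2.
  by apply: AC_ext (AC_D (AC_cst al be kappa) (AC_int v2i)) => // x _; rewrite add0r.
have Vi := AC_itg VAC.
have v1V : {ae mu, forall x, al < x < be -> v1 x - V x = 0}.
  by apply: I_eq0_ae => //; exact: itgB.
have UVAC : AC al be U V.
  apply: AC_ae_density UAC Vi _; apply: aeS v1V => x h /h/eqP.
  by rewrite subr_eq0 => /eqP.
have cU := AC_continuous UAC.
have [Ua Ub] := sobolev0_boundary albe cu us cU uU.
have Upos x : al < x < be -> 0 < U x.
  by move=> xab; rewrite -uU//; apply: upos; rewrite /= in_itv.
have U0 x : al <= x <= be -> 0 <= U x.
  move=> /andP[]; rewrite le_eqVlt => /predU1P[<- _|ax]; first by rewrite Ua.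
  rewrite le_eqVlt => /predU1P[->|xb]; first by rewrite Ub.
  by rewrite ltW// Upos// ax.
exists U, (fun x => P x * V x); split=> //; split=> //.
  by apply: AC_ext UVAC => // x _; rewrite mulrA weightK mul1r.
apply: (AC_ae_density (AC_mul coweight_AC VAC)).
  apply: itgB; first exact: itgM_continuous cc_itg cU.
  by apply: itgB; apply: itgM_powR => //; [exact: mp_itg|exact: mn_itg].
apply: aeS (aeI (aeI eq v1V) (aeI (aeI uv1 uv2) (aeI cct mmt))).
move=> x [[e h0] [[h1 h2] [h3 h4]]] xab.
have {}h0 := h0 xab; have {}e : - u2 x + b x * u1 x + c x * u x = m x * u x `^ p.
  by apply: e; rewrite /= in_itv.
rewrite -mulrBl max0B -uU//.
have -> : v2 x = b x * V x + ct x * u x - mt x * u x `^ p.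
  move: e; rewrite h1// h2// h3// h4//.
  have -> : v1 x = V x by apply/eqP; rewrite -subr_eq0 h0.
  by move=> <-; ring.
ring.
Qed.


(** The membership in the closure of the test functions comes from [sobolev0_AC], as [u' = k * W] is
    absolutely continuous; [u''] is square integrable because [m] is and [u^p] is bounded. *)
Lemma BVP_solution p u W : 0 < p -> (forall x, al < x < be -> 0 < u x) ->
  BVP al be k cc (fun x => mp x * u x `^ p - mn x * u x `^ p) u W ->
  solution Om b c m p u.
Proof.
move=> p0 upos [ua ub uAC WAC].
have cu := AC_continuous uAC; have cW := AC_continuous WAC.
have u0 x : al <= x <= be -> 0 <= u x.
  move=> /andP[]; rewrite le_eqVlt => /predU1P[<- _|ax]; first by rewrite ua.
  rewrite le_eqVlt => /predU1P[->|xb]; first by rewrite ub.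
  by rewrite ltW// upos// ax.
pose u1 x := k x * W x.
pose u2 x := b x * u1 x + (ct x * u x - mt x * u x `^ p).
have u1AC : AC al be u1 u2.
  apply: AC_ext (AC_mul weight_AC WAC) => // x _.
  rewrite -mulrBl max0B mulrBr !mulrA weightK mul1r /u2 /u1; ring.
have cu1 := AC_continuous u1AC.
have cup : {within `[al, be], continuous (fun x => u x `^ p)}.
  by apply: powR_within_continuous => // x /=; rewrite in_itv/=; exact: u0.
have u2m : measurable_fun `[al, be] u2 by exact: itg_measurable u1AC.1.
have u2L : Lp Om 2%:E u2.
  apply: Lp2_intro => //.
  have ct2i : itg al be (fun x => ct x * ct x).
    apply: (@itgM_bounded _ _ _ C) (ct_itg); first exact: measurable_funS ctm.
    by move=> x _; have /andP[h1 h2] := ct0 x; rewrite ger0_norm.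
  have cb1 : {within `[al, be], continuous (fun x => b x * u1 x)}.
    by move=> x; apply: continuousM; [exact: cb|exact: cu1].
  have i1 := itgM_continuous (continuous_itg cb1) cb1.
  have i2 := itgM_continuous (itgM_continuous ct2i cu) cu.
  have i3 := itgM_continuous (itgM_continuous mt2i cup) cup.
  (* The factors 2, 4, 4 come from applying [sqrD_le] to the three terms of [u2], once outside and
     once inside. *)
  apply: (itg_le _ (itgD (itgZ 2 i1) (itgD (itgZ 4 i2) (itgZ 4 i3)))).
    exact: measurable_funX.
  move=> x _; rewrite ger0_norm ?sqr_ge0// /u2; apply: le_trans (sqrD_le _ _) _.
  apply: le_trans (ler_norm _); apply: lerD; first by rewrite expr2.
  apply: (@le_trans _ _ (2 * (2 * (ct x * u x) ^+ 2 + 2 * (- (mt x * u x `^ p)) ^+ 2))).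
    by apply: ler_wpM2l => //; exact: sqrD_le.
  by rewrite le_eqVlt; apply/orP; left; apply/eqP; ring.
have w1 := AC_weak_derivative1 albe uAC; have w2 := AC_weak_derivative2 albe uAC u1AC.
have uL := Lp2_continuous cu; have u1L := Lp2_continuous cu1.
split.
- by apply: continuous_subspaceW cu; apply: subset_itv; rewrite bnd_simp.
- split=> // -[|[|[|//]]] _; [|by exists u1|by exists u2].
  by exists u => // phi tp; rewrite expr0 mul1r.
- exact: (sobolev0_AC albe uAC (AC_ucont u1AC : ucont al be (fun x => k x * W x)) ua ub).
- by move=> x; rewrite /= in_itv/=; exact: upos.
exists u1, u2; split=> //; apply: aeS (aeI cct mmt) => x [h1 h2].
by rewrite /= in_itv/= => xab; rewrite h1// h2// /u2; ring.
Qed.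

Lemma weight_gt0 x : 0 < k x. Proof. exact: expR_gt0. Qed.

Lemma weight_continuous : {within `[al, be], continuous k}.
Proof. exact: AC_continuous weight_AC. Qed.

Lemma coweight_bounded : exists2 B : R, 0 <= B & forall x, al <= x <= be -> P x <= B.
Proof.
have [B B0 PB] := continuous_bounded (AC_continuous coweight_AC).
by exists B => // x /PB; apply: le_trans; exact: ler_norm.
Qed.

Lemma cc_ge0 x : 0 <= cc x.
Proof. by rewrite mulr_ge0// ?expR_ge0//; have /andP[] := ct0 x. Qed.

Lemma subsol_solution p (w : R -> R) : 0 < p < 1 -> {within `[al, be], continuous w} ->
  (forall x, al <= x <= be -> 0 <= w x) -> (forall x, al < x < be -> 0 < w x) ->
  subsol al be k cc (fun x => mp x * w x `^ p - mn x * w x `^ p) w ->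
  exists u, solution Om b c m p u.
Proof.
move=> /andP[p0 p1] cw w0 wpos wS.
have m0 (z : R -> R) x : al <= x <= be -> 0 <= Num.max (z x) 0 by rewrite le_max lexx orbT.
have [u [W [upos uB]]] := positive_solution albe weight_continuous (fun x _ => weight_gt0 x)
  cc_itg mp_itg mn_itg (fun x _ => cc_ge0 x) (m0 _) (m0 _) p0 p1 cw w0 wpos wS.
by exists u; exact: BVP_solution uB.
Qed.

Lemma solvable_up p q u : 0 < p -> p < q -> q < 1 -> solution Om b c m p u ->
  exists u, solution Om b c m q u.
Proof.
move=> p0 pq q1 /(solution_BVP p0)[v [V [vpos vB]]].
have [w [cw w0 wpos wS]] := power_subsol albe (fun x _ => weight_gt0 x) weight_continuous
  cc_itg (fun x _ => cc_ge0 x) mp_itg mn_itg p0 pq q1 vpos vB.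
by apply: (subsol_solution (w := w)) => //; rewrite (lt_trans p0 pq).
Qed.

Lemma lebesgue_pt_I g x0 (e : R) : itg al be g -> al < x0 < be -> 0 < e ->
  lebesgue_pt (g \_ `[al, be]) x0 ->
  exists2 rho : R, 0 < rho & forall s, 0 < s -> s < rho ->
    I (x0 - s) (x0 + s) (fun t => `|g t - g x0|) <= e * s.
Proof.
move=> gi /andP[ax xb] e0 H.
(* The average is over an interval of length [2 * s], so a mean below [e / 2] is an integral below
   [e * s]. *)
have e20 : (0%E < (e / 2)%:E)%E by rewrite lte_fin divr_gt0.
have /= [d /= d0 Hd] := H _ (open_ereal_lt' e20).
exists (Num.min d (Num.min (x0 - al) (be - x0))); first by rewrite !lt_min d0 !subr_gt0 ax.
move=> s s0; rewrite !lt_min => /and3P[sd sa sb].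
have als : al < x0 - s by rewrite ltrBrDr -ltrBrDl.
have sbe : x0 + s < be by rewrite -ltrBrDl.
have gsi : itg (x0 - s) (x0 + s) (fun t => `|g t - g x0|).
  by apply: itg_norm; apply: itgB; [apply: itg_sub gi; exact: ltW|exact: itg_cst].
pose A : set R := `]x0 - s, x0 + s[%classic.
have sub : A `<=` `[x0 - s, x0 + s] by apply: subset_itv; rewrite bnd_simp.
have gsi' : mu.-integrable A (EFin \o (fun t => `|g t - g x0|)).
  by apply: integrableS gsi => //; exact: measurable_itv.
have Efin : (\int[mu]_(t in A) (`|(g t - g x0)%R|%R)%:E \is a fin_num)%E.
  by apply: (integrable_fin_num _ gsi'); exact: measurable_itv.
have gE t : x0 - s <= t <= x0 + s -> (g \_ `[al, be]) t = g t.
  move=> /andP[t1 t2]; rewrite patchE mem_set//= in_itv/=.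
  by rewrite (le_trans (ltW als) t1) (le_trans t2 (ltW sbe)).
have := Hd s; rewrite /ball_/= sub0r normrN gtr0_norm// => /(_ sd s0).
rewrite /davg /iavg lebesgue_measure_ball ?(ltW s0)// (_ : ball _ _ = A); last exact: ball_itv.
have -> : (\int[mu]_(y in A)
     `|((center ((g \_ `[al, be]) x0) \o g \_ `[al, be]) y)%:E| =
     \int[mu]_(t in A) (`|(g t - g x0)%R|%R)%:E)%E.
  apply: eq_integral => t; rewrite inE /A /= in_itv/= => /andP[t1 t2].
  rewrite /= (gE t) ?(ltW t1) ?(ltW t2)// (gE x0) ?abse_EFin//.
  by rewrite lerBlDr lerDl (ltW s0).
rewrite -(I_oo gsi) -(fineK Efin) inver mulrn_eq0/= gt_eqF// -EFinM lte_fin.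
rewrite mulrC ltr_pdivrMr ?mulrn_wgt0// => /ltW; rewrite /Rintegral => h; apply: le_trans h _.
by rewrite le_eqVlt; apply/orP; left; apply/eqP; rewrite -mulr_natr; field.
Qed.

Lemma solvable_ex : ~ ae_zero Om (m^\+) -> exists p, 0 < p < 1 /\ exists u, solution Om b c m p u.
Proof.
move=> mpos.
(* Almost every point is a Lebesgue point of [mw]; if none of them had [mw > 0], then [m^+] would
   vanish almost everywhere. *)
have [x0 [x0ab mx0 leb]] : exists x0, [/\ al < x0 < be, 0 < mw x0 & lebesgue_pt (mw \_ `[al, be]) x0].
  have := lebesgue_differentiation (integrable_locally_restrict (measurable_itv `[al, be]) mw_itg).
  move=> ld; apply: contrapT => nex; apply: mpos.
  apply: aeS (aeI ld mmt) => x [lx mx]; rewrite /= in_itv/= => xab.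
  rewrite /funrpos mx//; apply/max_idPr; rewrite leNgt; apply/negP => mt0.
  by apply: nex; exists x; split=> //; rewrite mulr_gt0 ?expR_gt0.
have [B B0 PB] := coweight_bounded.
have ccC x : al <= x <= be -> 0 <= cc x <= B * C.
  move=> xab; rewrite cc_ge0/=; have /andP[h1 h2] := ct0 x.
  by apply: ler_pM => //; [exact: expR_ge0|exact: PB].
have [p [w [p01 cw w0 wpos wS]]] := subsol_of_lebesgue_point albe weight_continuous
  (fun x _ => weight_gt0 x) cc_itg ccC mw_itg mx0 x0ab
  (fun e e0 => lebesgue_pt_I mw_itg x0ab e0 leb).
by exists p; split=> //; exact: subsol_solution wS.
Qed.

End Problem.

(** * The set of exponents *)

Lemma upward_closed_subset (R : realType) (P : set R) : P !=set0 ->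
  (forall p, P p -> 0 < p < 1) -> (forall p q, P p -> p < q -> q < 1 -> P q) ->
  P = `]0, 1[%classic \/
  exists2 pstar : R, 0 < pstar < 1 &
    (P = `]pstar, 1[%classic) \/ (P = `[pstar, 1[%classic).
Proof.
move=> [p0 Pp0] P01 Pup; have /andP[p00 p01] := P01 _ Pp0.
have hP : has_inf P by split; [exists p0|exists 0 => p /P01/andP[/ltW]].
have i0 : 0 <= inf P by apply: lb_le_inf; [exists p0|move=> p /P01/andP[/ltW]].
have i1 : inf P < 1 by apply: le_lt_trans p01; apply: ge_inf => //; case: hP.
have Pge p : P p -> inf P <= p by move=> Pp; apply: ge_inf => //; case: hP.
have Pgt p : inf P < p -> p < 1 -> P p.
  move=> ip p1; have [|q Pq] := @inf_adherent _ P (p - inf P) _ hP; first by rewrite subr_gt0.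
  by rewrite addrC subrK => qp; exact: Pup Pq qp p1.
have Plt p : P p -> p < 1 by move=> /P01/andP[].
have [i00|i00] := eqVneq (inf P) 0.
  left; apply/seteqP; split=> p /=; rewrite in_itv/=; first exact: P01.
  by move=> /andP[p_0 p1]; apply: Pgt; rewrite ?i00.
right; exists (inf P); first by rewrite lt_neqAle eq_sym i00 i0.
have [Pi|Pi] := pselect (P (inf P)); [right|left]; apply/seteqP; split=> p /=; rewrite in_itv/=.
- by move=> Pp; rewrite Pge//= Plt.
- by move=> /andP[]; rewrite le_eqVlt => /predU1P[<-//|]; exact: Pgt.
- move=> Pp; rewrite Plt// andbT lt_neqAle Pge// andbT.
  by apply/eqP => E; apply: Pi; rewrite E.
- by move=> /andP[]; exact: Pgt.
Qed.

Theorem corollary3p10 (R : realType) (alpha beta : R) (b c m : R -> R)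
    (Omega := `]alpha, beta[%classic : set R)
    (Mplus := [set x | Omega x /\ 0 <= m x] : set R)
    (P := solvable_exponents Omega b c m : set R) :
  alpha < beta ->
  {within `[alpha, beta], continuous b} ->
  Lp Omega +oo%E c ->
  {ae (@lebesgue_measure R), forall x, Omega x -> 0 <= c x} ->
  Lp Omega 2%:E m ->
  changes_sign Omega m ->
  {within Mplus, continuous m} ->
  ~ ae_zero Omega (m^\+) ->
  P = `]0, 1[%classic \/
  exists2 pstar : R, 0 < pstar < 1 &
    (P = `]pstar, 1[%classic) \/ (P = `[pstar, 1[%classic).
Proof.
move=> albe cb cL c0 mL _ _ mpos.
have [mt [mti mt2i mmt]] := Lp2_representative mL.
have [ct [C [ctm ct0 cct]]] := Lpoo_representative cL c0.
apply: upward_closed_subset.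
- by apply: (solvable_ex albe cb ctm ct0 cct mti mt2i mmt mpos).
- by move=> p [].
move=> p q [/andP[p0 _] [u us]] pq q1; split; first by rewrite (lt_trans p0 pq).
exact: (solvable_up albe cb ctm ct0 cct mti mt2i mmt p0 pq q1 us).
Qed.
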